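(* Let $\alpha,\beta\in\mathbb{R}$ satisfy $0\le\alpha<\beta+1$ and $\beta\le2\alpha$, and let $\Omega$ be a nonempty bounded open subset of $\mathbb{R}^2_+$. Then $$h_{\alpha,\beta}(\Omega)\ \ge\ h_{\alpha,\beta}(\Omega^\bigstar)=\frac{P_\alpha(\Omega^\bigstar)}{A_\beta(\Omega^\bigstar)}.$$
   Context: $\mathbb{R}^2_+:=\{(x,y)\in\mathbb{R}^2:\ y>0\}$. For measurable $E\subset\mathbb{R}^2_+$, the weighted area is $A_\beta(E):=\iint_E y^\beta\,dx\,dy$, and the weighted relative perimeter is $$P_\alpha(E):=\sup\left\{\iint_E \operatorname{div}(y^\alpha\mathbf{v})\,dx\,dy:\ \mathbf{v}\in C^1_0(\mathbb{R}^2_+,\mathbb{R}^2),\ |\mathbf{v}|\le1\text{ in }E\right\}\in[0,+\infty],$$ where $C_0^1$ denotes $C^1$ vector fields with compact support in the open half-plane $\mathbb{R}^2_+$. The weighted Cheeger constant of an open bounded set $\Omega\subset\mathbb{R}^2_+$ is $$h_{\alpha,\beta}(\Omega):=\inf\left\{\frac{P_\alpha(E)}{A_\beta(E)}:\ E\subset\Omega\text{ measurable},\ 0<A_\beta(E)<+\infty\right\}.$$ Set $$\Omega^\star:=\{(x,y):\ |x|<f(y),\ 0<y<1\},\qquad f(y):=\int_y^1\frac{t^{\beta-\alpha+1}}{\sqrt{1-t^{2(\beta-\alpha+1)}}}\,dt\quad(0<y<1).$$ $\Omega^\bigstar$ denotes the dilate $t\Omega^\star$, where $t>0$ is chosen such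 that $A_\beta(t\Omega^\star)=A_\beta(\Omega)$. *)

(* Defs.v *)
From HB Require Import structures.
From mathcomp Require Import all_boot all_order all_algebra.
From mathcomp Require Import all_classical all_reals all_analysis.
From mathcomp Require Import measurable_realfun.
Set Implicit Arguments.
Unset Strict Implicit.
Unset Printing Implicit Defensive.
Import Order.TTheory GRing.Theory Num.Theory.
Import numFieldNormedType.Exports.
Local Open Scope classical_set_scope.
Local Open Scope ring_scope.

Definition half_plane {R : realType} : set (R * R) := [set p | 0 < p.2].

Notation lebesgue_measure2 R :=
  (@lebesgue_measure R \x @lebesgue_measure R)%E (only parsing).

(* [measurable] on [R * R] only contains the Borel sets; the Lebesgue sets are
   the unions of a Borel set and a negligible set. The library integral over
   such a set is the usual one (it is a supremum over Borel simple functions,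
   for the positive and the negative part). *)
Definition lebesgue_measurable2 {R : realType} (E : set (R * R)) : Prop :=
  completed_algebra_gen (lebesgue_measure2 R) E.

(* The library norm on [R * R] is the maximum norm. *)
Definition euclidean_norm {R : realType} (u : R * R) : R :=
  Num.sqrt (u.1 ^+ 2 + u.2 ^+ 2).

Definition ex {R : realType} : R * R := (1, 0).
Definition ey {R : realType} : R * R := (0, 1).

Definition C1 {R : realType} (g : R * R -> R) : Prop :=
  [/\ forall p, derivable g p ex, forall p, derivable g p ey,
      continuous (fun p => 'D_ex g p) & continuous (fun p => 'D_ey g p)].

(* Fields on the half-plane are represented by their extension by zero to the
   whole plane, which is of class C^1 because the support is a compact subset
   of the open half-plane. *)
Definition C1_0 {R : realType} (v : R * R -> R * R) : Prop :=
  [/\ C1 (fun p => (v p).1), C1 (fun p => (v p).2),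
      compact (closure [set p | v p != 0]) &
      closure [set p | v p != 0] `<=` half_plane].

Definition divergence {R : realType} (w : R * R -> R * R) (p : R * R) : R :=
  'D_ex (fun q => (w q).1) p + 'D_ey (fun q => (w q).2) p.

Definition weighted_area {R : realType} (beta : R) (E : set (R * R)) : \bar R :=
  (\int[lebesgue_measure2 R]_(p in E) (p.2 `^ beta)%:E)%E.

Definition weighted_perimeter {R : realType} (alpha : R) (E : set (R * R)) :
    \bar R :=
  ereal_sup
    [set (\int[lebesgue_measure2 R]_(p in E)
            (divergence (fun q => q.2 `^ alpha *: v q) p)%:E)%E
    | v in [set v : R * R -> R * R |
             C1_0 v /\ forall p, E p -> euclidean_norm (v p) <= 1]].

Definition cheeger {R : realType} (alpha beta : R) (Omega : set (R * R)) :
    \bar R :=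
  ereal_inf
    [set (weighted_perimeter alpha E / weighted_area beta E)%E
    | E in [set E : set (R * R) |
             [/\ E `<=` Omega, lebesgue_measurable2 E,
                 (0 < weighted_area beta E)%E &
                 (weighted_area beta E < +oo)%E]]].

Definition star_profile {R : realType} (alpha beta y : R) : R :=
  \int[@lebesgue_measure R]_(t in `]y, 1[)
    (t `^ (beta - alpha + 1)
       / Num.sqrt (1 - t `^ (2 * (beta - alpha + 1)))).

Definition Omega_star {R : realType} (alpha beta : R) : set (R * R) :=
  [set p | `|p.1| < star_profile alpha beta p.2 /\ 0 < p.2 < 1].

Definition dilate {R : realType} (t : R) (A : set (R * R)) : set (R * R) :=
  [set t *: p | p in A].

(* Main.v *)
(* For a bounded Borel set [E], put [S] for the set of heights at which the
   slice of [E] is nonnegligible. The vertical component of a test field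
   [y^alpha v] may be prescribed as a function [lam y^(beta+1) - C(y)] whose
   level [C] moves only off [S], as long as it stays below [y^alpha] in absolute
   value; on [S] its divergence is then [lam (beta+1) y^beta]. The horizontal
   component points outwards from a short window that almost fills part of the
   slice, and collects at each height twice the length left free by the vertical
   one. Optimising over the pairs of heights where the level can be reset
   produces [lam = t^-k], with [k = beta - alpha + 1], for which
     P(E) >= (beta+1) t^-k A(E) + 2 kappa t^(alpha+1);
   a comparison of the superlevel sets of the horizontal component with those of
   the arc that bounds [t Omega*] gives the constant [kappa]. This is an
   equality for [t Omega*], by the Gauss-Green formula on a region below a graph.
   Dividing by [A(E)] and using weighted AM-GM in [t] bounds [P(E)/A(E)] from
   below by the quotient of any [t Omega*] whose area is at least [A(E)]. *)


Require Import Defs.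
From HB Require Import structures.
From mathcomp Require Import all_boot all_order all_algebra.
From mathcomp Require Import all_classical all_reals all_analysis.
From mathcomp Require Import measurable_realfun ring lra.
Import Order.TTheory GRing.Theory Num.Theory.
Import numFieldNormedType.Exports.
Set Implicit Arguments.
Unset Strict Implicit.
Unset Printing Implicit Defensive.
Local Open Scope classical_set_scope.
Local Open Scope ring_scope.

(** * Power inequalities *)

(** The field is modelled on the calibration of [t Omega*]: there the vertical component is
    [(y/t)^k], which reaches length 1 exactly at the top [y = t], and the slope of the boundary is
    its ratio to the length left for the horizontal component. For a general set the heights of
    nonnegligible slices need not start at 0, which is why the level must be reset on the gaps. A
    gap, however short, permits any reset within the bounds, since the field may be arbitrarily
    steep where it meets almost nothing of the set; the multiplier [lam] is limited only by pairs of
    heights with almost no gap between them. The constant [kappa] is the horizontal contribution of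
    the arc that leaves the boundary line at level 0. Arcs that start higher up are compared with it
    through an inequality on powers that rests on [beta <= 2 alpha]. For [beta <= alpha] this
    comparison works with a vertical component that is nonnegative up to smoothing errors; for
    [beta > alpha] it uses values down to [- y^alpha]. Hence the two cases of the barrier below. *)

(* The bound below zero for the vertical component of a test field. It has to
   vanish at [0], which [y `^ alpha] does not when [alpha = 0]. *)
Definition lower_barrier {R : realType} (alpha beta y : R) : R :=
  if beta <= alpha then 0 else y `^ alpha.

Section powers.
Context {R : realType}.
Implicit Types a b x y s t k : R.

Lemma powR_add_gt0 x a b : 0 < x -> x `^ (a + b) = x `^ a * x `^ b.
Proof. by move=> x0; rewrite powRD// (gt_eqF x0) implybT. Qed.

Lemma powR_le1 x a : 0 <= a -> 0 <= x <= 1 -> x `^ a <= 1.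
Proof.
move=> a0 /andP[x0 x1].
have -> : 1 = 1 `^ a :> R by rewrite powR1.
by apply: ge0_ler_powR => //; rewrite nnegrE.
Qed.

Lemma powR_antimono01 x a b : 0 <= x <= 1 -> 0 < a -> a <= b -> x `^ b <= x `^ a.
Proof.
move=> /andP[x0 x1] a0 ab; move: x0; rewrite le_eqVlt => /predU1P[<-|x0].
  by rewrite !powR0 ?gt_eqF// (lt_le_trans a0).
by apply: ger_powR => //; rewrite x0.
Qed.

Lemma lower_barrier_ge0 a b y : 0 <= lower_barrier a b y.
Proof. by rewrite /lower_barrier; case: ifP => // _; exact: powR_ge0. Qed.

Lemma lower_barrier_le a b y : lower_barrier a b y <= y `^ a.
Proof. by rewrite /lower_barrier; case: ifP => // _; exact: powR_ge0. Qed.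

Lemma lower_barrier0 a b : 0 <= a -> b <= 2 * a -> lower_barrier a b 0 = 0.
Proof.
move=> a0 b2a; rewrite /lower_barrier; case: ifPn => //; rewrite -ltNge => ab.
by rewrite powR0// gt_eqF//; lra.
Qed.

Lemma lower_barrierM a b x y : 0 <= x -> 0 <= y ->
  lower_barrier a b (x * y) = lower_barrier a b x * y `^ a.
Proof.
move=> x0 y0; rewrite /lower_barrier; case: ifPn => _; first by rewrite mul0r.
by rewrite powRM.
Qed.

(** If [b <= a], then [x^(a+1) <= x^(b+1)] on the unit interval. Otherwise the product expands to
    [1 + x^a - x^(a+1) - x^(2a+1)], and [b <= 2a] gives [x^(2a+1) <= x^(b+1)]. *)
Lemma barrier_inequality a b x : 0 <= a -> a < b + 1 -> b <= 2 * a ->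
  0 <= x <= 1 ->
  1 - x `^ (b + 1) <= (1 - x `^ (a + 1)) * (1 + lower_barrier a b x).
Proof.
move=> a0 ab b2a x01; rewrite /lower_barrier.
have a1 : 0 < a + 1 by lra.
have b1 : 0 < b + 1 by lra.
case: ifPn => [ba|].
  rewrite addr0 mulr1 lerD2l lerN2.
  by apply: powR_antimono01 => //; lra.
rewrite -ltNge => ltab.
have ap : 0 < a by lra.
have h1 : x `^ (a + 1) <= x `^ a by apply: powR_antimono01 => //; lra.
have h2 : x `^ (a + (a + 1)) <= x `^ (b + 1) by apply: powR_antimono01 => //; lra.
have h3 : x `^ (a + (a + 1)) = x `^ a * x `^ (a + 1).
  rewrite powRD//; apply/implyP => /eqP h.
  by exfalso; lra.
rewrite h3 in h2; lra.
Qed.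

(* The layer [|b| < s] of a tight arc is [(u, v)], and the corresponding layer
   of the arc starting on the boundary is [(0, t * s `^ k^-1)]. *)
Lemma layer_inequality a b t s u v : 0 <= a -> a < b + 1 -> b <= 2 * a ->
  0 < t -> 0 < s -> 0 < v -> 0 <= u <= v ->
  s * (v `^ a + lower_barrier a b u) =
    t `^ (- (b - a + 1)) * (v `^ (b + 1) - u `^ (b + 1)) ->
  (t * s `^ (b - a + 1)^-1) `^ (a + 1) <= v `^ (a + 1) - u `^ (a + 1).
Proof.
move=> a0 ab b2a t0 s0 v0 /andP[u0 uv] E.
set k := b - a + 1 in E *.
have k0 : 0 < k by rewrite /k; lra.
have a1 : 0 < a + 1 by lra.
(* By homogeneity only the ratio of the end points matters once [v^(b+1)] is split as [v^k v^a]. *)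
set x := u / v.
have x01 : 0 <= x <= 1.
  by rewrite /x divr_ge0 ?(ltW v0)//= ler_pdivrMr// mul1r.
have ux : u = x * v by rewrite /x divfK// gt_eqF.
have [x0 x1] := andP x01.
have v0' := ltW v0.
have vk : v `^ (b + 1) = v `^ k * v `^ a.
  by rewrite -powR_add_gt0//; congr (_ `^ _); rewrite /k; ring.
have va0 : 0 < v `^ a by exact: powR_gt0.
have B0 := lower_barrier_ge0 a b x.
have E1 : s * (1 + lower_barrier a b x) =
    t `^ (- k) * v `^ k * (1 - x `^ (b + 1)).
  apply: (mulIf (lt0r_neq0 va0)).
  move: E; rewrite ux lower_barrierM// powRM// vk => E.
  transitivity (s * (v `^ a + lower_barrier a b x * v `^ a)); first by ring.
  by rewrite E; ring.
set X := x `^ (a + 1).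
have X01 : 0 <= 1 - X by rewrite subr_ge0 powR_le1// ltW.
have tk0 : 0 < t `^ (- k) by exact: powR_gt0.
have vk0 : 0 < v `^ k by exact: powR_gt0.
have sle : s <= t `^ (- k) * v `^ k * (1 - X).
  have D0 : 0 < 1 + lower_barrier a b x by lra.
  rewrite -(ler_pM2r D0) E1 -[leRHS]mulrA ler_pM2l ?mulr_gt0//.
  by apply: barrier_inequality.
have sk : s `^ k^-1 <= t^-1 * v * (1 - X) `^ k^-1.
  have -> : t^-1 * v * (1 - X) `^ k^-1 = (t `^ (- k) * v `^ k * (1 - X)) `^ k^-1.
    rewrite !powRM ?mulr_ge0 ?powR_ge0// -!powRrM mulNr mulfV ?gt_eqF//.
    by rewrite powR_inv1 ?(ltW t0)// powRr1.
  apply: ge0_ler_powR => //; rewrite ?nnegrE ?invr_ge0 ?(ltW k0) ?(ltW s0)//.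
  by rewrite !mulr_ge0// ?powR_ge0.
have tsk : t * s `^ k^-1 <= v * (1 - X) `^ k^-1.
  rewrite -(ler_pM2l t0) in sk; apply: (le_trans sk).
  by rewrite !mulrA mulfV ?gt_eqF// mul1r.
apply: (@le_trans _ _ ((v * (1 - X) `^ k^-1) `^ (a + 1))).
  apply: ge0_ler_powR => //; first exact: ltW.
    by rewrite nnegrE mulr_ge0 ?powR_ge0 ?(ltW t0).
  by rewrite nnegrE mulr_ge0 ?powR_ge0.
rewrite powRM ?powR_ge0// -powRrM ux (powRM _ x0)// -/X.
suff : (1 - X) `^ (k^-1 * (a + 1)) <= 1 - X.
  have : 0 < v `^ (a + 1) by exact: powR_gt0.
  nra.
have k1 : 1 <= k^-1 * (a + 1).
  by rewrite mulrC ler_pdivlMr// mul1r /k; lra.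
have X0 : 0 <= X by exact: powR_ge0.
rewrite -[leRHS]powRr1//.
by apply: powR_antimono01 => //; rewrite X01/=; lra.
Qed.

(** Both powers are bounded below by the tangent of the exponential, taken in the variable [ln rho];
    the weight [k / m] makes the two linear terms cancel. *)
Lemma weighted_AMGM rho k m : 0 < rho -> 0 < k -> 0 < m ->
  1 + k / m <= rho `^ (- k) + k / m * rho `^ m.
Proof.
move=> rho0 k0 m0.
have h1 : 1 + - k * ln rho <= rho `^ (- k).
  by rewrite /powR gt_eqF// expR_ge1Dx.
have h2 : 1 + m * ln rho <= rho `^ m.
  by rewrite /powR gt_eqF// expR_ge1Dx.
have km : 0 < k / m by rewrite divr_gt0.
have : k / m * (1 + m * ln rho) <= k / m * rho `^ m by rewrite ler_pM2l.
have -> : k / m * (1 + m * ln rho) = k / m + k * ln rho.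
  by field; rewrite gt_eqF.
lra.
Qed.

(** Powers are meaningful on nonnegative bases only; the truncation makes them continuous on the
    whole line, as the compactness and intermediate value arguments require. *)
Lemma continuous_powR_max0 a : 0 <= a ->
  continuous (fun y : R => (Num.max y 0) `^ a).
Proof.
suff h (y : R) : 0 <= a ->
    (Num.max z 0) `^ a @[z --> y] --> (Num.max y 0) `^ a.
  by move=> a0 y; exact: h.
move=> a0.
have [->|a_neq0] := eqVneq a 0.
  rewrite powRr0; under eq_fun do rewrite powRr0; exact: cvg_cst.
have {}a0 : 0 < a by rewrite lt_neqAle eq_sym a_neq0.
have [y0|y0|y0] := ltgtP y 0.
- rewrite (powR0 (lt0r_neq0 a0)).
  apply: cvg_near_cst; near=> z.
  have z0 : z < 0 by near: z; exact: (lt_nbhsl y0).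
  by rewrite max_r ?(ltW z0)// powR0// gt_eqF.
- apply: (@cvg_trans _ (z `^ a @[z --> y])).
    apply: near_eq_cvg; near=> z.
    have z0 : 0 < z by near: z; exact: (lt_nbhsr y0).
    by rewrite max_l ?(ltW z0).
  have [+ _] := is_derive1_powR a y0.
  by move/derivable1_diffP/differentiable_continuous.
- rewrite y0 powR0 ?gt_eqF//.
  apply/cvgrPdist_lt => e e0.
  have e0' : 0 < e `^ a^-1 by exact: powR_gt0.
  near=> z.
  rewrite sub0r normrN ger0_norm ?powR_ge0//.
  have h : Num.max z 0 < e `^ a^-1.
    by rewrite gt_max e0' andbT; near: z; exact: (lt_nbhsl e0').
  have := @gt0_ltr_powR _ a a0 (Num.max z 0) (e `^ a^-1).
  rewrite -powRrM mulVf ?gt_eqF// powRr1 ?(ltW e0)//; apply => //.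
  - by rewrite nnegrE le_max lexx orbT.
  - by rewrite nnegrE powR_ge0.
Unshelve. all: by end_near. Qed.

End powers.

(** * One-variable calculus *)

Section calculus.
Context {R : realType}.
Local Notation mu := (@lebesgue_measure R).
Implicit Types (F f : R -> R) (a b : R).

Lemma derive_continuous f (x d : R) : is_derive x 1 f d -> {for x, continuous f}.
Proof. by case=> /derivable1_diffP/differentiable_continuous. Qed.

Lemma FTC2_cc F f a b : a < b ->
  (forall x, a <= x <= b -> is_derive x 1 F (f x)) ->
  (forall x, a <= x <= b -> {for x, continuous f}) ->
  (\int[mu]_(x in `[a, b]) (f x)%:E = (F b - F a)%:E)%E.
Proof.
move=> ab dF cf; rewrite (continuous_FTC2 (F := F))//.
- apply: continuous_in_subspaceT => x; rewrite inE/= in_itv/= => /cf; exact.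
- split=> [x| |].
  + by rewrite in_itv/= => /andP[ax xb]; have [] := dF x; rewrite ?(ltW ax) ?(ltW xb).
  + apply: cvg_at_right_filter; apply: (@derive_continuous _ _ (f a)); apply: dF.
    by rewrite lexx ltW.
  + apply: cvg_at_left_filter; apply: (@derive_continuous _ _ (f b)); apply: dF.
    by rewrite lexx ltW.
- move=> x; rewrite in_itv/= => /andP[ax xb].
  have dFx : is_derive x 1 F (f x) by apply: dF; rewrite ?(ltW ax) ?(ltW xb).
  by rewrite derive1E derive_val.
Qed.

(** Only one-sided limits of [F] are assumed at the end points, where [f] may blow up, as the slope
    of the star profile does at its top. Compact intervals exhaust the open one and the integrals
    converge monotonically. *)
Lemma ge0_FTC2_oo F f a b : a < b ->
  (forall x, a < x < b -> is_derive x 1 F (f x)) ->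
  (forall x, a < x < b -> {for x, continuous f}) ->
  (forall x, a < x < b -> 0 <= f x) ->
  F x @[x --> a^'+] --> F a -> F x @[x --> b^'-] --> F b ->
  (\int[mu]_(x in `]a, b[) (f x)%:E = (F b - F a)%:E)%E.
Proof.
move=> ab dF cf f0 Fa Fb.
(* The factor 1/3 makes the compact intervals nondegenerate from the first index on. *)
pose d n : R := (b - a) / 3 * harmonic n.
have ba3 : 0 < (b - a) / 3 by lra.
have d0 n : 0 < d n by rewrite mulr_gt0// invr_gt0.
have nd_d m n : (m <= n)%N -> d n <= d m.
  by move=> mn; rewrite ler_pM2l// lef_pV2 ?posrE ?ltr0n// ler_nat.
have d_lt n : a + d n < b - d n.
  have : d n <= (b - a) / 3 by rewrite (le_trans (nd_d 0 n isT))// /d /harmonic/= invr1 mulr1.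
  by lra.
have d_cvg : d n @[n --> \oo] --> 0.
  rewrite -(mulr0 ((b - a) / 3)); apply: cvgMr; exact: cvg_harmonic.
pose A n : set R := `[a + d n, b - d n]%classic.
have bigA : \bigcup_n A n = `]a, b[%classic.
  apply/seteqP; split=> x /=.
    move=> [n _]; rewrite /A /= !in_itv/= => /andP[h1 h2].
    by have := d0 n; lra.
  rewrite in_itv/= => /andP[h1 h2].
  have : \forall n \near \oo, d n < Num.min (x - a) (b - x).
    have m0 : 0 < Num.min (x - a) (b - x) by rewrite lt_min; lra.
    by apply: cvgr_lt d_cvg _ _.
  move=> [n _ /(_ n (leqnn n))]; rewrite lt_min => /andP[h3 h4].
  by exists n => //; rewrite /A /= in_itv/=; lra.
have ndA : nondecreasing_seq A.
  move=> m n mn; apply/subsetPset => x; rewrite /A /= !in_itv/= => /andP[h1 h2].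
  have dle := nd_d _ _ mn.
  by lra.
have mf : measurable_fun (`]a, b[%classic : set R) (EFin \o f).
  apply/measurable_EFinP; apply: open_continuous_measurable_fun.
    exact: interval_open.
  by move=> x; rewrite inE/= in_itv/=; exact: cf.
have intA n : (\int[mu]_(x in A n) (f x)%:E = (F (b - d n) - F (a + d n))%:E)%E.
  apply: FTC2_cc => // x /andP[h1 h2]; [apply: dF|apply: cf];
    by have := d0 n; lra.
have mfA n : measurable_fun (A n) (EFin \o f).
  by apply: (measurable_funS _ _ mf) => //; rewrite -bigA; exact: bigcup_sup.
have f0A n x : A n x -> (0 <= (EFin \o f) x)%E.
  rewrite /A/= in_itv/= lee_fin => /andP[h1 h2]; apply: f0.
  by have := d0 n; lra.
have := @ge0_nondecreasing_set_cvg_integral _ (measurableTypeR R) R A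
  (EFin \o f) lebesgue_measure ndA
  (fun n => measurable_itv _) mfA f0A.
rewrite bigA => /cvg_lim <- //; apply: cvg_lim => //.
under eq_fun do rewrite intA.
apply: cvg_EFin; first by near=> n.
have cb : F (b - d n) @[n --> \oo] --> F b.
  have := Fb; rewrite (cvg_at_leftP F b (F b)).
  apply; split; first by move=> n; have := d0 n; lra.
  by rewrite -[X in _ --> X]subr0; apply: cvgB => //; exact: cvg_cst.
have ca : F (a + d n) @[n --> \oo] --> F a.
  have := Fa; rewrite (cvg_at_rightP F a (F a)).
  apply; split; first by move=> n; have := d0 n; lra.
  by rewrite -[X in _ --> X]addr0; apply: cvgD => //; exact: cvg_cst.
exact: cvgB cb ca.
Unshelve. all: by end_near. Qed.

Lemma antiderivative f : continuous f -> exists F, forall x : R, is_derive x 1 F (f x).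
Proof.
move=> cf.
(* An oriented integral: for each [x] at least one of the two intervals is empty. *)
pose F x := \int[mu]_(t in `]0, x]) f t - \int[mu]_(t in `]x, 0]) f t.
exists F => x.
pose a := Num.min x 0 - 1; pose u := Num.max x 0 + 1.
have ax : a < x by rewrite /a ltrBlDr gt_min ltrDl ltr01.
have a0 : a < 0 by rewrite /a ltrBlDr gt_min ltrDl ltr01 orbT.
have xu : x < u by rewrite /u -ltrBlDr lt_max gtrBl ltr01.
have u0 : 0 < u by rewrite /u -ltrBlDr lt_max gtrBl ltr01 orbT.
have intf c d : mu.-integrable `[c, d] (EFin \o f).
  apply: continuous_compact_integrable; first exact: segment_compact.
  exact: continuous_subspaceT.
pose G x := \int[mu]_(t in `[a, x]) f t.
have GB y z : a <= y -> y <= z -> G z - G y = \int[mu]_(t in `]y, z]) f t.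
  move=> ay yz.
  by apply: (@Rintegral_itvB R f (BLeft a) (BRight z) y); rewrite ?bnd_simp.
have I0 y z : z <= y -> \int[mu]_(t in `]y, z]) f t = 0.
  by move=> zy; rewrite set_itv_ge ?Rintegral_set0// bnd_simp -leNgt.
have FG z : a < z -> F z = G z - G 0.
  move=> az; rewrite /F; have [z0|z0] := leP 0 z.
    by rewrite (I0 _ _ z0) subr0 GB// ltW.
  by rewrite (I0 _ _ (ltW z0)) sub0r -GB ?(ltW az) ?(ltW z0)// opprB.
have [dG G'] : derivable G x 1 /\ derive1 G x = f x.
  apply: (@continuous_FTC1 _ f (BLeft a) x u) => //; last exact: cf.
have dH : is_derive x 1 (fun z => G z - G 0) (f x).
  rewrite derive1E in G'; have ? : is_derive x 1 G (f x) := DeriveDef dG G'.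
  by rewrite -[f x]subr0; apply: is_deriveB.
apply: near_eq_is_derive dH; near=> z.
by rewrite FG//; near: z; exact: (lt_nbhsr ax).
Unshelve. all: by end_near. Qed.

End calculus.

(** * Integrals over Lebesgue measurable sets *)

Section completed_sets.
Context d (T : measurableType d) {R : realType}.
Variable mu : {measure set T -> \bar R}.
Local Open Scope ereal_scope.

(* No measurability is assumed: the integral of a nonnegative function is a
   supremum over simple functions below it. *)
Lemma ge0_subset_integral_nonmeas (A B : set T) (f : T -> \bar R) :
  (forall x, B x -> 0 <= f x) -> A `<=` B ->
  \int[mu]_(x in A) f x <= \int[mu]_(x in B) f x.
Proof.
move=> f0 AB; rewrite !ge0_integralE//; last by move=> x /AB; exact: f0.
apply: le_ereal_sup => _ [h hf <-]; exists h => //= x.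
apply: (le_trans (hf x)); rewrite /patch; case: ifPn => xA.
  by rewrite ifT// inE; apply: AB; rewrite inE in xA.
by case: ifPn => // xB; apply: f0; rewrite inE in xB.
Qed.

(** The union need not be measurable. It lies between [A] and the union of [A] with a measurable
    null set containing [N]; monotonicity is applied to the positive and negative parts of [f]
    separately. *)
Lemma integral_setU_negligible (A N : set T) (f : T -> \bar R) :
  measurable A -> mu.-negligible N -> measurable_fun setT f ->
  \int[mu]_(x in A `|` N) f x = \int[mu]_(x in A) f x.
Proof.
move=> mA [M [mM M0 NM]] mf.
have H g : measurable_fun setT g -> (forall x, 0 <= g x) ->
    \int[mu]_(x in A `|` N) g x = \int[mu]_(x in A) g x.
  move=> mg g0; apply/eqP; rewrite eq_le; apply/andP; split; last first.
    by apply: ge0_subset_integral_nonmeas => //; exact: subsetUl.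
  have mAM : measurable (A `|` M) by exact: measurableU.
  apply: (@le_trans _ _ (\int[mu]_(x in A `|` M) g x)).
    by apply: ge0_subset_integral_nonmeas => //; exact: setUS.
  rewrite (@ge0_negligible_integral _ _ _ _ _ M)//; last exact: measurable_funTS.
  by apply: ge0_subset_integral_nonmeas => // x [[]].
rewrite integralE [RHS]integralE !H//.
- exact: measurable_funeneg.
- exact: measurable_funepos.
Qed.

End completed_sets.

(** * Lebesgue density on forward windows *)

Section density.
Context {R : realType}.
Local Notation mu := (@lebesgue_measure R).
Implicit Types (D F : set R) (y r : R).

(** Windows point forward to match the forward differences used for smoothing: this number tells how
    far a smoothed indicator of [D] falls short of 1. *)
Definition right_defect D r y : R := fine (mu (`]y, y + r]%classic `\` D)) / r.

Lemma lebesgue_measure_itvoc y r : 0 <= r -> mu `]y, y + r]%classic = r%:E.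
Proof.
move=> r0; rewrite lebesgue_measure_itv/= lte_fin ltrDl.
case: ltgtP r0 => // [r0 _|<- _//].
by rewrite -EFinD addrAC subrr add0r.
Qed.

Lemma measure_itv_setD D y r : measurable D -> 0 <= r ->
  (0 <= mu (`]y, (y + r)%R]%classic `\` D) <= r%:E)%E.
Proof.
move=> mD r0; rewrite measure_ge0/= -(lebesgue_measure_itvoc y r0).
by apply: le_measure; rewrite ?inE//; apply: measurableD.
Qed.

Lemma measure_itv_setD_fin D y r : measurable D -> 0 <= r ->
  mu (`]y, y + r]%classic `\` D) \is a fin_num.
Proof.
move=> mD r0; have /andP[h1 h2] := measure_itv_setD y mD r0.
by rewrite ge0_fin_numE// (le_lt_trans h2)// ltry.
Qed.

Lemma right_defect_itv D r y : measurable D -> 0 < r ->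
  0 <= right_defect D r y <= 1.
Proof.
move=> mD r0; rewrite /right_defect.
have /andP[h1 h2] := measure_itv_setD y mD (ltW r0).
rewrite divr_ge0 ?fine_ge0 ?(ltW r0)//= ler_pdivrMr// mul1r.
by rewrite -lee_fin fineK// measure_itv_setD_fin// ltW.
Qed.

(** The missed parts of the windows are the sections of a single planar Borel set. *)
Lemma measurable_right_defect D r : measurable D -> measurable_fun setT (right_defect D r).
Proof.
move=> mD; apply: measurable_funM => //.
have mB : measurable [set p : R * R | p.1 < p.2 /\ p.2 <= p.1 + r /\ ~ D p.2].
  have -> : [set p : R * R | p.1 < p.2 /\ p.2 <= p.1 + r /\ ~ D p.2] =
     ((fun p : R * R => p.2 - p.1) @^-1` `]0, r]%classic) `&` (setT `*` ~` D).
    apply/seteqP; split=> -[x y]/=; rewrite in_itv/= subr_gt0 lerBlDl.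
      by move=> [h1 [h2 h3]]; rewrite h1.
    by move=> [/andP[h1 h2] [_ h3]].
  apply: measurableI; last by apply: measurableX => //; exact: measurableC.
  rewrite -[X in measurable X]setTI.
  apply: (measurable_funB (f := snd) (g := fst)) => //.
have -> : (fun y => fine (mu (`]y, y + r]%classic `\` D))) =
   fine \o (mu \o xsection [set p : R * R | p.1 < p.2 /\ p.2 <= p.1 + r /\ ~ D p.2]).
  apply/funext => y/=; congr (fine (mu _)); apply/seteqP; split=> x /=.
    by rewrite in_itv/= => -[/andP[h1 h2] h3]; rewrite /xsection/= inE.
  by rewrite /xsection/= inE/= in_itv/= => -[-> [->]].
apply: measurableT_comp => //.
exact: measurable_fun_xsection.
Qed.

(** The forward window is half of the ball of the same radius, so its defect is at most twice that
    of the ball, which tends to 0 at density points. *)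
Lemma right_defect_cvg0 D : measurable D ->
  {ae mu, forall x, D x -> right_defect D (harmonic n) x @[n --> \oo] --> 0}.
Proof.
move=> mD; have [N [mN N0 subN]] := lebesgue_density mD.
exists N; split => // x /= h; apply: subN => /= dens; apply: h => Dx.
rewrite indicE mem_set//= in dens.
have h0 : harmonic n @[n --> \oo] --> (0 : R)^'+.
  move=> A [e /= e0 eA]; have /cvgrPdist_lt /(_ e e0) := @cvg_harmonic R.
  by apply: filterS => n h; apply: eA; [|exact: harmonic_gt0].
have {}dens := cvg_comp _ _ h0 dens.
have h2 n : (mu (ball x (@harmonic R n)) = (2 * harmonic n)%:E)%E.
  rewrite lebesgue_measure_ball ?mulr_natl//; exact/ltW/harmonic_gt0.
have hlt n : (mu (ball x (@harmonic R n)) < +oo)%E by rewrite h2 ltry.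
have {}dens : 2 * (1 - fine (mu (D `&` ball x (harmonic n)) * (mu (ball x (harmonic n)))^-1))
    @[n --> \oo] --> 0.
  rewrite -(mulr0 2) -(subrr 1); apply: cvgMr; apply: cvgB; first exact: cvg_cst.
  by apply: fine_cvg.
apply: (squeeze_cvgr _ (cvg_cst 0) dens); near=> n.
rewrite -[n.+1%:R^-1]/(@harmonic R n).
move: (@harmonic_gt0 R n) (h2 n) (hlt n); move: (harmonic n) => h hn h2h hlth.
have [d0 d1] := andP (right_defect_itv x mD hn).
apply/andP; split; [exact: d0|rewrite /right_defect].
have mB := measurable_ball x h.
have finDB : mu (D `&` ball x h) \is a fin_num.
  rewrite ge0_fin_numE//; apply: (le_lt_trans (le_measure _ _ _ (@subIsetr _ _ _))).
  - by rewrite inE; exact: measurableI.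
  - by rewrite inE.
  - exact: hlth.
rewrite h2h inver; case: ifPn => [/eqP|_]; first by move: hn; lra.
rewrite fineM//= ler_pdivrMr//.
have -> : 2 * (1 - fine (mu (D `&` ball x h)) / (2 * h)) * h
   = 2 * h - fine (mu (D `&` ball x h)).
  by field; rewrite gt_eqF.
rewrite -lee_fin EFinB fineK ?measure_itv_setD_fin ?(ltW hn)// fineK// -h2h.
have -> : (mu (ball x h) - mu (D `&` ball x h) =
    mu (ball x h `\` D))%E.
  by rewrite setIC measureD//=; exact: hlth.
have sub : `]x, x + h]%classic `\` D `<=`
    (ball x h `\` D) `|` [set x + h].
  move=> z /=; rewrite in_itv/= => -[/andP[z1 z2] nD].
  move: z2; rewrite le_eqVlt => /predU1P[->|z2]; first by right.
  left; split => //; rewrite ball_itv/= in_itv/= z2 andbT.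
  by rewrite (lt_trans _ z1)// ltrBlDr ltrDl.
apply: (@le_trans _ _ (mu ((ball x h `\` D) `|` [set (x + h)%R]))).
  apply: le_measure => //; rewrite inE; first exact: measurableD.
  by apply: measurableU => //; exact: measurableD.
apply: (le_trans (measureU2 _ _ _)) => //; first exact: measurableD.
by rewrite [X in (_ + X)%E]lebesgue_measure_set1 adde0.
Unshelve. all: by end_near. Qed.

Lemma integral_right_defect_cvg0 D : measurable D -> (mu D < +oo)%E ->
  (\int[mu]_(x in D) (right_defect D (harmonic n) x)%:E)%E @[n --> \oo] --> 0%E.
Proof.
move=> mD Dfin.
have mrd n : measurable_fun D (EFin \o right_defect D (harmonic n)).
  apply/measurable_EFinP; apply: measurable_funTS; exact: measurable_right_defect.
have hcvg : {ae mu, forall x, D x ->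
    (right_defect D (harmonic n) x)%:E @[n --> \oo] --> (cst 0 x)%E}.
  have [N [mN N0 subN]] := right_defect_cvg0 mD.
  exists N; split => // x /= h; apply: subN => /= cvgx; apply: h => /cvgx c0.
  exact: cvg_EFin (nearW _ _) c0.
have bnd : {ae mu, forall x n, D x ->
    (`|(right_defect D (harmonic n) x)%:E| <= (cst 1 x))%E}.
  apply: aeW => x n _; rewrite lee_fin.
  have /andP[d0 d1] := right_defect_itv x mD (@harmonic_gt0 R n).
  by rewrite ger0_norm.
have i1 : mu.-integrable D (cst 1%E).
  apply/integrableP; split; first exact: measurable_cst.
  by under eq_integral do rewrite /= normr1; rewrite integral_cst// mul1e.
have [_ _] := @dominated_convergence _ (measurableTypeR R) R lebesgue_measure D mD
  _ (cst 0%E) (cst 1%E) mrd (measurable_cst _) hcvg i1 bnd.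
by rewrite integral0.
Qed.

(* Rational windows [`]q - 2 rho, q]]: only countably many are needed to reach
   every set of positive measure, which keeps the choice of the window
   measurable along the slices of a planar set. *)
Lemma dense_window F (e : R) : measurable F -> (0 < mu F)%E -> 0 < e ->
  exists (q : rat) (n : nat),
    (mu (`](ratr q - 2 * (harmonic n / 4))%R, ratr q]%classic `\` F) <
      (e * (harmonic n / 4))%:E)%E.
Proof.
move=> mF F0 e0.
have [x [Fx cvgx]] : exists x, F x /\ right_defect F (harmonic n) x @[n --> \oo] --> 0.
  apply/not_existsP => H.
  have [N [mN N0 subN]] := right_defect_cvg0 mF.
  have FN : F `<=` N by move=> x Fx; apply: subN => /= h; apply: (H x); split => //; exact: h.
  have : (mu F <= 0)%E by rewrite -N0; apply: le_measure; rewrite ?inE.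
  by rewrite leNgt F0.
have e4 : 0 < e / 4 by lra.
have /cvgr_lt/(_ _ e4)[n _ /(_ n (leqnn n)) hn] := cvgx.
have hx : right_defect F (harmonic n) x < e / 4 := hn.
move: (@harmonic_gt0 R n) hx; set h := harmonic n => h0 hx.
(* The window of length [h / 2] ending at such a [q] lies inside []x, x + h]], where [F] misses less
   than [e * h / 4]. *)
have [q] : exists q, ratr q \in `](x + h / 2), (x + h)[.
  by apply: rat_in_itvoo; lra.
rewrite in_itv/= => /andP[q1 q2].
exists q, n; rewrite -/h.
have hx' : (mu (`]x, (x + h)%R]%classic `\` F) < (e * (h / 4))%:E)%E.
  rewrite -(@fineK _ (mu _)) ?measure_itv_setD_fin ?(ltW h0)// lte_fin.
  by move: hx; rewrite /right_defect ltr_pdivrMr// mulrAC mulrA.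
apply: le_lt_trans hx'; apply: le_measure; rewrite ?inE; [exact: measurableD..|].
move=> z /=; rewrite !in_itv/= => -[/andP[z1 z2] nF]; split => //.
rewrite -[n.+1%:R^-1]/h in z1; lra.
Qed.

End density.

(** * Smoothing by second differences *)

Section smoothing.
Context {R : realType}.
Local Notation mu := (@lebesgue_measure R).
Implicit Types (D : set R) (F N : R -> R) (y z r : R).

Definition cdf_of D y : R := fine (mu (D `&` `]-oo, y]%classic)).

Lemma cdf_ofB D y z : measurable D -> (mu D < +oo)%E -> y <= z ->
  cdf_of D z - cdf_of D y = fine (mu (D `&` `]y, z]%classic)).
Proof.
move=> mD Dfin yz; rewrite /cdf_of.
have fin A : measurable A -> mu (D `&` A) \is a fin_num.
  move=> mA; rewrite ge0_fin_numE//; apply: le_lt_trans Dfin.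
  by apply: le_measure; rewrite ?inE//; exact: measurableI.
have -> : D `&` `]-oo, z]%classic =
    (D `&` `]-oo, y]%classic) `|` (D `&` `]y, z]%classic).
  rewrite -setIUr; congr (_ `&` _); apply/seteqP; split => x /=; rewrite !in_itv/=.
    by move=> xz; case: (leP x y) => xy; [left|right].
  by move=> [/le_trans|/andP[]//]; exact.
rewrite measureU//; [|exact: measurableI..|].
  by rewrite fineD ?fin// addrAC subrr add0r.
by apply/seteqP; split => x //= -[[_ +] [_]]; rewrite !in_itv/= => xy /andP[]; rewrite ltNge xy.
Qed.

Lemma cdf_of_lip D y z : measurable D -> (mu D < +oo)%E -> y <= z ->
  0 <= cdf_of D z - cdf_of D y <= z - y.
Proof.
move=> mD Dfin yz; rewrite cdf_ofB// fine_ge0//=.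
have zy : 0 <= z - y by rewrite subr_ge0.
have h : (mu (D `&` `]y, z]%classic) <= (z - y)%:E)%E.
  rewrite -(@lebesgue_measure_itvoc _ y _ zy) addrC subrK.
  by apply: le_measure; rewrite ?inE//; exact: measurableI.
rewrite -lee_fin fineK// ge0_fin_numE//; exact: le_lt_trans h (ltry _).
Qed.

Lemma cdf_of_defect D y r : measurable D -> (mu D < +oo)%E -> 0 < r ->
  cdf_of D (y + r) - cdf_of D y = r - r * right_defect D r y.
Proof.
move=> mD Dfin r0; rewrite cdf_ofB//; last by rewrite lerDl ltW.
rewrite /right_defect [in RHS]mulrC divfK ?gt_eqF//.
have ylt : (mu `]y, (y + r)%R]%classic < +oo)%E.
  by rewrite lebesgue_measure_itvoc ?(ltW r0)// ltry.
rewrite setIC measureD//= lebesgue_measure_itvoc ?(ltW r0)//.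
have fi : mu (`]y, (y + r)%R]%classic `&` D) \is a fin_num.
  rewrite ge0_fin_numE//; apply: le_lt_trans Dfin.
  by apply: le_measure; rewrite ?inE//; exact: measurableI.
by rewrite (fineB _ fi)//= subKr.
Qed.

(** If [F] is a primitive of [N] and [N] a primitive of some density, this is the mean of the
    density against a hat kernel on [[y, y + 2 r]]. The smoothing thus needs no convolution, and the
    result is of class C^1 as soon as [N] is continuous. *)
Definition bump F r y : R := (F (y + 2 * r) - 2 * F (y + r) + F y) / r ^+ 2.

Lemma is_derive_shift F (c y d : R) : is_derive (y + c) 1 F d ->
  is_derive y 1 (fun z => F (z + c)) d.
Proof.
move=> h; have h2 : is_derive y 1 (fun z => z + c) 1.
  by rewrite -[X in is_derive _ _ _ X]addr0; apply: is_deriveD.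
by have := is_derive1_comp (f := F) (g := fun z => z + c) (x := y); rewrite -[d]mulr1; apply.
Qed.

Lemma is_derive_bump F N r y : (forall x : R, is_derive x 1 F (N x)) ->
  is_derive y 1 (bump F r) (bump N r y).
Proof.
move=> dF; rewrite /bump.
have h1 := is_derive_shift (dF (y + 2 * r)).
have h2 := is_derive_shift (dF (y + r)).
have h3 := dF y.
apply: is_derive_eq; rewrite /GRing.scale/=; ring.
Qed.

(** Pointwise facts about a smoothed function, such as its range, its support or its plateau, are
    read off from one increment of [N] over a subwindow of length [r]. *)
Lemma bump_MVT F N r y : 0 < r -> (forall x : R, is_derive x 1 F (N x)) ->
  exists2 z, y < z < y + r & bump F r y = (N (z + r) - N z) / r.
Proof.
move=> r0 dF.
have dG (x : R) : is_derive x 1 (fun z => F (z + r) - F z) (N (x + r) - N x).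
  have h1 := is_derive_shift (dF (x + r)); have h3 := dF x.
  exact: is_deriveB.
have yr : y < y + r by rewrite ltrDl.
have cG : {within `[y, y + r], continuous (fun z => F (z + r) - F z)}.
  by apply: continuous_subspaceT => x; exact: derive_continuous (dG x).
have [z zin E] := @MVT R _ _ y (y + r) yr (fun x _ => dG x) cG.
exists z; first by rewrite in_itv/= in zin.
rewrite /bump (_ : F (y + 2 * r) - 2 * F (y + r) + F y =
  F (y + r + r) - F (y + r) - (F (y + r) - F y)); last first.
  by rewrite (_ : y + r + r = y + 2 * r); ring.
by rewrite E (_ : y + r - y = r); [field; rewrite gt_eqF|ring].
Qed.

End smoothing.

(** * Test fields and lower bounds for the perimeter *)

Section plane_calculus.
Context {R : realType}.
Implicit Types (f g : R -> R) (h : R * R -> R) (p : R * R).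

(** The derivative is carried as an explicit function, so that the divergence of a test field comes
    out as a formula. *)
Definition C1_line f (f' : R -> R) := (forall x : R, is_derive x 1 f (f' x)) /\ continuous f'.

Lemma C1_line_cont f f' : C1_line f f' -> continuous f.
Proof. by move=> [df _] x; exact: derive_continuous (df x). Qed.

Lemma C1_lineM f f' g g' : C1_line f f' -> C1_line g g' ->
  C1_line (fun x => f x * g x) (fun x => f x * g' x + g x * f' x).
Proof.
move=> cf cg; split => [x|x].
  have [[h1 _] [h2 _]] := (cf, cg); have ? := h1 x; have ? := h2 x.
  exact: is_deriveM.
apply: cvgD; apply: cvgM; by [exact: (C1_line_cont cf)|exact: (C1_line_cont cg)
  |exact: cf.2|exact: cg.2].
Qed.

Lemma C1_lineD f f' g g' : C1_line f f' -> C1_line g g' ->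
  C1_line (fun x => f x + g x) (fun x => f' x + g' x).
Proof.
move=> [df cf] [dg cg]; split => [x|x].
  by have ? := df x; have ? := dg x; exact: is_deriveD.
by apply: cvgD; [exact: cf|exact: cg].
Qed.

Lemma C1_line_cst (c : R) : C1_line (fun=> c) (fun=> 0).
Proof. by split => [x|x]; [exact: is_derive_cst|exact: cvg_cst]. Qed.

(** The difference quotients in the direction [ex] are literally those of the restriction to a
    horizontal line. *)
Lemma is_derive_exE h p (d : R) :
  is_derive p.1 1 (fun x => h (x, p.2)) d <-> is_derive p ex h d.
Proof.
have E : (fun t => t^-1 *: (h (t *: ex + p) - h p)) =
         (fun t => t^-1 *: (h (t *: 1 + p.1, p.2) - h (p.1, p.2))).
  apply/funext => t; case: p => x y; congr (_ *: (h _ - _)).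
  by rewrite [LHS]surjective_pairing/= scaler0 add0r.
by split=> -[h1 h2]; split; move: h1 h2; rewrite /derivable /derive E.
Qed.

Lemma is_derive_eyE h p (d : R) :
  is_derive p.2 1 (fun y => h (p.1, y)) d <-> is_derive p ey h d.
Proof.
have E : (fun t => t^-1 *: (h (t *: ey + p) - h p)) =
         (fun t => t^-1 *: (h (p.1, t *: 1 + p.2) - h (p.1, p.2))).
  apply/funext => t; case: p => x y; congr (_ *: (h _ - _)).
  by rewrite [LHS]surjective_pairing/= scaler0 add0r.
by split=> -[h1 h2]; split; move: h1 h2; rewrite /derivable /derive E.
Qed.

Lemma C1_of_partials h (hx hy : R * R -> R) :
  (forall p, is_derive p ex h (hx p)) -> (forall p, is_derive p ey h (hy p)) ->
  continuous hx -> continuous hy -> C1 h.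
Proof.
move=> dx dy cx cy; split=> [p|p||]; [by have [] := dx p|by have [] := dy p|..].
- by rewrite (_ : (fun p => _) = hx)//; apply/funext => p; exact: derive_val.
- by rewrite (_ : (fun p => _) = hy)//; apply/funext => p; exact: derive_val.
Qed.

Lemma continuous_fst1 f : continuous f -> continuous (fun p : R * R => f p.1).
Proof. by move=> cf p; apply: continuous_comp; [exact: cvg_fst|exact: cf]. Qed.

Lemma continuous_snd1 f : continuous f -> continuous (fun p : R * R => f p.2).
Proof. by move=> cf p; apply: continuous_comp; [exact: cvg_snd|exact: cf]. Qed.

Lemma is_derive_ex_tensor f f' g p : C1_line f f' ->
  is_derive p ex (fun p : R * R => f p.1 * g p.2) (f' p.1 * g p.2).
Proof.
move=> [df _]; apply/is_derive_exE => /=.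
have ? := df p.1.
have : is_derive p.1 1 (fun x => f x * g p.2) (f p.1 * 0 + g p.2 * f' p.1).
  exact: is_deriveM.
by rewrite mulr0 add0r mulrC.
Qed.

Lemma is_derive_ey_tensor f g g' p : C1_line g g' ->
  is_derive p ey (fun p : R * R => f p.1 * g p.2) (f p.1 * g' p.2).
Proof.
move=> [dg _]; apply/is_derive_eyE => /=.
have ? := dg p.2.
have : is_derive p.2 1 (fun y => f p.1 * g y) (f p.1 * g' p.2 + g p.2 * 0).
  exact: is_deriveM.
by rewrite mulr0 addr0.
Qed.

Lemma is_derive_sumn (I : Type) (s : seq I) (F : I -> R * R -> R) (dF : I -> R * R -> R)
    p v : (forall i, is_derive p v (F i) (dF i p)) ->
  is_derive p v (fun q => \sum_(i <- s) F i q) (\sum_(i <- s) dF i p).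
Proof.
move=> dFi; elim: s => [|i s IH].
  rewrite big_nil (_ : (fun q => \sum_(i <- [::]) F i q) = cst 0); first exact: is_derive_cst.
  by apply/funext => q; rewrite big_nil.
rewrite big_cons (_ : (fun q => \sum_(j <- i :: s) F j q) = F i \+ (fun q => \sum_(j <- s) F j q)); last first.
  by apply/funext => q; rewrite big_cons.
by have ? := dFi i; exact: is_deriveD.
Qed.

Lemma continuous_sumn (I : Type) (s : seq I) (F : I -> R * R -> R) :
  (forall i, continuous (F i)) -> continuous (fun q => \sum_(i <- s) F i q).
Proof.
move=> cF; elim: s => [|i s IH].
  have -> : (fun q => \sum_(i <- [::]) F i q) = cst 0.
    by apply/funext => q; rewrite big_nil.
  exact: cst_continuous.
have -> : (fun q => \sum_(j <- i :: s) F j q) = F i \+ (fun q => \sum_(j <- s) F j q).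
  by apply/funext => q; rewrite big_cons.
by move=> p; apply: cvgD; [exact: cF|exact: IH].
Qed.

Lemma C1_sum_tensor (I : Type) (s : seq I) (f f' g g' : I -> R -> R) :
  (forall i, C1_line (f i) (f' i)) -> (forall i, C1_line (g i) (g' i)) ->
  C1 (fun p : R * R => \sum_(i <- s) f i p.1 * g i p.2).
Proof.
move=> cf cg.
apply: (@C1_of_partials _ (fun p => \sum_(i <- s) f' i p.1 * g i p.2)
                          (fun p => \sum_(i <- s) f i p.1 * g' i p.2)).
- move=> p; apply: (@is_derive_sumn _ _ (fun i p => f i p.1 * g i p.2)
    (fun i p => f' i p.1 * g i p.2)) => i; exact: is_derive_ex_tensor.
- move=> p; apply: (@is_derive_sumn _ _ (fun i p => f i p.1 * g i p.2)
    (fun i p => f i p.1 * g' i p.2)) => i; exact: is_derive_ey_tensor.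
- apply: continuous_sumn => i p; apply: cvgM.
    by apply: continuous_fst1; exact: (cf i).2.
  by apply: continuous_snd1; exact: (C1_line_cont (cg i)).
- apply: continuous_sumn => i p; apply: cvgM.
    by apply: continuous_fst1; exact: (C1_line_cont (cf i)).
  by apply: continuous_snd1; exact: (cg i).2.
Qed.

Lemma C1_0_of_support (v : R * R -> R * R) (K delta : R) : 0 < delta ->
  C1 (fun p => (v p).1) -> C1 (fun p => (v p).2) ->
  (forall p, v p != 0 -> [/\ - K <= p.1 <= K & delta <= p.2 <= K]) -> C1_0 v.
Proof.
move=> d0 c1 c2 supp.
pose Q : set (R * R) := `[- K, K]%classic `*` `[delta, K]%classic.
have cQ : compact Q by apply: compact_setX; exact: segment_compact.
have clQ : closed Q by apply: compact_closed => //; exact: norm_hausdorff.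
have sQ : closure [set p | v p != 0] `<=` Q.
  rewrite [X in _ `<=` X]((closure_id Q).1 clQ); apply: closure_subset => p /= /supp [h1 h2].
  by split; rewrite /= in_itv.
split => //.
- by apply: (subclosed_compact _ cQ) => //; exact: closed_closure.
- move=> p /sQ [_] /=; rewrite in_itv/= => /andP[h _].
  by rewrite /half_plane /=; exact: lt_le_trans d0 h.
Qed.

End plane_calculus.

(** * Cut-offs and ramps in one variable *)

Section cutoffs.
Context {R : realType}.
Implicit Types (F N : R -> R).

Lemma C1_line_bump F N r : (forall x : R, is_derive x 1 F (N x)) -> continuous N ->
  C1_line (bump F r) (bump N r).
Proof.
move=> dF cN; split=> [x|]; first exact: is_derive_bump.
have cs (c : R) : continuous (fun y => N (y + c)).
  move=> y; apply: continuous_comp; last exact: cN.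
  by apply: cvgD; [exact: cvg_id|exact: cvg_cst].
move=> y; apply: cvgM; last exact: cvg_cst.
apply: cvgD; last exact: cN.
apply: cvgB; first exact: cs.
by apply: cvgM; [exact: cvg_cst|exact: cs].
Qed.

Lemma nondecreasing_lip_continuous N :
  (forall y z, y <= z -> 0 <= N z - N y <= z - y) -> continuous N.
Proof.
move=> lip y; apply/cvgrPdist_lt => e e0; near=> z.
have : `|z - y| < e.
  by rewrite distrC; near: z; apply: (@cvgr_dist_lt _ _ _ _ _ (fun z : R => z) y).
have [zy|yz] := leP z y.
  have /andP[h1 h2] := lip _ _ zy.
  rewrite (ger0_norm h1) ler0_norm ?subr_le0// opprB; exact: le_lt_trans.
have /andP[h1 h2] := lip _ _ (ltW yz).
rewrite (ler0_norm (_ : N y - N z <= 0)) ?opprB ?ger0_norm; lra.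
Unshelve. all: by end_near. Qed.

Lemma bump_itv F N r y : 0 < r ->
  (forall x : R, is_derive x 1 F (N x)) ->
  (forall y z, y <= z -> 0 <= N z - N y <= z - y) -> 0 <= bump F r y <= 1.
Proof.
move=> r0 dF lip; have [z _ ->] := bump_MVT y r0 dF.
have /andP[h1 h2] := lip z (z + r) ltac:(by rewrite lerDl ltW).
rewrite divr_ge0 ?(ltW r0)//= ler_pdivrMr// mul1r; lra.
Qed.

Lemma norm_bump_le N r y : 0 < r ->
  (forall y z, y <= z -> 0 <= N z - N y <= z - y) -> `|bump N r y| <= r^-1.
Proof.
move=> r0 lip; rewrite /bump normrM normfV (ger0_norm (exprn_ge0 _ (ltW r0))).
rewrite ler_pdivrMr ?exprn_gt0// expr2 mulrA mulVf ?gt_eqF// mul1r.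
have /andP[h1 h2] := lip y (y + r) ltac:(by rewrite lerDl ltW).
have /andP[h3 h4] := lip (y + r) (y + 2 * r) ltac:(lra).
by rewrite ler_norml; lra.
Qed.

Lemma max_min_lip (u w M : R) : u <= w ->
  (0 <= Num.max w M - Num.max u M <= w - u) && (0 <= Num.min w M - Num.min u M <= w - u).
Proof.
by move=> uw; have [] := leP w M; have [] := leP u M; lra.
Qed.

(** The smoothed derivative of a clipped ramp [N] of slope 1 on [[a, b + 2 d]]. The clipping is
    asymmetric because the kernel looks forward over a length [2 d]. *)
Lemma plateau (a b d : R) : 0 < d -> a <= b -> exists X X' : R -> R,
  [/\ C1_line X X', (forall x, 0 <= X x <= 1), (forall x, a <= x <= b -> X x = 1),
      (forall x, X x != 0 -> a - 2 * d <= x <= b + 2 * d) &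
      (forall x, `|X' x| <= d^-1)].
Proof.
move=> d0 ab.
pose N x := Num.min (Num.max (x - a) 0) (b + 2 * d - a).
have lip y z : y <= z -> 0 <= N z - N y <= z - y.
  move=> yz; rewrite /N.
  have h1 := max_min_lip 0 (_ : y - a <= z - a); have {h1}/andP[/andP[h1 h2] _] := h1 ltac:(lra).
  have h3 := max_min_lip (b + 2 * d - a) (_ : Num.max (y - a) 0 <= Num.max (z - a) 0).
  have {h3}/andP[_ /andP[h3 h4]] := h3 ltac:(lra).
  by lra.
have cN := nondecreasing_lip_continuous lip.
have [F dF] := antiderivative cN.
exists (bump F d), (bump N d); split.
- exact: C1_line_bump.
- by move=> x; apply: bump_itv lip.
- move=> x /andP[ax xb]; have [z /andP[z1 z2] ->] := bump_MVT x d0 dF.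
  rewrite /N (max_l (_ : 0 <= z - a)) ?(max_l (_ : 0 <= z + d - a)) ?min_l; try lra.
  by rewrite (_ : z + d - a - (z - a) = d) ?divff ?gt_eqF//; lra.
- move=> x; apply: contra_neqT; rewrite negb_and -!ltNge => h.
  have [z /andP[z1 z2] ->] := bump_MVT x d0 dF.
  case/orP : h => h; rewrite /N.
    by rewrite !(max_r (_ : _ - a <= 0)) ?subrr ?mul0r//; lra.
  rewrite !(max_l (_ : 0 <= _ - a)) ?min_r ?subrr ?mul0r//; lra.
- by move=> x; apply: norm_bump_le.
Qed.

(** Meant as the sign of the horizontal component: it passes from -1 to 1 inside a window of length
    [2 r], and this rise of 2 is what a slice filling the window contributes to the divergence. *)
Lemma ramp (q r : R) : 0 < r -> exists s s' : R -> R,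
  [/\ C1_line s s', (forall x, `|s x| <= 1), (forall x, 0 <= s' x <= 2 / r),
      s q = 1 & s (q - 2 * r) = -1].
Proof.
move=> r0.
pose N x := Num.max (x - q) 0.
have lip y z : y <= z -> 0 <= N z - N y <= z - y.
  move=> yz; rewrite /N; have yz' : y - q <= z - q by lra.
  by have /andP[/andP[h1 h2] _] := max_min_lip 0 yz'; lra.
have cN := nondecreasing_lip_continuous lip.
have [F dF] := antiderivative cN.
have [c1 c2] := C1_line_bump r dF cN.
exists (fun x => 2 * bump F r x + -1), (fun x => 2 * bump N r x); split.
- have h := C1_lineD (C1_lineM (C1_line_cst (2 : R)) (conj c1 c2)) (C1_line_cst (-1 : R)).
  have E : (fun x => 2 * bump N r x + bump F r x * 0 + 0) = (fun x => 2 * bump N r x).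
    by apply/funext => x; rewrite mulr0 !addr0.
  by rewrite E in h.
- by move=> x; have := bump_itv x r0 dF lip; rewrite ler_norml; lra.
- move=> x; have : 0 <= bump N r x <= r^-1.
    rewrite /bump divr_ge0 ?exprn_ge0 ?(ltW r0)//=; last first.
      rewrite /N; have [] := leP (x + 2 * r - q) 0; have [] := leP (x + r - q) 0;
        have [] := leP (x - q) 0; lra.
    have := norm_bump_le x r0 lip; rewrite ler_norml => /andP[_]; exact.
  by have : 2 / r = 2 * r^-1 by []; lra.
- have [z /andP[z1 z2] ->] := bump_MVT q r0 dF.
  rewrite /N !max_l; try lra.
  by rewrite (_ : z + r - q - (z - q) = r) ?divff ?gt_eqF//; lra.
- have [z /andP[z1 z2] ->] := bump_MVT (q - 2 * r) r0 dF.
  by rewrite /N !max_r ?subrr ?mul0r; lra.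
Qed.

End cutoffs.

(** * The two-component test field *)

Section test_fields.
Context {R : realType}.
Local Notation mu := (@lebesgue_measure R).
Local Notation mu2 := (lebesgue_measure2 R).

(** The strict bound on [rho] keeps the radicand away from 0, where the square root is not
    differentiable. *)
Lemma C1_line_sqrt1B (b b' : R -> R) (rho : R) : C1_line b b' ->
  (forall y, `|b y| <= rho) -> rho < 1 ->
  exists a', C1_line (fun y => Num.sqrt (1 - b y ^+ 2)) a'.
Proof.
move=> cb brho rho1.
have pos y : 0 < 1 - b y ^+ 2.
  rewrite subr_gt0 -(ger0_norm (sqr_ge0 (b y))) normrX.
  rewrite expr_lt1// ?normr_ge0//; exact: le_lt_trans rho1.
have cB := C1_line_cont cb.
exists (fun y => (2 * Num.sqrt (1 - b y ^+ 2))^-1 * - (2 * b y * b' y)); split=> y.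
  have h1 := is_derive1_sqrt (pos y).
  have h2 : is_derive y 1 (fun y => 1 - b y ^+ 2) (- (2 * b y * b' y)).
    have ? := cb.1 y.
    apply: is_derive_eq; rewrite /GRing.scale/=; ring.
  exact: (@is_derive1_comp _ Num.sqrt (fun y => 1 - b y ^+ 2)).
apply: cvgM; last first.
  apply: cvgN; apply: cvgM; last exact: cb.2.
  by apply: cvgM; [exact: cvg_cst|exact: cB].
apply: cvgV; first by rewrite mulf_neq0// gt_eqF// sqrtr_gt0.
apply: cvgM; first exact: cvg_cst.
apply: (@continuous_comp _ _ _ (fun y => 1 - b y ^+ 2) Num.sqrt); last exact: sqrt_continuous.
apply: cvgB; first exact: cvg_cst.
by rewrite expr2 (_ : (fun y => b y ^+ 2) = (fun y => b y * b y)) //; apply: cvgM; exact: cB.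
Qed.

(** The field has horizontal component [X a sum_j sg_j ch_j] and vertical component [X b], where
    [a = sqrt (1 - b^2)] is the length left free by [b], the [sg_j] are ramps in [x], the [ch_j]
    cut-offs in height, and the plateau [X] is 1 over [E]. The weighted profile [B = y^alpha b] is a
    datum of its own, so the weight is never differentiated here. *)
Lemma field_perimeter (alpha delta K K1 rho : R) (E : set (R * R))
    (b b' B B' : R -> R) (m : nat) (sg sg' ch ch' : nat -> R -> R) :
  0 < delta -> delta <= K1 -> K <= K1 -> rho < 1 ->
  (forall p, E p -> `|p.1| < K /\ 0 < p.2) ->
  C1_line b b' -> (forall y, `|b y| <= rho) ->
  (forall y, b y != 0 -> delta <= y <= K1) ->
  C1_line B B' -> (forall y, 0 < y -> y `^ alpha * b y = B y) ->
  (forall j, C1_line (sg j) (sg' j)) -> (forall j x, `|sg j x| <= 1) ->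
  (forall j, C1_line (ch j) (ch' j)) -> (forall j y, 0 <= ch j y) ->
  (forall y, \sum_(j <- iota 0 m) ch j y <= 1) ->
  (forall j y, ch j y != 0 -> delta <= y <= K1) ->
  (\int[mu2]_(p in E) (B' p.2 + \sum_(j <- iota 0 m)
     sg' j p.1 * (p.2 `^ alpha * Num.sqrt (1 - b p.2 ^+ 2) * ch j p.2))%:E
   <= weighted_perimeter alpha E)%E.
Proof.
move=> d0 dK KK1 rho1 EK cb brho bsupp cB yb csg sg1 cch ch0 ch1 chsupp.
have [a' ca] := C1_line_sqrt1B cb brho rho1.
set a := fun y => Num.sqrt (1 - b y ^+ 2) in ca.
have K0 : 0 <= K1 by lra.
have [X [X' [cX X01 X1 Xs _]]] := @plateau R (- K1) K1 1 ltr01 ltac:(lra).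
pose v1 p := \sum_(j <- iota 0 m) (X p.1 * sg j p.1) * (a p.2 * ch j p.2).
pose v2 p := \sum_(j <- [:: tt]) X p.1 * b p.2.
pose v p := (v1 p, v2 p).
have v2E p : v2 p = X p.1 * b p.2 by rewrite /v2 big_seq1.
have cv : C1_0 v.
  apply: (@C1_0_of_support _ _ (K1 + 2) delta) => //.
  - exact: (@C1_sum_tensor R nat (iota 0 m) (fun j x => X x * sg j x) _
      (fun j y => a y * ch j y) _ (fun j => C1_lineM cX (csg j)) (fun j => C1_lineM ca (cch j))).
  - exact: (@C1_sum_tensor R unit [:: tt] (fun=> X) _ (fun=> b) _ (fun=> cX) (fun=> cb)).
  - move=> p vp.
    have X0 : X p.1 != 0.
      apply: contra_neq vp => Xp; rewrite /v v2E /v1 Xp mul0r.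
      by rewrite big1// => j _; rewrite !mul0r.
    have := Xs _ X0 => /andP[x1 x2]; split; first lra.
    suff /andP[h1 h2] : delta <= p.2 <= K1 by apply/andP; split => //; lra.
    have [b0|b0] := eqVneq (b p.2) 0; last exact: bsupp.
    have [/hasP[j _ cj]|/hasPn H] := boolP (has (fun j => ch j p.2 != 0) (iota 0 m)).
      exact: chsupp cj.
    exfalso; move/eqP : vp; apply; rewrite /v v2E b0 mulr0 /v1 big_seq big1// => j jm.
    by have := H _ jm; rewrite negbK => /eqP ->; rewrite !mulr0.
have bnd p : euclidean_norm (v p) <= 1.
  rewrite /euclidean_norm /= v2E.
  have s1 : `|\sum_(j <- iota 0 m) sg j p.1 * ch j p.2| <= 1.
    apply: (le_trans (ler_norm_sum _ _ _)); apply: le_trans (ch1 p.2).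
    apply: ler_sum => j _; rewrite normrM (ger0_norm (ch0 j _)).
    by rewrite ler_piMl.
  have v1E : v1 p = X p.1 * a p.2 * (\sum_(j <- iota 0 m) sg j p.1 * ch j p.2).
    by rewrite /v1 mulr_sumr; apply: eq_bigr => j _; ring.
  have b1 : b p.2 ^+ 2 <= 1.
    rewrite -(ger0_norm (sqr_ge0 (b p.2))) normrX expr_le1//.
    exact: le_trans (brho _) (ltW rho1).
  have a2 : a p.2 ^+ 2 = 1 - b p.2 ^+ 2 by rewrite sqr_sqrtr// subr_ge0.
  rewrite -[leRHS]sqrtr1; apply: ler_wsqrtr.
  set t := \sum_(j <- _) _ in s1 v1E; rewrite v1E.
  have t2 : t ^+ 2 <= 1.
    by rewrite -(ger0_norm (sqr_ge0 t)) normrX expr_le1.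
  have X2 : X p.1 ^+ 2 <= 1.
    by have /andP[x0 x1] := X01 p.1; rewrite expr_le1.
  rewrite !exprMn a2 -mulrA -mulrDr.
  have h1 : (1 - b p.2 ^+ 2) * t ^+ 2 + b p.2 ^+ 2 <= 1.
    have : (1 - b p.2 ^+ 2) * t ^+ 2 <= (1 - b p.2 ^+ 2) * 1 by rewrite ler_wpM2l ?subr_ge0.
    lra.
  apply: (le_trans _ X2); rewrite -[leRHS]mulr1; apply: ler_wpM2l => //; exact: sqr_ge0.
apply: ereal_sup_ubound; exists v; first by split.
apply: eq_integral => p; rewrite inE => /EK [p1 p2]; congr (_%:E).
have Xp : X p.1 = 1.
  by apply: X1; move: p1; rewrite ltr_norml => /andP[]; lra.
rewrite /divergence.
have nX : \forall x \near p.1, X x = 1.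
  have h1 : - K < p.1 by move: p1; rewrite ltr_norml => /andP[].
  have h2 : p.1 < K by move: p1; rewrite ltr_norml => /andP[].
  near=> x; apply: X1; apply/andP; split.
    have : - K < x by near: x; exact: (lt_nbhsr h1).
    lra.
  have : x < K by near: x; exact: (lt_nbhsl h2).
  lra.
have d1 : is_derive p ex (fun q : R * R => (q.2 `^ alpha *: v q).1)
    (\sum_(j <- iota 0 m) sg' j p.1 * (p.2 `^ alpha * Num.sqrt (1 - b p.2 ^+ 2) * ch j p.2)).
  apply/is_derive_exE => /=.
  have h : is_derive p.1 1 (fun x => \sum_(j <- iota 0 m) sg j x * (p.2 `^ alpha * a p.2 * ch j p.2))
     (\sum_(j <- iota 0 m) sg' j p.1 * (p.2 `^ alpha * a p.2 * ch j p.2)).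
    have := @is_derive_sumn R _ (iota 0 m)
      (fun j (q : R * R) => sg j q.1 * (fun y => y `^ alpha * a y * ch j y) q.2)
      (fun j (q : R * R) => sg' j q.1 * (fun y => y `^ alpha * a y * ch j y) q.2) p ex.
    by move=> /(_ (fun j => is_derive_ex_tensor
      (fun y => y `^ alpha * a y * ch j y) p (csg j)))/is_derive_exE.
  apply: near_eq_is_derive h; near=> x.
  have Xx : X x = 1 by near: x.
  rewrite /GRing.scale/= /v1/= Xx mulr_sumr; apply: eq_bigr => j _.
  by rewrite mul1r; ring.
have d2 : is_derive p ey (fun q : R * R => (q.2 `^ alpha *: v q).2) (B' p.2).
  apply/is_derive_eyE => /=; apply: near_eq_is_derive (cB.1 p.2); near=> y.
  have y0 : 0 < y by near: y; exact: (lt_nbhsr p2).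
  by rewrite /GRing.scale/= v2E/= Xp mul1r yb.
by rewrite (@derive_val _ _ _ _ _ _ _ d1) (@derive_val _ _ _ _ _ _ _ d2) addrC.
Unshelve. all: by end_near. Qed.

End test_fields.

(** * Integrals along horizontal slices *)

Section slices.
Context {R : realType}.
Local Notation mu := (@lebesgue_measure R).
Local Notation mu2 := (lebesgue_measure2 R).
Implicit Types (E : set (R * R)).

Lemma bounded_integrable d (T : measurableType d) (m : {measure set T -> \bar R})
    (A : set T) (f : T -> R) (M : R) : measurable A -> (m A < +oo)%E ->
  measurable_fun A f -> (forall x, A x -> `|f x| <= M) -> m.-integrable A (EFin \o f).
Proof.
move=> mA Afin mf fM; apply: measurable_bounded_integrable => //.
exists M; split; first exact: num_real.
by move=> x Mx y Ay; apply: (le_trans (fM _ Ay)); exact: ltW.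
Qed.

Lemma measure2_bounded_lty E (K : R) : measurable E ->
  (forall p, E p -> `|p.1| <= K /\ `|p.2| <= K) -> (mu2 E < +oo)%E.
Proof.
move=> mE EK.
apply: (@le_lt_trans _ _ (mu2 (`[- K, K]%classic `*` `[- K, K]%classic))).
  apply: le_measure; rewrite ?inE//; first exact: measurableX.
  by move=> p /EK [h1 h2]; split; rewrite /= in_itv/= -ler_norml.
have fin : (mu `[(- K)%R, K]%classic < +oo)%E.
  by rewrite lebesgue_measure_itv/=; case: ifP => _; rewrite -?EFinB ltry.
by rewrite product_measure1E//; apply: lte_mul_pinfty => //; rewrite ge0_fin_numE.
Qed.

Lemma measurable_fun_fst1 (f : R -> R) : measurable_fun setT f ->
  measurable_fun setT (fun p : R * R => f p.1).
Proof. by move=> mf; apply: (measurableT_comp mf); exact: measurable_fst. Qed.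

Lemma measurable_fun_snd1 (f : R -> R) : measurable_fun setT f ->
  measurable_fun setT (fun p : R * R => f p.2).
Proof. by move=> mf; apply: (measurableT_comp mf); exact: measurable_snd. Qed.

Lemma fubini_tonelli2_set E (f : R * R -> R) : measurable E ->
  measurable_fun setT f -> (forall p, 0 <= f p) ->
  (\int[mu2]_(p in E) (f p)%:E =
   \int[mu]_y \int[mu]_(x in ysection E y) (f (x, y))%:E)%E.
Proof.
move=> mE mf f0; rewrite integral_mkcond.
rewrite fubini_tonelli2.
- rewrite /fubini_G; apply: eq_integral => y _; rewrite [RHS]integral_mkcond.
  apply: eq_integral => x _; rewrite /patch.
  by rewrite mem_ysection.
- by apply/(measurable_restrictT _ mE)/measurable_EFinP/measurable_funTS.
- by move=> p; apply: erestrict_ge0 => q _; rewrite lee_fin.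
Qed.

Lemma slice_integral_ge E (D : set R) (s g : R -> R) (c : R) :
  measurable E -> measurable D -> 0 <= c ->
  measurable_fun setT s -> (forall x, 0 <= s x) ->
  measurable_fun setT g -> (forall y, 0 <= g y) ->
  (forall y, D y -> (c%:E <= \int[mu]_(x in ysection E y) (s x)%:E)%E) ->
  (c%:E * \int[mu]_(y in D) (g y)%:E <= \int[mu2]_(p in E) (s p.1 * g p.2)%:E)%E.
Proof.
move=> mE mD c0 ms s0 mg g0 cD.
have msg : measurable_fun setT (fun p : R * R => s p.1 * g p.2).
  by apply: measurable_funM; [exact: measurable_fun_fst1|exact: measurable_fun_snd1].
rewrite fubini_tonelli2_set//; last by move=> p; rewrite mulr_ge0.
rewrite -ge0_integralZl//=; last 2 first.
- by apply/measurable_EFinP/measurable_funTS.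
- by move=> y _; rewrite lee_fin.
rewrite integral_mkcond.
pose G y := (\int[mu]_(x in ysection E y) (s x * g y)%:E)%E.
have mysE y : measurable (ysection E y) by exact: measurable_ysection.
have mG : measurable_fun setT G.
  have mf : measurable_fun setT ((fun p : R * R => (s p.1 * g p.2)%:E) \_ E).
    by apply/(measurable_restrictT _ mE)/measurable_EFinP/measurable_funTS.
  have f0 p : (0 <= ((fun p : R * R => (s p.1 * g p.2)%:E) \_ E) p)%E.
    by apply: erestrict_ge0 => q _; rewrite lee_fin mulr_ge0.
  have := @measurable_fun_fubini_tonelli_G _ _ _ _ R lebesgue_measure _ mf f0.
  congr (measurable_fun _ _); apply/funext => y.
  rewrite /fubini_G /G [RHS]integral_mkcond; apply: eq_integral => x _; rewrite /patch.
  by rewrite mem_ysection.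
apply: ge0_le_integral => //.
- by move=> y _; apply: erestrict_ge0 => z _; rewrite mule_ge0 ?lee_fin.
- apply/(measurable_restrictT _ mD); apply: measurable_funTS.
  by apply: measurable_funeM; apply/measurable_EFinP.
- move=> y _; rewrite /patch; case: ifPn => [|_]; last first.
    by apply: integral_ge0 => x _; rewrite lee_fin mulr_ge0.
  rewrite inE => /cD h; under eq_integral do rewrite mulrC EFinM.
  rewrite ge0_integralZl//=.
  + by rewrite muleC lee_wpmul2l// lee_fin.
  + exact: mysE.
  + by apply/measurable_EFinP/measurable_funTS.
  + by move=> x _; rewrite lee_fin.
  + by rewrite lee_fin.
Qed.

(** The ramp rises by 2 across the window with slope at most [2 / r], so the part of the window
    outside [F] accounts for at most [2 e] of the rise. *)
Lemma ramp_slice_ge (F : set R) (s s' : R -> R) (q r e : R) : 0 < r -> 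
  measurable F -> C1_line s s' -> (forall x, 0 <= s' x <= 2 / r) ->
  s q = 1 -> s (q - 2 * r) = -1 ->
  (mu (`](q - 2 * r)%R, q]%classic `\` F) <= (e * r)%:E)%E ->
  ((2 - 2 * e)%:E <= \int[mu]_(x in F) (s' x)%:E)%E.
Proof.
move=> r0 mF [ds cs] s'0 sq1 sq2 muF.
have ms : measurable_fun setT s' by exact: continuous_measurable_fun.
set J := `]q - 2 * r, q]%classic in muF.
have mJ : measurable J by exact: measurable_itv.
have mE A : measurable_fun A (fun x => (s' x)%:E).
  by apply/measurable_EFinP/measurable_funTS.
have s0 x : (0 <= (s' x)%:E)%E by rewrite lee_fin; have /andP[] := s'0 x.
have I2 : (\int[mu]_(x in J) (s' x)%:E = 2%:E)%E.
  have -> : (2 : R) = s q - s (q - 2 * r) by rewrite sq1 sq2; ring.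
  have qr : q - 2 * r < q by lra.
  rewrite -(@FTC2_cc _ s s' _ _ qr (fun x _ => ds x) (fun x _ => cs x)).
  by rewrite integral_itv_obnd_cbnd.
have IJ : (\int[mu]_(x in J `\` F) (s' x)%:E <= (2 * e)%:E)%E.
  apply: (@le_trans _ _ (\int[mu]_(x in J `\` F) (2 / r)%:E)%E).
    apply: ge0_le_integral.
    - exact: measurableD.
    - by move=> x _; exact: s0.
    - exact: mE.
    - exact: measurable_cst.
    - by move=> x _; rewrite lee_fin; have /andP[] := s'0 x.
  rewrite integral_cst; last exact: measurableD.
  apply: (@le_trans _ _ ((2 / r)%:E * (e * r)%:E)%E).
    by apply: lee_wpmul2l => //; rewrite lee_fin divr_ge0// ltW.
  by rewrite -EFinM lee_fin (_ : 2 / r * (e * r) = 2 * e)//; field; rewrite gt_eqF.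
have mJF : measurable (J `\` F) by exact: measurableD.
have mU : measurable (J `\` F `|` F) by exact: measurableU.
have dJF : [disjoint J `\` F & F] by apply/disj_setPS => x [[]].
have JU : J `<=` J `\` F `|` F.
  by move=> x Jx; have [Fx|nFx] := pselect (F x); [right|left].
have IU : (2%:E <= \int[mu]_(x in J `\` F) (s' x)%:E + \int[mu]_(x in F) (s' x)%:E)%E.
  have IUe : (\int[mu]_(x in J `\` F `|` F) (s' x)%:E =
      \int[mu]_(x in J `\` F) (s' x)%:E + \int[mu]_(x in F) (s' x)%:E)%E.
    apply: ge0_integral_setU;
      [exact: mJF|exact: mF|exact: mE|by move=> x _; exact: s0|exact: dJF].
  rewrite -IUe -I2.
  Show. apply: ge0_subset_integral; [exact: mJ|exact: mU|exact: mE|by move=> x _; exact: s0|exact: JU].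
rewrite EFinB leeBlDl//; apply: (le_trans IU); exact: leeD2r.
Qed.

End slices.

(** * Lower bounds from a prescribed vertical profile *)

Section profile_bound.
Context {R : realType}.
Local Notation mu := (@lebesgue_measure R).
Local Notation mu2 := (lebesgue_measure2 R).

Lemma bump_sum (F : nat -> R -> R) (s : seq nat) r y :
  bump (fun x => \sum_(j <- s) F j x) r y = \sum_(j <- s) bump (F j) r y.
Proof.
rewrite /bump mulr_sumr -sumrB -big_split/= mulr_suml.
by apply: eq_bigr => j _.
Qed.

(** For disjoint sets the increments add up to the measure of a subset of []y, z]]. This is what
    keeps the sum of the smoothed indicators at most 1. *)
Lemma sum_cdf_of_lip (D : nat -> set R) m y z :
  (forall j, measurable (D j)) -> (forall j, (mu (D j) < +oo)%E) ->
  trivIset setT D -> y <= z ->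
  0 <= (\sum_(j <- iota 0 m) cdf_of (D j) z) - (\sum_(j <- iota 0 m) cdf_of (D j) y) <= z - y.
Proof.
move=> mD Dfin tD yz; rewrite -sumrB.
have zy : 0 <= z - y by rewrite subr_ge0.
have mDI j : measurable (D j `&` `]y, z]%classic) by exact: measurableI.
have muyz : mu `]y, z]%classic = (z - y)%:E.
  by rewrite -(@lebesgue_measure_itvoc _ y _ zy) addrC subrK.
have DIfin j : mu (D j `&` `]y, z]%classic) \is a fin_num.
  rewrite ge0_fin_numE//; apply: le_lt_trans (Dfin j).
  apply: le_measure; rewrite ?inE.
  - exact: mDI.
  - exact: mD.
  - exact: subIsetl.
have tDI : trivIset setT (fun j => D j `&` `]y, z]%classic).
  by move=> i j _ _ [x [[Di _] [Dj _]]]; apply: tD => //; exists x.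
apply/andP; split.
  by apply: sumr_ge0 => j _; have /andP[] := cdf_of_lip (mD j) (Dfin j) yz.
rewrite -lee_fin -sumEFin.
under eq_bigr do rewrite cdf_ofB// fineK//.
have -> : (\sum_(j <- iota 0 m) mu (D j `&` `]y, z]%classic) =
    mu (\big[setU/set0]_(j < m) (D j `&` `]y, z]%classic)))%E.
  have -> := @measure_bigsetU _ _ _ (@lebesgue_measure R) (fun j => D j `&` `]y, z]%classic)
    mDI tDI m.
  by rewrite -(big_mkord xpredT (fun j => mu (D j `&` `]y, z]%classic))) /index_iota subn0.
rewrite -muyz; apply: le_measure; rewrite ?inE//.
  by apply: bigsetU_measurable => j _; exact: mDI.
have -> : \big[setU/set0]_(j < m) (D j `&` `]y, z]%classic) =
    \bigcup_(j < m) (D j `&` `]y, z]%classic) by rewrite bigcup_mkord.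
by move=> x [j _ []].
Qed.

Lemma sum_ereal_cvg0 (u : nat -> nat -> \bar R) (s : seq nat) :
  (forall j, u j n @[n --> \oo] --> 0%E) ->
  (\sum_(j <- s) u j n)%E @[n --> \oo] --> 0%E.
Proof.
move=> u0; elim: s => [|j s IH].
  by under eq_fun do rewrite big_nil; exact: cvg_cst.
under eq_fun do rewrite big_cons.
have := @cvgeD _ _ _ _ (u j) (fun n => (\sum_(i <- s) u i n)%E) 0%E 0%E isT (u0 j) IH.
by rewrite adde0; exact.
Qed.

Lemma subset_itvoc_setD (D : set R) (y z y' z' : R) : y' <= y -> z <= z' ->
  `]y, z]%classic `\` D `<=` `]y', z']%classic `\` D.
Proof.
move=> yy zz x [/=]; rewrite !in_itv/= => /andP[x1 x2] nD; split => //; lra.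
Qed.

Lemma integrable_height (E : set (R * R)) (K : R) (g : R -> R) : measurable E ->
  (forall p, E p -> `|p.1| < K /\ 0 < p.2 < K) -> continuous g ->
  mu2.-integrable E (EFin \o (fun p => g p.2)).
Proof.
move=> mE EK cg.
have Efin : (mu2 E < +oo)%E.
  apply: (@measure2_bounded_lty _ _ K) => // p /EK [h1 /andP[h2 h3]].
  by rewrite (ltW h1) ger0_norm ?(ltW h3)// ltW.
have [M' HM'] : exists M', forall y, 0 <= y <= K -> `|g y| <= M'.
  have [K0|K0] := leP 0 K; last by exists 0 => y; lra.
  have /compact_bounded[M' [_ HM']] : compact (g @` `[0, K]).
    by apply: continuous_compact; [exact: continuous_subspaceT|exact: segment_compact].
  exists (M' + 1) => y yK; apply: (HM' (M' + 1)); first by rewrite ltrDl.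
  by exists y => //=; rewrite in_itv.
apply: (@bounded_integrable _ _ _ _ _ _ M') => //.
  apply: measurable_funTS; apply: measurable_fun_snd1; exact: continuous_measurable_fun.
by move=> p /EK [_ /andP[h1 h2]]; apply: HM'; rewrite !ltW.
Qed.

(** Each [D j] gathers heights whose slices nearly fill one common window, and the field uses the
    ramp of that window multiplied by a smoothed indicator of [D j]. Letting the smoothing scale
    tend to 0 costs only the integrals of finitely many right defects, which vanish in the limit. *)
Lemma window_perimeter (alpha K K1 d1 rho e : R) (E : set (R * R))
    (b b' B B' : R -> R) (D : nat -> set R) (q r : nat -> R) (m : nat) :
  0 <= alpha -> 0 < d1 -> d1 <= K1 -> K <= K1 -> rho < 1 -> 0 <= e <= 1 ->
  measurable E -> (forall p, E p -> `|p.1| < K /\ 0 < p.2 < K) ->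
  C1_line b b' -> (forall y, `|b y| <= rho) ->
  (forall y, b y != 0 -> d1 <= y <= K1) ->
  C1_line B B' -> (forall y, 0 < y -> y `^ alpha * b y = B y) ->
  (forall j, measurable (D j)) -> trivIset setT D ->
  (forall j, D j `<=` `]d1, K[) -> (forall j, 0 < r j) ->
  (forall j y, D j y ->
    (mu (`](q j - 2 * r j)%R, q j]%classic `\` ysection E y) <= (e * r j)%:E)%E) ->
  (\int[mu2]_(p in E) (B' p.2)%:E + (2 - 2 * e)%:E *
     \sum_(j <- iota 0 m) \int[mu]_(y in D j) (y `^ alpha * Num.sqrt (1 - b y ^+ 2))%:E
   <= weighted_perimeter alpha E)%E.
Proof.
move=> a0 d0 dK1 KK1 rho1 /andP[e0 e1] mE EK cb brho bsupp cB yb mD tD Dsub r0 win.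
set w := fun y => y `^ alpha * Num.sqrt (1 - b y ^+ 2).
set I := (\int[mu2]_(p in E) (B' p.2)%:E)%E.
have c0 : 0 <= 2 - 2 * e by lra.
have w0 y : 0 <= w y by rewrite mulr_ge0 ?powR_ge0// sqrtr_ge0.
have mw : measurable_fun setT w.
  apply: measurable_funM; first exact: measurable_powR.
  have [a' [da _]] := C1_line_sqrt1B cb brho rho1.
  by apply: continuous_measurable_fun => x; exact: derive_continuous (da x).
have Dfin j : (mu (D j) < +oo)%E.
  apply: (@le_lt_trans _ _ (mu `]d1, K[%classic)).
    apply: le_measure; rewrite ?inE; [exact: mD|exact: measurable_itv|exact: Dsub].
  by rewrite lebesgue_measure_itv/=; case: ifP => _; rewrite -?EFinB ltry.
have Efin : (mu2 E < +oo)%E.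
  apply: (@measure2_bounded_lty _ _ K) => // p /EK [h1 /andP[h2 h3]].
  by rewrite (ltW h1) ger0_norm ?(ltW h3)// ltW.
set M := K `^ alpha.
have M0 : 0 <= M by exact: powR_ge0.
have wM y : 0 < y < K -> w y <= M.
  move=> /andP[y0 yK]; rewrite -[leRHS]mulr1; apply: ler_pM; rewrite ?powR_ge0 ?sqrtr_ge0//.
    by apply: ge0_ler_powR => //; rewrite ?nnegrE ltW// (lt_trans y0).
  by rewrite -[leRHS]sqrtr1; apply: ler_wsqrtr; rewrite gerBl sqr_ge0.
have [F dF] : {F : nat -> R -> R & forall j (x : R), is_derive x 1 (F j) (cdf_of (D j) x)}.
  have H j : {F : R -> R | forall x : R, is_derive x 1 F (cdf_of (D j) x)}.
    apply: cid; apply: antiderivative; apply: nondecreasing_lip_continuous => y z.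
    exact: cdf_of_lip.
  by exists (fun j => projT1 (H j)) => j; exact: projT2 (H j).
have [sg [sg' Hsg]] : {sg : nat -> R -> R & {sg' : nat -> R -> R &
   forall j, [/\ C1_line (sg j) (sg' j), (forall x, `|sg j x| <= 1),
     (forall x, 0 <= sg' j x <= 2 / r j), sg j (q j) = 1 &
     sg j (q j - 2 * r j) = -1] } }.
  have H j := cid (ramp (q j) (r0 j)).
  exists (fun j => projT1 (H j)), (fun j => projT1 (cid (projT2 (H j)))) => j.
  exact: projT2 (cid (projT2 (H j))).
have [->|Pfin] := eqVneq (weighted_perimeter alpha E) +oo%E; first by rewrite leey.
pose rd j n := (\int[mu]_(y in D j) (right_defect (D j) (harmonic n) y)%:E)%E.
have rd0 j : rd j n @[n --> \oo] --> 0%E by exact: integral_right_defect_cvg0.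
pose err n := ((2 - 2 * e)%:E * ((2 * M)%:E * \sum_(j <- iota 0 m) rd j n))%E.
have err0 : err n @[n --> \oo] --> 0%E.
  have h1 : (2 * M)%:E \is a fin_num by [].
  have h2 : (2 - 2 * e)%:E \is a fin_num by [].
  have := cvgeZl h2 (cvgeZl h1 (@sum_ereal_cvg0 rd (iota 0 m) rd0)).
  by rewrite !mule0; exact.
have PE0 : weighted_perimeter alpha E + err n @[n --> \oo] --> weighted_perimeter alpha E.
  have h : (weighted_perimeter alpha E +? 0)%E by rewrite /adde_def/= !andbF.
  have := cvgeD h (cvg_cst (weighted_perimeter alpha E)) err0.
  by rewrite adde0; exact.
apply: (cvge_to_ge PE0).
(* The forward kernel spreads the cut-offs to the left by at most [harmonic n]; this keeps their
   supports above [d1 / 2]. *)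
have hsmall : \forall n \near \oo, @harmonic R n < d1 / 2.
  have d2 : 0 < d1 / 2 by lra.
  by have /cvgr_lt/(_ _ d2) := @cvg_harmonic R.
near=> n.
have hn : harmonic n < d1 / 2 by near: n.
have h0 := @harmonic_gt0 R n.
(* Halved so that the kernel, of length [2 rr], sees exactly the window of the defect at scale
   [harmonic n]. *)
pose rr := (harmonic n : R) / 2.
have rr0 : 0 < rr by rewrite /rr; lra.
have lipD j y z : y <= z -> 0 <= cdf_of (D j) z - cdf_of (D j) y <= z - y.
  exact: cdf_of_lip.
pose ch j := bump (F j) rr.
have ch01 j y : 0 <= ch j y <= 1 by exact: (bump_itv y rr0 (dF j) (lipD j)).
have chsum y : \sum_(j <- iota 0 m) ch j y <= 1.
  rewrite -bump_sum.
  have dsum (x : R) : is_derive x 1 (fun x => \sum_(j <- iota 0 m) F j x)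
      (\sum_(j <- iota 0 m) cdf_of (D j) x).
    elim: (iota 0 m) => [|j s IH].
      rewrite big_nil.
      have -> : (fun x => \sum_(j <- [::]) F j x) = cst 0.
        by apply/funext => z; rewrite big_nil.
      exact: is_derive_cst.
    rewrite big_cons.
    have -> : (fun x => \sum_(i <- j :: s) F i x) = F j \+ (fun x => \sum_(i <- s) F i x).
      by apply/funext => z; rewrite big_cons.
    by have ? := dF j x; exact: is_deriveD.
  have /andP[_] := bump_itv y rr0 dsum (fun y z => sum_cdf_of_lip m mD Dfin tD (z:=z)).
  exact.
(* The mean value involves a half window inside the full one; relative to its own length it misses
   at most twice the proportion. *)
have chlow j y : 1 - 2 * right_defect (D j) (harmonic n) y <= ch j y.
  rewrite /ch; have [z /andP[z1 z2] ->] := bump_MVT y rr0 (dF j).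
  rewrite cdf_of_defect// (_ : (rr - rr * _) / rr = 1 - right_defect (D j) rr z); last first.
    by field; rewrite gt_eqF.
  rewrite lerD2l lerN2 /right_defect.
  rewrite (_ : 2 * (_ / _) = fine (mu (`]y, y + harmonic n]%classic `\` D j)) / rr); last first.
    by rewrite /rr; field; rewrite gt_eqF.
  rewrite ler_pM2r ?invr_gt0//; apply: fine_le.
  - by apply: measure_itv_setD_fin => //; exact: ltW.
  - by apply: measure_itv_setD_fin => //; exact: ltW.
  apply: le_measure; rewrite ?inE; [by apply: measurableD; [exact: measurable_itv|exact: mD]..|].
  by apply: subset_itvoc_setD; rewrite /rr in z2 *; lra.
have chsupp j y : ch j y != 0 -> d1 / 2 <= y <= K1.
  apply: contra_neqT; rewrite negb_and -!ltNge => hy.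
  rewrite /ch; have [z /andP[z1 z2] ->] := bump_MVT y rr0 (dF j).
  rewrite cdf_ofB//; last by rewrite lerDl ltW.
  rewrite (_ : D j `&` _ = set0) ?measure0 ?mul0r//.
  rewrite -subset0 => x [/Dsub /=]; rewrite !in_itv/= => /andP[x1 x2] /andP[x3 x4].
  by case/orP : hy => hy; rewrite /rr in z2 x4; lra.
have cch j : C1_line (ch j) (bump (cdf_of (D j)) rr).
  by apply: C1_line_bump => //; apply: nondecreasing_lip_continuous => y z; exact: lipD.
have main := @field_perimeter R alpha (d1 / 2) K K1 rho E b b' B B' m sg sg' ch
  (fun j => bump (cdf_of (D j)) rr) ltac:(lra) ltac:(lra) KK1 rho1
  (fun p Ep => conj (EK p Ep).1 (proj1 (andP (EK p Ep).2))) cb brho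
  (fun y hy => ltac:(have /andP[h1 h2] := bsupp y hy; lra)) cB yb
  (fun j => let: And5 h _ _ _ _ := Hsg j in h)
  (fun j => let: And5 _ h _ _ _ := Hsg j in h)
  cch (fun j y => proj1 (andP (ch01 j y))) chsum chsupp.
have mch j : measurable_fun setT (ch j).
  by apply: continuous_measurable_fun; exact: C1_line_cont (cch j).
have mwch j : measurable_fun setT (fun y => w y * ch j y) by exact: measurable_funM.
have wch0 j y : 0 <= w y * ch j y by rewrite mulr_ge0//; have /andP[] := ch01 j y.
have low j : ((2 - 2 * e)%:E * \int[mu]_(y in D j) (w y * ch j y)%:E <=
    \int[mu2]_(p in E) (sg' j p.1 * (w p.2 * ch j p.2))%:E)%E.
  have [csg _ sg'0 sq1 sq2] := Hsg j.
  apply: (@slice_integral_ge R E (D j) (sg' j) (fun y => w y * ch j y)) => //.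
  - by apply: continuous_measurable_fun; exact: csg.2.
  - by move=> x; have /andP[] := sg'0 x.
  - move=> y Dy; apply: (@ramp_slice_ge R _ (sg j) _ (q j) (r j)) => //.
      exact: measurable_ysection.
    exact: win.
have intj j : mu2.-integrable E (EFin \o (fun p => sg' j p.1 * (w p.2 * ch j p.2))).
  have [csg _ sg'0 sq1 sq2] := Hsg j.
  apply: (@bounded_integrable _ _ _ _ _ _ (2 / r j * (M * 1))) => //.
    apply: measurable_funTS; apply: measurable_funM.
      by apply: measurable_fun_fst1; apply: continuous_measurable_fun; exact: csg.2.
    exact: (measurable_fun_snd1 (mwch j)).
  move=> p /EK [_ pK]; have /andP[s0 s2] := sg'0 p.1; have /andP[ch0 ch1] := ch01 j p.2.
  have wp := wM _ pK; have wp0 := w0 p.2.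
  rewrite ger0_norm; last by rewrite mulr_ge0// mulr_ge0.
  by apply: ler_pM => //; apply: ler_pM.
have intB := integrable_height mE EK cB.2.
have {}main : (I + \sum_(j <- iota 0 m) \int[mu2]_(p in E) (sg' j p.1 * (w p.2 * ch j p.2))%:E <=
   weighted_perimeter alpha E)%E.
  apply: le_trans main; rewrite le_eqVlt; apply/orP; left; apply/eqP.
  rewrite -(@integral_sum _ _ _ mu2 E mE _ (fun j p => (sg' j p.1 * (w p.2 * ch j p.2))%:E) intj).
  rewrite /I -integralD//; last first.
    by apply: integrable_sum => // j _; exact: intj.
  by apply: eq_integral => p _; rewrite sumEFin -EFinD.
have up j : (\int[mu]_(y in D j) (w y)%:E <=
    \int[mu]_(y in D j) (w y * ch j y)%:E + (2 * M)%:E * rd j n)%E.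
  have mrd : measurable_fun setT (right_defect (D j) (harmonic n)) by exact: measurable_right_defect.
  have rdi y : 0 <= right_defect (D j) (harmonic n) y by have /andP[] := right_defect_itv y (mD j) h0.
  have m0 : measurable_fun (D j) (fun y => (w y)%:E).
    by apply/measurable_EFinP; exact: measurable_funTS.
  have m1 : measurable_fun (D j) (fun y => (w y * ch j y)%:E).
    by apply/measurable_EFinP; exact: measurable_funTS.
  have m2 : measurable_fun (D j) (fun y => (right_defect (D j) (harmonic n) y)%:E).
    by apply/measurable_EFinP; exact: measurable_funTS.
  have M20 : (0 <= (2 * M)%:E)%E by rewrite lee_fin mulr_ge0.
  have m3 := measurable_funeM (2 * M)%:E m2.
  rewrite /rd -ge0_integralZl; [|exact: mD|exact: m2|by move=> y _; rewrite lee_fin|exact: M20].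
  rewrite -ge0_integralD; [|exact: mD|by move=> y _; rewrite lee_fin|exact: m1
    |by move=> y _; rewrite mule_ge0// lee_fin|exact: m3].
  apply: ge0_le_integral; [exact: mD|by move=> y _; rewrite lee_fin|exact: m0
    |exact: emeasurable_funD|].
  move=> y Dy; rewrite -EFinM -EFinD lee_fin.
  have wy : w y <= M.
    by apply: wM; move: (Dsub _ _ Dy); rewrite /= in_itv/= => /andP[h1 h2]; lra.
  have := chlow j y; have := rdi y; have := w0 y; nra.
apply: (@le_trans _ _ (I + (2 - 2 * e)%:E * (\sum_(j <- iota 0 m)
   (\int[mu]_(y in D j) (w y * ch j y)%:E + (2 * M)%:E * rd j n)))%E).
  apply: leeD2l; apply: lee_wpmul2l; first by rewrite lee_fin.
  exact: lee_sum.
rewrite big_split/= ge0_muleDr; last 2 first.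
- by apply: sume_ge0 => j _; apply: integral_ge0 => y _; rewrite lee_fin.
- apply: sume_ge0 => j _; rewrite mule_ge0 ?lee_fin ?mulr_ge0//.
  by apply: integral_ge0 => y _; rewrite lee_fin; have /andP[] := right_defect_itv y (mD j) h0.
rewrite addeA; apply: leeD; last first.
  rewrite /err [X in (_ <= _ * X)%E]ge0_sume_distrr// => j _.
  by apply: integral_ge0 => y _; rewrite lee_fin; have /andP[] := right_defect_itv y (mD j) h0.
apply: le_trans main; apply: leeD2l.
rewrite ge0_sume_distrr; first exact: lee_sum.
by move=> j _; apply: integral_ge0 => y _; rewrite lee_fin.
Unshelve. all: by end_near. Qed.

End profile_bound.

Section profile_perimeter.
Context {R : realType}.
Local Notation mu := (@lebesgue_measure R).
Local Notation mu2 := (lebesgue_measure2 R).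

(** At a fixed precision [e] the rational windows are countably many and reach every nonnegligible
    slice. Their sets of heights are made disjoint, finite sums are bounded, the number of windows
    tends to infinity, and only then [e] tends to 0. *)
Lemma profile_perimeter (alpha K K1 d1 rho : R) (E : set (R * R))
    (b b' B B' : R -> R) :
  0 <= alpha -> 0 < d1 -> d1 <= K1 -> K <= K1 -> rho < 1 ->
  measurable E -> (forall p, E p -> `|p.1| < K /\ 0 < p.2 < K) ->
  C1_line b b' -> (forall y, `|b y| <= rho) ->
  (forall y, b y != 0 -> d1 <= y <= K1) ->
  C1_line B B' -> (forall y, 0 < y -> y `^ alpha * b y = B y) ->
  (\int[mu2]_(p in E) (B' p.2)%:E + 2%:E *
     \int[mu]_(y in `]d1, K[ `&` [set y | (0 < mu (ysection E y))%E])
       (y `^ alpha * Num.sqrt (1 - b y ^+ 2))%:E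
   <= weighted_perimeter alpha E)%E.
Proof.
move=> a0 d0 dK1 KK1 rho1 mE EK cb brho bsupp cB yb.
set w := fun y => y `^ alpha * Num.sqrt (1 - b y ^+ 2).
set I := (\int[mu2]_(p in E) (B' p.2)%:E)%E.
set S := `]d1, K[ `&` _.
set J := (\int[mu]_(y in S) (w y)%:E)%E.
have fI : I \is a fin_num by apply: integrable_fin_num => //; exact: integrable_height mE EK cB.2.
have w0 y : 0 <= w y by rewrite mulr_ge0 ?powR_ge0// sqrtr_ge0.
have mw : measurable_fun setT w.
  apply: measurable_funM; first exact: measurable_powR.
  have [a' [da _]] := C1_line_sqrt1B cb brho rho1.
  by apply: continuous_measurable_fun => x; exact: derive_continuous (da x).
have mwE A : measurable_fun A (fun y => (w y)%:E).
  by apply/measurable_EFinP; exact: measurable_funTS.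
have w0E y : (0 <= (w y)%:E)%E by rewrite lee_fin.
have mslice (A : set R) : measurable A ->
    measurable_fun setT (fun y => mu (A `\` ysection E y)).
  move=> mA.
  have -> : (fun y => mu (A `\` ysection E y)) = mu \o ysection ((A `*` setT) `\` E).
    apply/funext => y /=; congr (mu _); apply/seteqP; split => x /=.
      by rewrite /ysection/= !inE => -[Ax nE]; split => //; rewrite inE in nE.
    by rewrite /ysection/= inE => -[[Ax _] nE]; split => //; rewrite inE.
  apply: measurable_fun_ysection; apply: measurableD => //.
  exact: measurableX.
have mS : measurable S.
  apply: measurableI => //.
  rewrite -[X in measurable X]setTI; apply: emeasurable_fun_o_infty => //.
  exact: measurable_fun_ysection.
have key (e : R) : 0 < e <= 1 -> (I + (2 - 2 * e)%:E * J <= weighted_perimeter alpha E)%E.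
  move=> /andP[e0 e1].
  (* Integers that encode no pair repeat the pair [(0, 0)]; this is harmless, because [T] tests the
     actual slices against the window. *)
  pose code i : rat * nat := odflt (0, 0%N) (unpickle i).
  pose q i : R := ratr (code i).1.
  pose r i : R := harmonic (code i).2 / 4.
  have r0 i : 0 < r i by rewrite divr_gt0// harmonic_gt0.
  pose T i := `]d1, K[%classic `&`
    [set y | (mu (`](q i - 2 * r i)%R, q i]%classic `\` ysection E y) <= (e * r i)%:E)%E].
  have mT i : measurable (T i).
    apply: measurableI => //.
    rewrite -[X in measurable X]setTI; apply: emeasurable_fun_infty_c => //.
    exact: mslice.
  pose D := seqDU T.
  have mD i : measurable (D i).
    by apply: measurableD => //; apply: bigsetU_measurable => j _; exact: mT.
  have tD : trivIset setT D by exact: trivIset_seqDU.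
  have DT i : D i `<=` T i by exact: subDsetl.
  have SD : S `<=` \bigcup_i D i.
    rewrite /D -seqDU_bigcup_eq => y [yd ymu].
    have [qq [nn h]] := dense_window (measurable_ysection y mE) ymu e0.
    have cE : code (pickle (qq, nn)) = (qq, nn) by rewrite /code pickleK.
    exists (pickle (qq, nn)) => //; split; first exact: yd.
    by rewrite /mkset /q /r cE; exact: ltW.
  have bnd m : (I + (2 - 2 * e)%:E * \sum_(j <- iota 0 m) \int[mu]_(y in D j) (w y)%:E <=
      weighted_perimeter alpha E)%E.
    apply: (@window_perimeter R alpha K K1 d1 rho e E b b' B B' D q r m) => //.
    - by rewrite (ltW e0).
    - by move=> j y /DT [].
    - by move=> j y /DT [].
  have [->|Pfin] := eqVneq (weighted_perimeter alpha E) +oo%E; first by rewrite leey.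
  have mU : measurable (\bigcup_i D i) by exact: bigcup_measurable.
  apply: (@le_trans _ _ (I + (2 - 2 * e)%:E * \int[mu]_(y in \bigcup_i D i) (w y)%:E)%E).
    apply: leeD2l; apply: lee_wpmul2l; first by rewrite lee_fin; lra.
    apply: ge0_subset_integral; [exact: mS|exact: mU|exact: mwE|by move=> *|exact: SD].
  rewrite (@ge0_integral_bigcup _ _ _ lebesgue_measure D _ mD (mwE _) (fun x _ => w0E x) tD).
  have cS : cvgn (fun n => (\sum_(0 <= i < n) \int[mu]_(y in D i) (w y)%:E)%E).
    by apply: is_cvg_nneseries => i _ _; apply: integral_ge0.
  have cI : (I + (2 - 2 * e)%:E * \sum_(0 <= i < n) \int[mu]_(y in D i) (w y)%:E)%E @[n --> \oo]
      --> (I + (2 - 2 * e)%:E * \sum_(i <oo) \int[mu]_(y in D i) (w y)%:E)%E.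
    apply: cvgeD; [by rewrite fin_num_adde_defr|exact: cvg_cst|].
    exact: cvgeZl.
  apply: (cvge_to_le cI); apply: nearW => n.
  by have := bnd n; rewrite /index_iota subn0.
have J0 : (0 <= J)%E by apply: integral_ge0.
have [->|Pfin] := eqVneq (weighted_perimeter alpha E) +oo%E; first by rewrite leey.
(* At precision 1/2 the factor is 1: a finite perimeter makes [J] finite, and the limit in [e] can
   be taken among real numbers. *)
have h1 : (I + (2 - 2 * 2^-1)%:E * J <= weighted_perimeter alpha E)%E by apply: key; lra.
have Jfin : J \is a fin_num.
  rewrite ge0_fin_numE// ltey; apply: contra_neq Pfin => JE.
  move: h1; rewrite JE (_ : 2 - 2 * 2^-1 = 1 :> R); last by field.
  have IN : I != -oo%E by move: fI; rewrite fin_numE => /andP[].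
  by rewrite mul1e (addey IN) leye_eq => /eqP.
have Pf : weighted_perimeter alpha E \is a fin_num.
  rewrite fin_numE Pfin andbT; apply/eqP => PE; move: h1; rewrite PE leeNy_eq.
  by rewrite -(fineK fI) -(fineK Jfin).
move: key; rewrite -(fineK fI) -(fineK Jfin) -(fineK Pf).
move: (fine _) (fine _) (fine _) => p j i key.
rewrite -EFinM -EFinD lee_fin.
have j0 : 0 <= j \/ j < 0 by case: (leP 0 j); [left|right].
have {}key (e : R) : 0 < e <= 1 -> i + (2 - 2 * e) * j <= p.
  move=> he; have := key e he. rewrite -EFinM -EFinD lee_fin.
  exact.
case: j0 => j0; last by have := key 1; lra.
apply/ler_addgt0Pr => e e0.
have d0' : 0 < 2 * j + e by lra.
have := key (e / (2 * j + e)).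
have -> : 0 < e / (2 * j + e) <= 1 by rewrite divr_gt0//= ler_pdivrMr// mul1r; lra.
move=> /(_ isT); have : e / (2 * j + e) * (2 * j) <= e.
  by rewrite mulrAC ler_pdivrMr// ler_pM2l//; lra.
lra.
Qed.

End profile_perimeter.

(** * The isoperimetric inequality *)

Section barrier_function.
Context {R : realType}.
Local Notation mu := (@lebesgue_measure R).
Local Notation mu2 := (lebesgue_measure2 R).

(* For a cumulative distribution function [N], [N w = N y] says that almost no
   height between [w] and [y] is available for a change of level. *)
Definition feasible (alpha beta lam L : R) (N : R -> R) := forall w y,
  0 <= w -> w <= y -> y <= L -> N w = N y ->
  lam * (y `^ (beta + 1) - w `^ (beta + 1)) <= lower_barrier alpha beta w + y `^ alpha.

Lemma continuous_lower_barrier_max0 (alpha beta : R) : 0 <= alpha ->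
  continuous (fun y : R => lower_barrier alpha beta (Num.max y 0)).
Proof.
move=> a0; rewrite /lower_barrier; case: (beta <= alpha); first exact: cst_continuous.
exact: continuous_powR_max0.
Qed.

(** The pairs that violate the constraint by at least [eta] form a compact set, on which feasibility
    forbids [N w = N y]; pairs with [w > y] are never among them, by monotonicity of the power. The
    distance [|N w - N y|] therefore has a positive minimum there, and [M] is the largest possible
    left-hand side divided by it. *)
Lemma feasible_penalization (alpha beta lam L : R) (N : R -> R) (eta : R) :
  0 <= alpha -> 0 <= beta + 1 -> 0 < lam -> 0 <= L -> continuous N ->
  feasible alpha beta lam L N -> 0 < eta ->
  exists2 M, 0 <= M & forall w y, 0 <= w <= L -> 0 <= y <= L ->
    lam * y `^ (beta + 1) - y `^ alpha - eta <=
    lam * w `^ (beta + 1) + lower_barrier alpha beta w + M * `|N w - N y|.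
Proof.
move=> a0 b0 lam0 L0 cN feas eta0.
pose m0 (y : R) := Num.max y 0.
pose phi (p : R * R) := lam * m0 p.1 `^ (beta + 1) + lower_barrier alpha beta (m0 p.1)
   - lam * m0 p.2 `^ (beta + 1) + m0 p.2 `^ alpha.
have cphi : continuous phi.
  move=> p; rewrite /phi; apply: cvgD; last first.
    by apply: (continuous_snd1 (f := fun y => m0 y `^ alpha)); exact: continuous_powR_max0.
  apply: cvgB; last first.
    apply: cvgM; first exact: cvg_cst.
    by apply: (continuous_snd1 (f := fun y => m0 y `^ (beta + 1))); exact: continuous_powR_max0.
  apply: cvgD.
    apply: cvgM; first exact: cvg_cst.
    by apply: (continuous_fst1 (f := fun y => m0 y `^ (beta + 1))); exact: continuous_powR_max0.
  by apply: (continuous_fst1 (f := fun y => lower_barrier alpha beta (m0 y)));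
    exact: continuous_lower_barrier_max0.
pose A : set (R * R) := (`[0, L]%classic `*` `[0, L]%classic) `&` (phi @^-1` `]-oo, - eta]%classic).
have cA : compact A.
  apply: (@subclosed_compact _ A (`[0, L]%classic `*` `[0, L]%classic)).
  - apply: closedI; first by apply: compact_closed; [exact: norm_hausdorff|apply: compact_setX; exact: segment_compact].
    by apply: closed_comp => [p _|]; [exact: cphi|exact: interval_closed].
  - by apply: compact_setX; exact: segment_compact.
  - by move=> p [].
have m0E y : 0 <= y -> m0 y = y by move=> y0; rewrite /m0 max_l.
have out w y : 0 <= w <= L -> 0 <= y <= L -> ~ A (w, y) ->
    lam * y `^ (beta + 1) - y `^ alpha - eta <=
    lam * w `^ (beta + 1) + lower_barrier alpha beta w.
  move=> wL yL nA; rewrite leNgt; apply/negP => h; apply: nA.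
  split; first by split; rewrite /= in_itv.
  rewrite /= in_itv/= /phi/= !m0E; [lra|by case/andP : yL|by case/andP : wL].
have [A0|/set0P A0] := eqVneq A set0.
  exists 0 => // w y wL yL; rewrite mul0r addr0; apply: out => //.
  by rewrite A0.
have cD : continuous (fun p : R * R => `|N p.1 - N p.2|).
  move=> p; apply: cvg_norm; apply: cvgB; [exact: continuous_fst1|exact: continuous_snd1].
have [[w1 y1] cin cmin] := compact_EVT_min A0 cA (continuous_subspaceT cD).
rewrite inE in cin.
have mpos : 0 < `|N w1 - N y1|.
  rewrite normr_gt0 subr_eq0; apply/negP => /eqP NE.
  move: cin => [[/=]]; rewrite !in_itv/= => /andP[w0 wL] /andP[y0 yL].
  rewrite /phi/= !m0E// => h.
  have pa := powR_ge0 y1 alpha; have bw := lower_barrier_ge0 alpha beta w1.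
  have [wy|yw] := leP w1 y1.
    by have := feas _ _ w0 wy yL NE; lra.
  have : y1 `^ (beta + 1) <= w1 `^ (beta + 1).
    by apply: ge0_ler_powR; rewrite ?nnegrE// ltW.
  by move=> /(ler_wpM2l (ltW lam0)); lra.
exists (lam * L `^ (beta + 1) / `|N w1 - N y1|).
  by rewrite divr_ge0// mulr_ge0 ?powR_ge0// ltW.
move=> w y wL yL; have M0 : 0 <= lam * L `^ (beta + 1) / `|N w1 - N y1|.
  by rewrite divr_ge0// mulr_ge0 ?powR_ge0// ltW.
have [Awy|nA] := pselect (A (w, y)); last first.
  by apply: (le_trans (out _ _ wL yL nA)); rewrite lerDl mulr_ge0.
have h1 : lam * L `^ (beta + 1) <=
    lam * L `^ (beta + 1) / `|N w1 - N y1| * `|N w - N y|.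
  rewrite mulrAC ler_pdivlMr//; apply: ler_wpM2l; first by rewrite mulr_ge0 ?powR_ge0// ltW.
  by have := cmin (w, y); apply; rewrite inE.
have h2 : lam * y `^ (beta + 1) <= lam * L `^ (beta + 1).
  apply: ler_wpM2l; first exact: ltW.
  by apply: ge0_ler_powR; rewrite ?nnegrE//; case/andP : yL.
have := powR_ge0 y alpha; have := lower_barrier_ge0 alpha beta w.
have : 0 <= lam * w `^ (beta + 1) by rewrite mulr_ge0 ?powR_ge0// ltW.
by lra.
Qed.

(* The reset level [C] of the vertical field is locally constant on the part of
   the axis where the slices are nonnegligible: it only moves with [N]. It is
   the inf-convolution of the upper constraint with [M |N w - N y|]. *)
Lemma reset_level (alpha beta lam L : R) (N : R -> R) (eta : R) :
  0 <= alpha -> 0 <= beta + 1 -> 0 < lam -> 0 <= L -> continuous N ->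
  feasible alpha beta lam L N -> 0 < eta ->
  exists M (C : R -> R), [/\ 0 <= M, forall y, 0 <= C y,
    (forall y, 0 <= y <= L -> C y <= lam * y `^ (beta + 1) + lower_barrier alpha beta y),
    (forall y, 0 <= y <= L -> lam * y `^ (beta + 1) - y `^ alpha - eta <= C y) &
    (forall y z, `|C y - C z| <= M * `|N y - N z|)].
Proof.
move=> a0 b0 lam0 L0 cN feas eta0.
have [M M0 HM] := feasible_penalization a0 b0 lam0 L0 cN feas eta0.
pose A y := [set lam * w `^ (beta + 1) + lower_barrier alpha beta w + M * `|N w - N y|
  | w in `[0, L]%classic].
have A0 y : A y !=set0.
  by exists (lam * 0 `^ (beta + 1) + lower_barrier alpha beta 0 + M * `|N 0 - N y|), 0 => //=;
    rewrite in_itv/= lexx.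
have lb y : lbound (A y) 0.
  move=> _ [w _ <-]; rewrite !addr_ge0 ?lower_barrier_ge0 ?mulr_ge0 ?powR_ge0//.
  exact: ltW.
have hlb y : has_lbound (A y) by exists 0; exact: lb.
exists M, (fun y => inf (A y)); split => //.
- by move=> y; apply: lb_le_inf => //; exact: lb.
- move=> y yL; apply: ge_inf => //; exists y; first by rewrite /= in_itv.
  by rewrite subrr normr0 mulr0 addr0.
- move=> y yL; apply: lb_le_inf => // _ [w wL <-].
  by apply: HM => //; move: wL; rewrite /= in_itv.
- suff h y z : inf (A y) - inf (A z) <= M * `|N y - N z|.
    move=> y z; rewrite ler_norml h andbT.
    by have := h z y; rewrite distrC; lra.
  rewrite lerBlDr -lerBlDl; apply: lb_le_inf => // _ [w wL <-].
  rewrite lerBlDl; apply: (@le_trans _ _ (lam * w `^ (beta + 1) +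
      lower_barrier alpha beta w + M * `|N w - N y|)).
    by apply: ge_inf => //; exists w.
  have : M * `|N w - N y| <= M * (`|N w - N z| + `|N y - N z|).
    apply: ler_wpM2l => //; rewrite (distrC (N y)).
    by rewrite (le_trans _ (ler_normD _ _))// addrA subrK.
  by rewrite mulrDr; lra.
Qed.

(** The cut-off vanishes below [d], which removes the singularity of real powers at height 0. *)
Lemma C1_line_cut (ch ch' f f' : R -> R) (d : R) : 0 < d -> C1_line ch ch' ->
  (forall y : R, y < d -> ch y = 0) ->
  (forall y : R, 0 < y -> is_derive y 1 f (f' y)) ->
  (forall y : R, 0 < y -> {for y, continuous f'}) ->
  C1_line (fun y => ch y * f y) (fun y => ch y * f' y + f y * ch' y).
Proof.
move=> d0 cch ch0 df cf.
have ch'0 (y : R) : y < d -> ch' y = 0.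
  move=> yd; have h : is_derive y 1 ch (ch' y) := cch.1 y.
  have h0 : is_derive y 1 ch 0.
    have hc : is_derive y 1 (cst (0 : R) : R -> R) 0 by exact: is_derive_cst.
    apply: near_eq_is_derive hc.
    by near=> z; rewrite /= ch0//; near: z; exact: (lt_nbhsl yd).
  by rewrite -(@derive_val _ _ _ _ _ _ _ h) (@derive_val _ _ _ _ _ _ _ h0).
have H (y : R) : y < d \/ 0 < y by case: (ltP y d) => h; [left|right; lra].
split => y; have [yd|y0] := H y.
- rewrite ch'0// ch0// mul0r mulr0 addr0.
  have hc : is_derive y 1 (cst (0 : R) : R -> R) 0 by exact: is_derive_cst.
  apply: near_eq_is_derive hc.
  by near=> z; rewrite /= ch0 ?mul0r//; near: z; exact: (lt_nbhsl yd).
- by have ? := cch.1 y; have ? := df y y0; exact: is_deriveM.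
- apply: cvg_near_cst; near=> z.
  have zd : z < d by near: z; exact: (lt_nbhsl yd).
  by rewrite ch'0// ch0// ch'0// ch0// !mul0r !mulr0.
- apply: cvgD; apply: cvgM.
  + exact: (C1_line_cont cch).
  + exact: cf.
  + exact: derive_continuous (df y y0).
  + exact: cch.2.
Unshelve. all: by end_near. Qed.

(** Slices have length at most [2 K] and only the nonnegligible ones count. Error terms that depend
    on the height alone are controlled in this way by their integral over those heights. *)
Lemma integral_height_le (E : set (R * R)) (K : R) (h : R -> R) :
  measurable E -> (forall p, E p -> `|p.1| < K) -> measurable_fun setT h ->
  (forall y, 0 <= h y) -> 
  (\int[mu2]_(p in E) (h p.2)%:E <=
   (2 * K)%:E * \int[mu]_(y in [set y | (0 < mu (ysection E y))%E]) (h y)%:E)%E.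
Proof.
move=> mE EK mh h0.
have [->|/set0P[p0 /EK p0K]] := eqVneq E set0.
  rewrite integral_set0 (_ : [set y | _] = set0) ?integral_set0 ?mule0//.
  by rewrite -subset0 => y /=; rewrite ysection0 measure0 ltxx.
have K0 : 0 < K by exact: le_lt_trans p0K.
have mS : measurable [set y | (0 < mu (ysection E y))%E].
  rewrite -[X in measurable X]setTI; apply: emeasurable_fun_o_infty => //.
  exact: measurable_fun_ysection.
have mhE A : measurable_fun A (fun y => (h y)%:E).
  by apply/measurable_EFinP; exact: measurable_funTS.
have K20 : (0 <= (2 * K)%:E)%E by rewrite lee_fin; lra.
rewrite (@fubini_tonelli2_set _ _ (fun p => h p.2))//; last exact: measurable_fun_snd1.
rewrite -ge0_integralZl; [|exact: mS|exact: mhE|by move=> y _; rewrite lee_fin|exact: K20].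
rewrite [leRHS]integral_mkcond.
have E1 y : (\int[mu]_(x in ysection E y) (h y)%:E = (h y)%:E * mu (ysection E y))%E.
  by rewrite integral_cst//; exact: measurable_ysection.
apply: (@le_trans _ _ (\int[mu]_y ((h y)%:E * mu (ysection E y)))%E).
  by rewrite le_eqVlt; apply/orP; left; apply/eqP; apply: eq_integral => y _; exact: E1.
apply: ge0_le_integral => //.
- by move=> y _; rewrite mule_ge0// lee_fin.
- by apply: emeasurable_funM; [exact: mhE|exact: measurable_fun_ysection].
- apply/(measurable_restrictT _ mS); exact: measurable_funeM.
- move=> y _; rewrite /patch; case: ifPn => [_|].
    rewrite muleC; apply: lee_wpmul2r; first by rewrite lee_fin.
    apply: (@le_trans _ _ (mu `](- K)%R, (- K + 2 * K)%R]%classic)).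
      apply: le_measure; rewrite ?inE; [exact: measurable_ysection|exact: measurable_itv|].
      move=> x; rewrite /ysection/= inE => /EK /=; rewrite ltr_norml in_itv/= => /andP[h1 h2].
      by apply/andP; split => //; lra.
    by rewrite lebesgue_measure_itvoc//; lra.
  rewrite notin_setE/= => /negP; rewrite -leNgt => h1.
  have -> : mu (ysection E y) = 0%E by apply/eqP; rewrite eq_le h1 measure_ge0.
  by rewrite mule0.
Qed.

End barrier_function.

(** * The bound away from the boundary line *)

Section truncated_bound.
Context {R : realType}.
Local Notation mu := (@lebesgue_measure R).
Local Notation mu2 := (lebesgue_measure2 R).

Lemma C1_line_locally_cst (f f' : R -> R) (y k : R) : C1_line f f' ->
  (\forall z \near y, f z = k) -> f' y = 0.
Proof.
move=> cf fk; have h : is_derive y 1 f (f' y) := cf.1 y.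
have hc : is_derive y 1 (cst k : R -> R) 0 by exact: is_derive_cst.
have h0 : is_derive y 1 f 0.
  by apply: near_eq_is_derive hc; apply: filterS fk => z /= ->.
by rewrite -(@derive_val _ _ _ _ _ _ _ h) (@derive_val _ _ _ _ _ _ _ h0).
Qed.

Lemma lipschitz_continuous (f : R -> R) (M : R) :
  (forall y z, `|f y - f z| <= M * `|y - z|) -> continuous f.
Proof.
move=> lip y; apply/cvgrPdist_lt => e e0.
have M0 : 0 <= M.
  by have := lip 1 0; rewrite subr0 normr1 mulr1; apply: le_trans.
have d0 : 0 < e / (M + 1) by rewrite divr_gt0//; lra.
near=> z; apply: (le_lt_trans (lip _ _)).
have : `|y - z| < e / (M + 1) by near: z; apply: (@cvgr_dist_lt _ _ _ _ _ (fun z : R => z) y).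
rewrite ltr_pdivlMr; last lra.
by have := normr_ge0 (y - z); nra.
Unshelve. all: by end_near. Qed.

Lemma lower_barrier_mono (alpha beta : R) y z : 0 <= alpha -> 0 <= y -> y <= z ->
  lower_barrier alpha beta y <= lower_barrier alpha beta z.
Proof.
move=> a0 y0 yz; rewrite /lower_barrier; case: (beta <= alpha) => //.
by apply: ge0_ler_powR; rewrite ?nnegrE// (le_trans y0).
Qed.

(** When [|B| <= Y], the square of [Bt] exceeds that of [B] by at most [(2 delta + delta^2) Y^2],
    which is less than the room [(4 delta + 4 delta^2) Y^2] won by the factor [1 + 2 delta].
    Otherwise the left-hand side is 0. *)
Lemma arc_density_le (Y Bt B delta : R) : 0 < Y -> 0 <= delta ->
  `|Bt - B| <= delta * Y ->
  Num.sqrt (Y ^+ 2 - B ^+ 2) <=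
  (1 + 2 * delta) * (Y * Num.sqrt (1 - (Y^-1 * (Bt / (1 + 2 * delta))) ^+ 2)).
Proof.
move=> Y0 d0 BtB; have d1 : 0 < 1 + 2 * delta by lra.
have -> : (1 + 2 * delta) * (Y * Num.sqrt (1 - (Y^-1 * (Bt / (1 + 2 * delta))) ^+ 2)) =
   Num.sqrt (((1 + 2 * delta) * Y) ^+ 2 - Bt ^+ 2).
  rewrite mulrA -{1}(ger0_norm (_ : 0 <= (1 + 2 * delta) * Y)); last by rewrite mulr_ge0// ltW.
  rewrite -sqrtr_sqr -sqrtrM ?sqr_ge0//; congr (Num.sqrt _).
  by field; rewrite !gt_eqF.
have [YB|BY] := leP (Y ^+ 2) (B ^+ 2).
  by rewrite ler0_sqrtr ?sqrtr_ge0// subr_le0.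
apply: ler_wsqrtr.
have B1 : `|B| <= Y.
  rewrite -(ger0_norm (ltW Y0)) -ler_sqr ?nnegrE//; rewrite !real_normK ?num_real//.
  exact: ltW.
have Bt2 : Bt ^+ 2 <= (`|B| + delta * Y) ^+ 2.
  rewrite -(real_normK (num_real Bt)) ler_sqr ?nnegrE ?addr_ge0 ?mulr_ge0 ?(ltW Y0)//.
  by rewrite -lerBlDl (le_trans (lerB_dist _ _)).
have : (`|B| + delta * Y) ^+ 2 <= B ^+ 2 + 2 * delta * Y ^+ 2 + delta ^+ 2 * Y ^+ 2.
  rewrite sqrrD real_normK ?num_real// exprMn lerD2r lerD2l.
  have : `|B| * (delta * Y) <= Y * (delta * Y) by apply: ler_wpM2r => //; rewrite mulr_ge0// ltW.
  rewrite -mulr_natl; lra.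
have : 0 <= delta ^+ 2 * Y ^+ 2 by rewrite mulr_ge0 ?sqr_ge0.
have : 0 <= delta * Y ^+ 2 by rewrite mulr_ge0 ?sqr_ge0.
have -> : ((1 + 2 * delta) * Y) ^+ 2 = Y ^+ 2 + 4 * (delta * Y ^+ 2) + 4 * (delta ^+ 2 * Y ^+ 2) by ring.
lra.
Qed.

(** The profile [lam y^(beta+1) - C(y)] is averaged over short forward windows to become C^1, cut
    off near height 0, and divided by [1 + 2 delta] so that its ratio to [y^alpha] stays strictly
    below 1 despite the errors. As [N p = N q], the level is constant on [[p, q]]; the upper
    constraint at [p] and the lower one at [q] place it within [eta] of [c]. For [p = q] only the
    area term remains. *)
Lemma truncated_arc_bound (alpha beta lam K L p q delta c : R) (E : set (R * R))
    (S := [set y | (0 < mu (ysection E y))%E])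
    (N := cdf_of (`]0, L]%classic `\` S)) :
  0 <= alpha -> alpha < beta + 1 -> beta <= 2 * alpha -> 0 < lam -> 0 < K ->
  K + 2 <= L -> 0 < delta -> delta <= 1 -> 3 * delta <= K -> measurable E ->
  (forall p, E p -> `|p.1| < K /\ 0 < p.2 < K) ->
  feasible alpha beta lam L N ->
  0 <= p -> p <= q -> q <= L -> N p = N q ->
  c = lam * p `^ (beta + 1) + lower_barrier alpha beta p ->
  (p < q -> lam * q `^ (beta + 1) - q `^ alpha = c) ->
  ((lam * (beta + 1))%:E * \int[mu2]_(z in E `&` [set z | (3 * delta < z.2)%R]) (z.2 `^ beta)%:E +
   2%:E * \int[mu]_(y in `]p, q[ `&` `](3 * delta)%R, +oo[)
     (Num.sqrt ((y `^ alpha) ^+ 2 - (lam * y `^ (beta + 1) - c) ^+ 2))%:E <=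
   (1 + 2 * delta)%:E * weighted_perimeter alpha E +
   (delta + 4 * K * (lam * (3 * delta) `^ (beta + 1) +
      lower_barrier alpha beta (3 * delta) + delta))%:E)%E.
Proof.
move=> a0 ab b2a lam0 K0 KL d0 d1 dK mE EK feas p0 pq qL Npq cE tight.
have b1 : 0 < beta + 1 by lra.
have L0 : 0 <= L by lra.
have mS : measurable S.
  rewrite -[X in measurable X]setTI; apply: emeasurable_fun_o_infty => //.
  exact: measurable_fun_ysection.
have SK : S `<=` `]0, K[%classic.
  move=> y Sy; have [x] : ysection E y !=set0.
    by apply/set0P/eqP => E0; move: Sy; rewrite /S/= E0 measure0 ltxx.
  by rewrite /ysection/= inE => /EK [_]; rewrite in_itv.
have fin_itv (u v : R) (A : set R) : measurable A -> A `<=` `]u, v]%classic -> (mu A < +oo)%E.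
  move=> mA Auv; apply: (@le_lt_trans _ _ (mu `]u, v]%classic)).
    by apply: le_measure; rewrite ?inE.
  by rewrite lebesgue_measure_itv/=; case: ifP => _; rewrite -?EFinB ltry.
have Sfin : (mu S < +oo)%E.
  apply: (@fin_itv 0 K) => // y /SK; rewrite /= !in_itv/= => /andP[-> h]; exact: ltW.
set Z := `]0, L]%classic `\` S in N feas Npq.
have mZ : measurable Z by exact: measurableD.
have Zfin : (mu Z < +oo)%E by apply: (@fin_itv 0 L) => // y [].
have lipN y z : y <= z -> 0 <= N z - N y <= z - y by exact: cdf_of_lip.
have cN : continuous N by exact: nondecreasing_lip_continuous.
(* A lower bound for [y^alpha] on the support of the field. The errors of the reset level and of its
   averaging will each be at most [delta * w / 2]. *)
set w := delta `^ alpha; have w0 : 0 < w by exact: powR_gt0.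
pose eta := delta * w / 2; have eta0 : 0 < eta by rewrite divr_gt0// mulr_gt0.
have [M [C [M0 C0 Cup Clow Clip]]] := reset_level a0 (ltW b1) lam0 L0 cN feas eta0.
have normN y z : `|N y - N z| <= `|y - z|.
  have [yz|zy] := leP y z.
    have /andP[h1 h2] := lipN _ _ yz.
    by rewrite distrC (ger0_norm h1) distrC ger0_norm// subr_ge0.
  have /andP[h1 h2] := lipN _ _ (ltW zy).
  by rewrite (ger0_norm h1) ger0_norm// subr_ge0 ltW.
have ClipM y z : `|C y - C z| <= M * `|y - z|.
  by apply: (le_trans (Clip _ _)); exact: ler_wpM2l.
have cC : continuous C by exact: lipschitz_continuous ClipM.
have [FC dFC] := antiderivative cC.
(* The averaging scale: it makes the averaged level close to the level, and also makes small the
   integral of its derivative over the heights of [S], since that derivative is at most [M] times a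
   right defect. *)
have [n [hn1 hn2 hn3]] : exists n, [/\ M * harmonic n <= eta, M * harmonic n <= delta &
    ((M * (2 * K))%:E * \int[mu]_(y in S) (right_defect S (harmonic n) y)%:E <= delta%:E)%E].
  have hM : M * harmonic n @[n --> \oo] --> 0.
    by rewrite -(mulr0 M); apply: cvgMr; exact: cvg_harmonic.
  have hI : ((M * (2 * K))%:E * \int[mu]_(y in S) (right_defect S (harmonic n) y)%:E)%E
      @[n --> \oo] --> 0%E.
    have fM : (M * (2 * K))%:E \is a fin_num by [].
    by have := cvgeZl fM (integral_right_defect_cvg0 mS Sfin); rewrite mule0; exact.
  have n1 : \forall n \near \oo, M * harmonic n < eta.
    by apply: cvgr_lt hM _ _.
  have n2 : \forall n \near \oo, M * harmonic n < delta.
    by apply: cvgr_lt hM _ _.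
  have n3 : \forall n \near \oo, ((M * (2 * K))%:E * \int[mu]_(y in S) (right_defect S (harmonic n) y)%:E < delta%:E)%E.
    have dE : (0 < delta%:E)%E by rewrite lte_fin.
    exact: (hI _ (open_ereal_lt' dE)).
  have [n _ /(_ n (leqnn n)) [[h1 h2] h3]] := filterI (filterI n1 n2) n3.
  by exists n; split; exact: ltW.
move: (@harmonic_gt0 R n) hn1 hn2 hn3; move: (harmonic n) => e e0 Me1 Me2 Me3.
(* The mean of [C] over [[y, y + e]], written with a primitive so that its derivative is an
   increment of [C]. *)
pose Ce y := (FC (y + e) - FC y) / e.
pose Ce' y := (C (y + e) - C y) / e.
have dCe (y : R) : is_derive y 1 Ce (Ce' y).
  have h1 := is_derive_shift (dFC (y + e)); have h2 := dFC y.
  rewrite /Ce /Ce'; apply: is_derive_eq; rewrite /GRing.scale/=; ring.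
have cCe' : continuous Ce'.
  move=> y; apply: cvgM; last exact: cvg_cst.
  apply: cvgB; last exact: cC.
  apply: (@continuous_comp _ _ _ (fun y => y + e) C); last exact: cC.
  by apply: cvgD; [exact: cvg_id|exact: cvg_cst].
have CeC y : `|Ce y - C y| <= M * e.
  have ye : y < y + e by rewrite ltrDl.
  have cF : {within `[y, y + e], continuous FC}.
    by apply: continuous_subspaceT => x; exact: derive_continuous (dFC x).
  have [z] := @MVT R _ _ y (y + e) ye (fun x _ => dFC x) cF.
  rewrite in_itv/= => /andP[z1 z2] E1.
  rewrite /Ce E1 addrAC subrr add0r mulfK ?gt_eqF//.
  apply: (le_trans (ClipM _ _)); apply: ler_wpM2l => //.
  by clear -z1 z2; rewrite ger0_norm; lra.
have rdN y : `|Ce' y| <= M * right_defect S e y.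
  rewrite /Ce' normrM normfV (gtr0_norm e0) /right_defect mulrA ler_pM2r ?invr_gt0//.
  apply: (le_trans (Clip _ _)); apply: ler_wpM2l => //.
  have ye : y <= y + e by rewrite lerDl ltW.
  have /andP[h1 _] := lipN _ _ ye; rewrite (ger0_norm h1) cdf_ofB//.
  apply: fine_le.
  - rewrite ge0_fin_numE//; apply: le_lt_trans Zfin.
    by apply: le_measure; rewrite ?inE//; exact: measurableI.
  - by apply: measure_itv_setD_fin => //; exact: ltW.
  - apply: le_measure; rewrite ?inE; [exact: measurableI|exact: measurableD|].
    by move=> x [[_ nS] xi].
have dd1 : 0 < 1 + 2 * delta by lra.
have [X [X' [cX X01 X1 Xs X'd]]] := @plateau R (3 * delta) K delta d0 dK.
have Xlow (y : R) : y < delta -> X y = 0.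
  by move=> yd; apply/eqP; apply: contraTT yd => /Xs; rewrite -leNgt => /andP[+ _]; clear; lra.
pose f y := (lam * y `^ (beta + 1) - Ce y) / (1 + 2 * delta).
pose f' y := (lam * ((beta + 1) * y `^ beta) - Ce' y) / (1 + 2 * delta).
pose g y := y `^ (- alpha) * f y.
pose g' y := y `^ (- alpha) * f' y + f y * (- alpha * y `^ (- alpha - 1)).
have df (y : R) : 0 < y -> is_derive y 1 f (f' y).
  move=> y0; have h1 := is_derive1_powR (beta + 1) y0; have h2 := dCe y.
  rewrite (_ : beta + 1 - 1 = beta) in h1; last by ring.
  by rewrite /f /f'; apply: is_derive_eq; rewrite /GRing.scale/=; ring.
have cpow (a y : R) : 0 < y -> {for y, continuous (fun y : R => y `^ a)}.
  by move=> y0; exact: derive_continuous (is_derive1_powR a y0).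
have cf' (y : R) : 0 < y -> {for y, continuous f'}.
  move=> y0; apply: cvgM; last exact: cvg_cst.
  apply: cvgB; last exact: cCe'.
  by apply: cvgM; [exact: cvg_cst|apply: cvgM; [exact: cvg_cst|exact: cpow]].
have dg (y : R) : 0 < y -> is_derive y 1 g (g' y).
  move=> y0; have h1 := is_derive1_powR (- alpha) y0; have h2 := df y y0.
  exact: is_deriveM.
have cg' (y : R) : 0 < y -> {for y, continuous g'}.
  move=> y0; apply: cvgD; apply: cvgM.
  - exact: cpow.
  - exact: cf'.
  - exact: derive_continuous (df y y0).
  - by apply: cvgM; [exact: cvg_cst|exact: cpow].
have cB := C1_line_cut d0 cX Xlow df cf'.
have cb := C1_line_cut d0 cX Xlow dg cg'.
set B' := (fun y => X y * f' y + f y * X' y) in cB.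
set b := (fun y => X y * g y) in cb.
have Btlow y : 0 <= y <= L -> - lower_barrier alpha beta y - M * e <= lam * y `^ (beta + 1) - Ce y.
  move=> yL; have := Cup _ yL; have := CeC y; rewrite ler_norml; clear; lra.
have Bthigh y : 0 <= y <= L -> lam * y `^ (beta + 1) - Ce y <= y `^ alpha + eta + M * e.
  move=> yL; have := Clow _ yL; have := CeC y; rewrite ler_norml; clear; lra.
pose rho := (1 + delta) / (1 + 2 * delta).
have rho1 : rho < 1 by rewrite ltr_pdivrMr//; clear -d0; lra.
have brho y : `|b y| <= rho.
  have [X0|X0] := eqVneq (X y) 0.
    by rewrite /b X0 mul0r normr0 divr_ge0//; clear -d0; lra.
  have /andP[y1 y2] := Xs _ X0.
  have y0 : 0 < y by clear -y1 d0; lra.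
  have yL : 0 <= y <= L by clear -y0 y2 d1 KL; apply/andP; split; lra.
  have yw : w <= y `^ alpha by apply: ge0_ler_powR; rewrite ?nnegrE// ?(ltW d0) ?(ltW y0)//; clear -y1; lra.
  have ya : 0 < y `^ alpha by exact: powR_gt0.
  have h : `|lam * y `^ (beta + 1) - Ce y| <= (1 + delta) * y `^ alpha.
    have h1 := Btlow _ yL; have h2 := Bthigh _ yL; have h3 := lower_barrier_le alpha beta y.
    have h4 : delta * w <= delta * y `^ alpha by rewrite ler_pM2l.
    by rewrite ler_norml; move: h1 h2 h3 h4 Me1 eta0; rewrite /eta; clear; lra.
  have /andP[x0 x1] := X01 y.
  rewrite /b normrM (ger0_norm x0); apply: (@le_trans _ _ (1 * `|g y|)); first exact: ler_wpM2r.
  rewrite mul1r /g /f powRN normrM normfV (gtr0_norm ya) normrM normfV (gtr0_norm dd1).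
  rewrite mulrA ler_pM2r ?invr_gt0// mulrC ler_pdivrMr//.
have bsupp y : b y != 0 -> delta <= y <= L.
  rewrite /b mulf_eq0 negb_or => /andP[/Xs /andP[h1 h2] _].
  by clear -h1 h2 d1 KL; apply/andP; split; lra.
have yb (y : R) : 0 < y -> y `^ alpha * b y = X y * f y.
  move=> y0; rewrite /b /g mulrCA; congr (_ * _).
  by rewrite mulrA powRN mulfV ?mul1r// gt_eqF ?powR_gt0.
have dL : delta <= L by clear -d1 K0 KL; lra.
have KL' : K <= L by clear -KL; lra.
have main := @profile_perimeter R alpha K L delta rho E b _ _ B' a0 d0 dL KL'
  rho1 mE EK cb brho bsupp cB yb.
move: main; set J0 := (\int[mu]_(y in _ `&` _) _)%E; set I := (\int[mu2]_(z in E) (B' z.2)%:E)%E => main.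
(* Bounds [|lam y^(beta+1) - Ce y|] for heights between [delta] and [3 delta], where the cut-off
   varies. *)
pose V := lam * (3 * delta) `^ (beta + 1) + lower_barrier alpha beta (3 * delta) + delta.
have V0 : 0 <= V.
  by rewrite !addr_ge0 ?lower_barrier_ge0 ?mulr_ge0 ?powR_ge0// ltW.
have Efin : (mu2 E < +oo)%E.
  apply: (@measure2_bounded_lty _ _ K) => // z /EK [h1 /andP[h2 h3]].
  by rewrite (ltW h1) ger0_norm ?(ltW h3)// ltW.
have fI : I \is a fin_num by apply: integrable_fin_num => //; exact: integrable_height mE EK cB.2.
have area : ((lam * (beta + 1))%:E * \int[mu2]_(z in E `&` [set z | (3 * delta < z.2)%R]) (z.2 `^ beta)%:E <=
   (1 + 2 * delta)%:E * I + (delta + 4 * K * V)%:E)%E.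
  pose rd := right_defect S e.
  have rd01 y : 0 <= rd y <= 1 by exact: right_defect_itv.
  have mrd : measurable_fun setT rd by exact: measurable_right_defect.
  pose h2 y := M * rd y.
  pose W := `[delta, 3 * delta]%classic : set R.
  pose h3 y := V / delta * \1_W y.
  have Vd0 : 0 <= V / delta by rewrite divr_ge0// ltW.
  have h20 y : 0 <= h2 y by rewrite mulr_ge0//; have /andP[] := rd01 y.
  have h30 y : 0 <= h3 y by rewrite mulr_ge0// indicE.
  have mh2 : measurable_fun setT h2 by apply: measurable_funM => //; exact: measurable_cst.
  have mW : measurable W by exact: measurable_itv.
  have m1W : measurable_fun setT (\1_W : R -> R) by exact: measurable_indic.
  have mh3 : measurable_fun setT h3 by apply: measurable_funM; [exact: measurable_cst|exact: m1W].
  have ih2 : mu2.-integrable E (EFin \o (fun z => h2 z.2)).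
    apply: (@bounded_integrable _ _ _ _ _ _ (M * 1)) => //.
      by apply: measurable_funTS; exact: measurable_fun_snd1.
    by move=> z _; rewrite ger0_norm//; apply: ler_wpM2l => //; have /andP[] := rd01 z.2.
  have ih3 : mu2.-integrable E (EFin \o (fun z => h3 z.2)).
    apply: (@bounded_integrable _ _ _ _ _ _ (V / delta * 1)) => //.
      by apply: measurable_funTS; exact: measurable_fun_snd1.
    by move=> z _; rewrite ger0_norm//; apply: ler_wpM2l => //; rewrite indicE; case: (_ \in _).
  have ih1 : mu2.-integrable E (EFin \o (fun z => B' z.2)) by exact: integrable_height mE EK cB.2.
  (* The rescaled divergence is corrected by [h2] for the drift of the averaged level and by [h3]
     for the slope of the cut-off. The sum is nonnegative on [E] and dominates
     [lam (beta + 1) y^beta] above [3 delta]; the corrections integrate to at most [delta] and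
     [4 K V]. *)
  pose G (z : R * R) := (1 + 2 * delta) * B' z.2 + h2 z.2 + h3 z.2.
  have GB y : (1 + 2 * delta) * B' y = X y * (lam * ((beta + 1) * y `^ beta) - Ce' y) +
      (lam * y `^ (beta + 1) - Ce y) * X' y.
    by rewrite /B' /f /f'; field; rewrite gt_eqF.
  have lb0 y : 0 <= lam * ((beta + 1) * y `^ beta).
    by rewrite mulr_ge0 ?(ltW lam0)// mulr_ge0 ?(ltW b1)// powR_ge0.
  have GP1 z : E z -> 3 * delta < z.2 -> lam * (beta + 1) * z.2 `^ beta <= G z.
    move=> /EK [_ /andP[z0 zK]] zd.
    have Xz : X z.2 = 1 by apply: X1; rewrite (ltW zd) (ltW zK).
    have X'z : X' z.2 = 0.
      apply: (C1_line_locally_cst (k := 1) cX); near=> y; apply: X1.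
      apply/andP; split; apply/ltW; near: y; [exact: (lt_nbhsr zd)|exact: (lt_nbhsl zK)].
    rewrite /G GB Xz X'z mulr0 addr0 mul1r.
    have := rdN z.2; have := h30 z.2; rewrite ler_norml /h2 /rd -mulrA; clear; lra.
  have GP0 z : E z -> 0 <= G z.
    move=> Ez; have [zd|zd] := ltP (3 * delta) z.2.
      by apply: le_trans (GP1 _ Ez zd); rewrite -mulrA.
    have := EK _ Ez => -[_ /andP[z0 zK]].
    have [zd'|zd'] := ltP z.2 delta.
      have Xz : X z.2 = 0 by exact: Xlow.
      have X'z : X' z.2 = 0.
        apply: (C1_line_locally_cst (k := 0) cX); near=> y; apply: Xlow.
        by near: y; exact: (lt_nbhsl zd').
      by rewrite /G GB Xz X'z mul0r mulr0 !add0r addr_ge0.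
    have zW : h3 z.2 = V / delta.
      by rewrite /h3 indicE mem_set ?mulr1// /W /= in_itv/= zd' zd.
    have zL : 0 <= z.2 <= L by rewrite (ltW z0)/=; clear -zK KL; lra.
    have hV : `|lam * z.2 `^ (beta + 1) - Ce z.2| <= V.
      have om := lower_barrier_mono beta a0 (ltW z0) zd.
      have pw : lam * z.2 `^ (beta + 1) <= lam * (3 * delta) `^ (beta + 1).
        apply: ler_wpM2l; first exact: ltW.
        by apply: ge0_ler_powR; rewrite ?nnegrE ?(ltW b1) ?(ltW z0)//; clear -d0; lra.
      have pz0 : 0 <= lam * z.2 `^ (beta + 1) by rewrite mulr_ge0 ?(ltW lam0) ?powR_ge0.
      have := Cup _ zL; have := C0 z.2; have := CeC z.2.
      rewrite !ler_norml /V; move: om pw pz0 Me2; have := lower_barrier_ge0 alpha beta (3 * delta).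
      clear; lra.
    have hX' : `|(lam * z.2 `^ (beta + 1) - Ce z.2) * X' z.2| <= V / delta.
      by rewrite normrM; apply: ler_pM.
    have hCe : `|X z.2 * Ce' z.2| <= h2 z.2.
      have /andP[x0 x1] := X01 z.2.
      rewrite normrM (ger0_norm x0); apply: le_trans (rdN z.2).
      by rewrite ler_piMl.
    have hX : 0 <= X z.2 * (lam * ((beta + 1) * z.2 `^ beta)).
      by have /andP[x0 _] := X01 z.2; rewrite mulr_ge0.
    rewrite /G GB zW; move: hX' hCe hX; rewrite !ler_norml; clear; lra.
  have mG : measurable_fun setT (EFin \o G).
    apply/measurable_EFinP; apply: measurable_funD; last exact: measurable_fun_snd1.
    apply: measurable_funD; last exact: measurable_fun_snd1.
    apply: measurable_funM => //; apply: measurable_fun_snd1.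
    by apply: continuous_measurable_fun; exact: cB.2.
  have mP : measurable [set z : R * R | 3 * delta < z.2].
    have -> : [set z : R * R | 3 * delta < z.2] = setT `*` `]3 * delta, +oo[%classic.
      by apply/seteqP; split=> z /=; rewrite in_itv/= andbT => // -[].
    exact: measurableX.
  have mEP := measurableI _ _ mE mP.
  have lb10 : (0 <= (lam * (beta + 1))%:E)%E by rewrite lee_fin mulr_ge0 ?(ltW lam0) ?(ltW b1).
  have mzb A : measurable_fun A (fun z : R * R => (z.2 `^ beta)%:E).
    apply/measurable_EFinP; apply: measurable_funTS.
    by apply: (measurable_fun_snd1 (f := fun y => y `^ beta)); exact: measurable_powR.
  rewrite -ge0_integralZl; [|exact: mEP|exact: mzb|by move=> z _; rewrite lee_fin powR_ge0|exact: lb10].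
  apply: (@le_trans _ _ (\int[mu2]_(z in E) (G z)%:E)%E).
    apply: (@le_trans _ _ (\int[mu2]_(z in E `&` [set z | (3 * delta < z.2)%R]) (G z)%:E)%E).
      apply: ge0_le_integral; [exact: mEP| | | |].
      - by move=> z _; rewrite mule_ge0// lee_fin powR_ge0.
      - by apply: measurable_funeM; exact: mzb.
      - by apply: measurable_funTS; exact: mG.
      - by move=> z [Ez zd]; rewrite -EFinM lee_fin; exact: GP1.
    apply: ge0_subset_integral; [exact: mEP|exact: mE|by apply: measurable_funTS; exact: mG| |exact: subIsetl].
    by move=> z Ez; rewrite lee_fin; exact: GP0.
  have EG : (\int[mu2]_(z in E) (G z)%:E = (1 + 2 * delta)%:E * I +
      \int[mu2]_(z in E) (h2 z.2)%:E + \int[mu2]_(z in E) (h3 z.2)%:E)%E.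
    have ih1' : mu2.-integrable E (fun z => ((1 + 2 * delta)%:E * (B' z.2)%:E)%E).
      exact: integrableZl.
    rewrite /I -integralZl// -integralD// -integralD//.
    exact: integrableD.
  have K20 : (0 <= (2 * K)%:E)%E by rewrite lee_fin mulr_ge0// ltW.
  have Ih2 : (\int[mu2]_(z in E) (h2 z.2)%:E <= delta%:E)%E.
    apply: (le_trans (integral_height_le mE (fun z Ez => (EK z Ez).1) mh2 h20)).
    apply: le_trans Me3; rewrite -/S /h2.
    under eq_integral do rewrite EFinM.
    have mrdE : measurable_fun S (fun y => (rd y)%:E).
      by apply/measurable_EFinP; exact: measurable_funTS.
    rewrite ge0_integralZl; [|exact: mS|exact: mrdE|by move=> y _; rewrite lee_fin; have /andP[] := rd01 y|by rewrite lee_fin].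
    by rewrite muleA -EFinM [2 * K * M]mulrC.
  have Ih3 : (\int[mu2]_(z in E) (h3 z.2)%:E <= (4 * K * V)%:E)%E.
    apply: (le_trans (integral_height_le mE (fun z Ez => (EK z Ez).1) mh3 h30)).
    rewrite -/S /h3; under eq_integral do rewrite EFinM.
    have miE : measurable_fun S (fun y => (\1_W y)%:E : \bar R).
      by apply/measurable_EFinP; apply: measurable_funTS; exact: m1W.
    rewrite ge0_integralZl; [|exact: mS|exact: miE|by move=> y _; rewrite lee_fin indicE|by rewrite lee_fin].
    rewrite integral_indic//.
    have muW : (mu (W `&` S) <= (2 * delta)%:E)%E.
      apply: (@le_trans _ _ (mu W)).
        by apply: le_measure; rewrite ?inE//; exact: measurableI.
      rewrite lebesgue_measure_itv/= lte_fin ifT; last by clear -d0; lra.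
      by rewrite -EFinB lee_fin; clear -d0; lra.
    rewrite muleA -EFinM.
    apply: (@le_trans _ _ ((2 * K * (V / delta))%:E * (2 * delta)%:E)%E).
      by apply: lee_wpmul2l => //; rewrite lee_fin; apply: mulr_ge0 => //; rewrite mulr_ge0// ltW.
    rewrite -EFinM lee_fin (_ : 2 * K * (V / delta) * (2 * delta) = 4 * K * V)//.
    by field; rewrite gt_eqF.
  rewrite EG (EFinD delta) [leRHS]addeA; apply: leeD; [apply: leeD2l; exact: Ih2|exact: Ih3].
have arc : (\int[mu]_(y in `]p, q[ `&` `](3 * delta)%R, +oo[)
     (Num.sqrt ((y `^ alpha) ^+ 2 - (lam * y `^ (beta + 1) - c) ^+ 2))%:E <=
     (1 + 2 * delta)%:E * J0)%E.
  set T := `]p, q[ `&` _.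
  pose Ga y := Num.sqrt ((y `^ alpha) ^+ 2 - (lam * y `^ (beta + 1) - c) ^+ 2).
  have mT : measurable T by apply: measurableI; exact: measurable_itv.
  have mpow (a : R) : measurable_fun setT (fun y : R => y `^ a) by exact: measurable_powR.
  have mGa A : measurable_fun A (fun y => (Ga y)%:E).
    apply/measurable_EFinP; apply: measurable_funTS.
    have ms : measurable_fun setT (@Num.sqrt R).
      by apply: continuous_measurable_fun; exact: sqrt_continuous.
    apply: (measurableT_comp ms).
    apply: measurable_funB; apply: measurable_funX => //.
    by apply: measurable_funB => //; exact: measurable_funM.
  have Ga0 y : (0 <= (Ga y)%:E)%E by rewrite lee_fin sqrtr_ge0.
  (* By [N p = N q] the gaps between [p] and [q] are negligible, so the arc lies over [S] up to a
     null set. *)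
  pose Nq := Z `&` `]p, q]%classic.
  have mNq : measurable Nq by exact: measurableI.
  have Nq0 : mu Nq = 0%E.
    have fN : mu Nq \is a fin_num.
      rewrite ge0_fin_numE//; apply: le_lt_trans Zfin.
      by apply: le_measure; rewrite ?inE//; exact: subIsetl.
    have := cdf_ofB mZ Zfin pq; rewrite -/N Npq subrr -/Nq => h.
    by rewrite -(fineK fN) -h.
  rewrite (@ge0_negligible_integral _ (measurableTypeR R) R lebesgue_measure T Nq
    (fun y => (Ga y)%:E) mNq mT (mGa _) (fun y _ => Ga0 y) Nq0).
  have TS : T `\` Nq `<=` `]delta, K[%classic `&` S.
    move=> y [[]]; rewrite /= !in_itv/= andbT => /andP[y1 y2] y3 nN.
    have Sy : S y.
      apply: contrapT => nS; apply: nN; split; last by rewrite /= in_itv/= y1 ltW.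
      split => //; rewrite /= in_itv/=.
      by rewrite (le_lt_trans p0 y1)/= (le_trans (ltW y2)).
    split => //; have := SK _ Sy; rewrite /= !in_itv/= => /andP[_ ->].
    by rewrite andbT; clear -y3 d0; lra.
  have mTN : measurable (T `\` Nq) by exact: measurableD.
  pose wt y := y `^ alpha * Num.sqrt (1 - b y ^+ 2).
  have mwt A : measurable_fun A (fun y => (wt y)%:E).
    apply/measurable_EFinP; apply: measurable_funTS; apply: measurable_funM => //.
    have [a' ca] := C1_line_sqrt1B cb brho rho1.
    by apply: continuous_measurable_fun; exact: C1_line_cont ca.
  have wt0 y : (0 <= (wt y)%:E)%E by rewrite lee_fin mulr_ge0 ?powR_ge0 ?sqrtr_ge0.
  have dd1E : (0 <= (1 + 2 * delta)%:E)%E by rewrite lee_fin ltW.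
  apply: (@le_trans _ _ ((1 + 2 * delta)%:E * \int[mu]_(y in T `\` Nq) (wt y)%:E)%E); last first.
    apply: lee_wpmul2l => //; apply: ge0_subset_integral;
      [exact: mTN| |exact: mwt|by move=> y _; exact: wt0|exact: TS].
    by apply: measurableI => //; exact: measurable_itv.
  rewrite -ge0_integralZl; [|exact: mTN|exact: mwt|by move=> y _; exact: wt0|exact: dd1E].
  apply: ge0_le_integral; [exact: mTN|by move=> y _; exact: Ga0|exact: mGa|by apply: measurable_funeM; exact: mwt|].
  move=> y yT; have [/= ydK Sy] := TS _ yT.
  move: yT => -[[]]; rewrite /= !in_itv/= andbT => /andP[y1 y2] y3 _.
  move: ydK; rewrite in_itv/= => /andP[_ yK].
  have y0 : 0 < y by exact: le_lt_trans y1.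
  have Xy : X y = 1 by apply: X1; rewrite !ltW.
  rewrite -EFinM lee_fin /Ga /wt /b Xy mul1r /g /f powRN.
  apply: arc_density_le; [exact: powR_gt0|exact: ltW|].
  have Cp : `|C y - c| <= eta.
    have Ny : N y = N p.
      have /andP[h1 _] := lipN _ _ (ltW y1); have /andP[h3 _] := lipN _ _ (ltW y2).
      by move: h1 h3 Npq; clear; lra.
    have CNp z : N z = N p -> C z = C p.
      move=> Nz; have := Clip z p; rewrite Nz subrr normr0 mulr0 normr_le0 subr_eq0.
      by move/eqP.
    have pL : 0 <= p <= L by rewrite p0 (le_trans pq).
    have qL' : 0 <= q <= L by rewrite (le_trans p0).
    have := Cup _ pL; have := Clow _ qL'.
    rewrite (CNp q (esym Npq)) (CNp y Ny) -cE (tight (lt_trans y1 y2)) ler_norml.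
    by move: eta0; clear; lra.
  have yw : delta * w <= delta * y `^ alpha.
    rewrite ler_pM2l//; apply: ge0_ler_powR; rewrite ?nnegrE ?(ltW d0) ?(ltW y0)//.
    by move: y3 d0; clear; lra.
  have := CeC y; move: Cp yw Me1 eta0; rewrite !ler_norml /eta; clear; lra.
have J00 : (0 <= J0)%E.
  by apply: integral_ge0 => y _; rewrite lee_fin mulr_ge0 ?powR_ge0 ?sqrtr_ge0.
apply: (@le_trans _ _ ((1 + 2 * delta)%:E * (I + 2%:E * J0) + (delta + 4 * K * V)%:E)%E); last first.
  by apply: leeD2r; apply: lee_wpmul2l => //; rewrite lee_fin ltW.
rewrite (@muleDr _ (1 + 2 * delta)%:E I)//; last exact: fin_num_adde_defr.
rewrite [leRHS]addeAC; apply: leeD; first exact: area.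
by rewrite muleCA; apply: lee_wpmul2l.
Unshelve. all: by end_near. Qed.

End truncated_bound.

(** * Removal of the truncation *)

Section arc_bound.
Context {R : realType}.
Local Notation mu := (@lebesgue_measure R).
Local Notation mu2 := (lebesgue_measure2 R).

(** As [delta] tends to 0 the truncated pieces increase to [E] and to the whole arc. The error
    disappears because [y^(beta+1)] and [lower_barrier] both vanish at height 0. *)
Lemma arc_bound (alpha beta lam K L p q c : R) (E : set (R * R))
    (N := cdf_of (`]0, L]%classic `\` [set y | (0 < mu (ysection E y))%E])) :
  0 <= alpha -> alpha < beta + 1 -> beta <= 2 * alpha -> 0 < lam -> 0 < K ->
  K + 2 <= L -> measurable E ->
  (forall p, E p -> `|p.1| < K /\ 0 < p.2 < K) ->
  feasible alpha beta lam L N ->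
  0 <= p -> p <= q -> q <= L -> N p = N q ->
  c = lam * p `^ (beta + 1) + lower_barrier alpha beta p ->
  (p < q -> lam * q `^ (beta + 1) - q `^ alpha = c) ->
  ((lam * (beta + 1))%:E * weighted_area beta E +
   2%:E * \int[mu]_(y in `]p, q[)
     (Num.sqrt ((y `^ alpha) ^+ 2 - (lam * y `^ (beta + 1) - c) ^+ 2))%:E <=
   weighted_perimeter alpha E)%E.
Proof.
move=> a0 ab b2a lam0 K0 KL mE EK feas p0 pq qL Npq cE tight.
have b1 : 0 < beta + 1 by lra.
pose d n : R := Num.min 1 (K / 3) * harmonic n.
have m0 : 0 < Num.min 1 (K / 3) by rewrite lt_min ltr01/= divr_gt0.
have d0 n : 0 < d n by rewrite mulr_gt0// harmonic_gt0.
have h1 n : (harmonic n : R) <= 1 by rewrite /harmonic /= invf_le1 ?ler1n// ltr0n.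
have dm n : d n <= Num.min 1 (K / 3) by rewrite ler_piMr// ltW.
have d1 n : d n <= 1 by rewrite (le_trans (dm n))// ge_min lexx.
have dK n : 3 * d n <= K.
  have : d n <= K / 3 by rewrite (le_trans (dm n))// ge_min lexx orbT.
  lra.
have dcvg : d n @[n --> \oo] --> 0.
  by rewrite -(mulr0 (Num.min 1 (K / 3))); apply: cvgMr; exact: cvg_harmonic.
have dmono m n : (m <= n)%N -> d n <= d m.
  by move=> mn; rewrite ler_pM2l// lef_pV2 ?posrE ?ltr0n// ler_nat.
pose G y := Num.sqrt ((y `^ alpha) ^+ 2 - (lam * y `^ (beta + 1) - c) ^+ 2).
pose En n := E `&` [set z : R * R | (3 * d n < z.2)%R].
pose Tn n := `]p, q[%classic `&` `](3 * d n)%R, +oo[%classic.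
pose u n := ((lam * (beta + 1))%:E * \int[mu2]_(z in En n) (z.2 `^ beta)%:E +
   2%:E * \int[mu]_(y in Tn n) (G y)%:E)%E.
pose err n := d n + 4 * K * (lam * (3 * d n) `^ (beta + 1) + lower_barrier alpha beta (3 * d n) + d n).
have main n : (u n <= (1 + 2 * d n)%:E * weighted_perimeter alpha E + (err n)%:E)%E.
  exact: (@truncated_arc_bound R alpha beta lam K L p q (d n) c E a0 ab b2a lam0 K0 KL
    (d0 n) (d1 n) (dK n) mE EK feas p0 pq qL Npq cE tight).
have [->|Pfin] := eqVneq (weighted_perimeter alpha E) +oo%E; first by rewrite leey.
have lb10 : (0 <= (lam * (beta + 1))%:E)%E by rewrite lee_fin mulr_ge0 ?(ltW lam0) ?(ltW b1).
have G0 y : (0 <= (G y)%:E)%E by rewrite lee_fin sqrtr_ge0.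
have z0 (z : R * R) : (0 <= (z.2 `^ beta)%:E)%E by rewrite lee_fin powR_ge0.
have u0 n : (0 <= u n)%E.
  by apply: adde_ge0; apply: mule_ge0 => //; apply: integral_ge0.
have PN : weighted_perimeter alpha E != -oo%E.
  apply/eqP => PE; have := le_trans (u0 0%N) (main 0%N).
  by rewrite PE gt0_muleNy ?addNye ?leeNy_eq// lte_fin; have := d0 0%N; lra.
have Pf : weighted_perimeter alpha E \is a fin_num by rewrite fin_numE PN Pfin.
have mpow (a : R) : measurable_fun setT (fun y : R => y `^ a) by exact: measurable_powR.
have mGa A : measurable_fun A (fun y => (G y)%:E).
  apply/measurable_EFinP; apply: measurable_funTS.
  have ms : measurable_fun setT (@Num.sqrt R).
    by apply: continuous_measurable_fun; exact: sqrt_continuous.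
  apply: (measurableT_comp ms).
  apply: measurable_funB; apply: measurable_funX => //.
  by apply: measurable_funB => //; exact: measurable_funM.
have mzb A : measurable_fun A (fun z : R * R => (z.2 `^ beta)%:E).
  apply/measurable_EFinP; apply: measurable_funTS.
  by apply: (measurable_fun_snd1 (f := fun y => y `^ beta)); exact: measurable_powR.
have mEn n : measurable (En n).
  apply: measurableI => //.
  have -> : [set z : R * R | (3 * d n < z.2)%R] = setT `*` `](3 * d n), +oo[%classic.
    by apply/seteqP; split=> z /=; rewrite in_itv/= andbT => // -[].
  exact: measurableX.
have mTn n : measurable (Tn n) by apply: measurableI; exact: measurable_itv.
have small y : 0 < y -> exists n, 3 * d n < y.
  move=> y0; have y3 : 0 < y / 3 by lra.
  have /cvgr_lt/(_ _ y3)[n _ /(_ n (leqnn n)) h] := dcvg.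
  by exists n; have : d n < y / 3 := h; lra.
have ndE : nondecreasing_seq En.
  move=> m n mn; apply/subsetPset => z [Ez /= hz]; split => //=.
  by move: hz; have := dmono _ _ mn; clear; lra.
have ndT : nondecreasing_seq Tn.
  move=> m n mn; apply/subsetPset => z [Ez /= hz]; split => //=; move: hz.
  by rewrite !in_itv/= !andbT; have := dmono _ _ mn; clear; lra.
have UE : \bigcup_n En n = E.
  apply/seteqP; split=> z; first by move=> [n _ []].
  move=> Ez; have [_ /andP[zz _]] := EK _ Ez; have [n hn] := small _ zz.
  by exists n.
have UT : \bigcup_n Tn n = `]p, q[%classic.
  apply/seteqP; split=> y; first by move=> [n _ []].
  move=> yT; have y0 : 0 < y by move: yT; rewrite /= in_itv/= => /andP[h _]; lra.
  have [n hn] := small _ y0; exists n => //; split => //.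
  by rewrite /= in_itv/= hn.
have cE' : (\int[mu2]_(z in En n) (z.2 `^ beta)%:E)%E @[n --> \oo] --> weighted_area beta E.
  rewrite /weighted_area -[X in integral _ X _]UE.
  apply: ge0_nondecreasing_set_cvg_integral;
    [exact: ndE|exact: mEn|by move=> n; exact: mzb|by move=> n z _; exact: z0].
have cT : (\int[mu]_(y in Tn n) (G y)%:E)%E @[n --> \oo] --> (\int[mu]_(y in `]p, q[) (G y)%:E)%E.
  rewrite -[X in integral _ X _]UT.
  apply: ge0_nondecreasing_set_cvg_integral;
    [exact: ndT|exact: mTn|by move=> n; exact: mGa|by move=> n z _; exact: G0].
have cu : u n @[n --> \oo] --> ((lam * (beta + 1))%:E * weighted_area beta E +
   2%:E * \int[mu]_(y in `]p, q[) (G y)%:E)%E.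
  apply: cvgeD.
  - apply: ge0_adde_def; rewrite inE; apply: mule_ge0 => //; apply: integral_ge0 => z _ //.
  - exact: cvgeZl.
  - exact: cvgeZl.
have d3 : 3 * d n @[n --> \oo] --> 0 by rewrite -(mulr0 3); exact: cvgMr.
have cmax (h : R -> R) : continuous (fun y : R => h (Num.max y 0)) -> h (3 * d n) @[n --> \oo] --> h 0.
  move=> ch.
  have H : (fun n => h (Num.max (3 * d n) 0)) @ \oo --> h 0.
    by have := continuous_cvg _ (ch 0) d3; rewrite maxxx; exact.
  have <- // : (fun n => h (Num.max (3 * d n) 0)) = (fun n => h (3 * d n)).
  by apply/funext => n; rewrite max_l// mulr_ge0// ltW.
have cerr : err n @[n --> \oo] --> 0.
  have c1 := cmax (fun y => y `^ (beta + 1)) (continuous_powR_max0 (ltW b1)).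
  have c2 := cmax _ (@continuous_lower_barrier_max0 R alpha beta a0).
  rewrite powR0 ?gt_eqF// in c1; rewrite lower_barrier0// in c2.
  have -> : 0 = 0 + 4 * K * (lam * 0 + 0 + 0) :> R by ring.
  apply: cvgD => //; apply: cvgMr; apply: cvgD => //; apply: cvgD => //.
  exact: cvgMr.
have cv : ((1 + 2 * d n)%:E * weighted_perimeter alpha E + (err n)%:E)%E @[n --> \oo] -->
    weighted_perimeter alpha E.
  rewrite -(fineK Pf); move: (fine _) => P.
  have h : (1 + 2 * d n) * P + err n @[n --> \oo] --> P.
    rewrite -[X in _ --> X]addr0 -[X in _ --> X + _]mul1r; apply: cvgD => //; apply: cvgMl.
    rewrite -[X in _ --> X]addr0; apply: cvgD; first exact: cvg_cst.
    by rewrite -(mulr0 2); exact: cvgMr.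
  exact: cvg_EFin (nearW _ _) h.
exact: (lee_cvg_to cu cv (nearW _ main)).
Unshelve. all: by end_near. Qed.

End arc_bound.

(** * Layer-cake formula and power integrals *)

Section layers.
Context {R : realType}.
Local Notation mu := (@lebesgue_measure R).
Local Notation mu2 := (lebesgue_measure2 R).

(** Immediate from the supremum over simple functions, so that no measurability has to be checked
    for inner integrals. *)
Lemma ge0_le_integral_nonmeas d (T : measurableType d) (m : {measure set T -> \bar R})
    (A : set T) (f g : T -> \bar R) :
  (forall x, A x -> (0 <= f x)%E) -> (forall x, A x -> (f x <= g x)%E) ->
  (\int[m]_(x in A) f x <= \int[m]_(x in A) g x)%E.
Proof.
move=> f0 fg; rewrite !ge0_integralE//; last by move=> x Ax; apply: le_trans (fg _ Ax); exact: f0.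
apply: le_ereal_sup => _ [h hf <-]; exists h => //= x.
apply: (le_trans (hf x)); rewrite /patch; case: ifPn => // xA.
by apply: fg; rewrite inE in xA.
Qed.

Lemma cvg_powR_at (a v : R) : 0 <= a -> 0 <= v -> y `^ a @[y --> v^'+] --> v `^ a.
Proof.
move=> a0 v0; have c : (fun y : R => (Num.max y 0) `^ a) @ v^'+ --> v `^ a.
  have := cvg_at_right_filter (continuous_powR_max0 a0 (x := v)).
  by rewrite max_l; exact.
apply: cvg_trans c; apply: near_eq_cvg; near=> y.
rewrite max_l//; apply: (le_trans v0); apply: ltW.
by near: y; exact: nbhs_right_gt.
Unshelve. all: by end_near. Qed.

(** The exponent may be negative, with an integrand unbounded at 0; hence the improper form of the
    fundamental theorem. *)
Lemma integral_powR (a u v : R) : 0 < a + 1 -> 0 <= u -> u <= v ->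
  (\int[mu]_(y in `]u, v[) (y `^ a)%:E = ((v `^ (a + 1) - u `^ (a + 1)) / (a + 1))%:E)%E.
Proof.
move=> a1 u0; rewrite le_eqVlt => /predU1P[->|uv].
  by rewrite subrr mul0r set_itv_ge ?integral_set0// bnd_simp ltxx.
have v0 : 0 < v by exact: le_lt_trans uv.
pose F (y : R) := y `^ (a + 1) / (a + 1).
have -> : (v `^ (a + 1) - u `^ (a + 1)) / (a + 1) = F v - F u by rewrite mulrBl.
apply: ge0_FTC2_oo => //.
- move=> y /andP[uy _]; have y0 : 0 < y by exact: le_lt_trans uy.
  have h := is_derive1_powR (a + 1) y0.
  rewrite (_ : a + 1 - 1 = a) in h; last by ring.
  by apply: is_derive_eq; rewrite /GRing.scale/=; field; rewrite gt_eqF.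
- move=> y /andP[uy _]; apply: derive_continuous (is_derive1_powR a _).
  exact: le_lt_trans uy.
- by move=> y _; exact: powR_ge0.
- by apply: cvgMl; apply: cvg_powR_at => //; exact: ltW.
- apply: cvgMl; apply: cvg_at_left_filter.
  exact: derive_continuous (is_derive1_powR (a + 1) v0).
Qed.

Lemma fubini_tonelli1_set (E : set (R * R)) (f : R * R -> R) : measurable E ->
  measurable_fun setT f -> (forall p, 0 <= f p) ->
  (\int[mu2]_(p in E) (f p)%:E =
   \int[mu]_x \int[mu]_(y in xsection E x) (f (x, y))%:E)%E.
Proof.
move=> mE mf f0; rewrite integral_mkcond.
rewrite fubini_tonelli1.
- rewrite /fubini_F; apply: eq_integral => x _; rewrite [RHS]integral_mkcond.
  by apply: eq_integral => y _; rewrite /patch mem_xsection.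
- by apply/(measurable_restrictT _ mE)/measurable_EFinP/measurable_funTS.
- by move=> p; apply: erestrict_ge0 => q _; rewrite lee_fin.
Qed.

(** Both sides integrate [h] over the planar set of pairs [(y, r)] with [y] in [D] and
    [0 < r < sqrt (1 - b(y)^2)], sliced in the two directions. *)
Lemma layer_cake (D : set R) (h b : R -> R) : measurable D ->
  measurable_fun setT h -> (forall y, 0 <= h y) -> measurable_fun setT b ->
  (\int[mu]_(y in D) (h y * Num.sqrt (1 - b y ^+ 2))%:E =
   \int[mu]_(r in `]0%R, 1%R[) \int[mu]_(y in D `&` [set y | (b y ^+ 2 < 1 - r ^+ 2)%R]) (h y)%:E)%E.
Proof.
move=> mD mh h0 mb.
pose Q := [set p : R * R | D p.1 /\ 0 < p.2 < 1 /\ b p.1 ^+ 2 < 1 - p.2 ^+ 2].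
have mQ : measurable Q.
  have -> : Q = (D `*` `]0, 1[%classic) `&`
      ((fun p : R * R => 1 - p.2 ^+ 2 - b p.1 ^+ 2) @^-1` `]0, +oo[%classic).
    apply/seteqP; split=> p /=; rewrite !in_itv/= andbT subr_gt0.
      by move=> [? [? ?]].
    by move=> [[? ?] ?].
  apply: measurableI; first by apply: measurableX.
  rewrite -[X in measurable X]setTI.
  have mg : measurable_fun setT (fun p : R * R => 1 - p.2 ^+ 2 - b p.1 ^+ 2).
    apply: measurable_funB.
      apply: measurable_funB => //.
      by apply: (measurable_fun_snd1 (f := fun r => r ^+ 2)); exact: measurable_funX.
    by apply: (measurable_fun_fst1 (f := fun y => b y ^+ 2)); exact: measurable_funX.
  by apply: mg => //; exact: measurable_itv.
have mhQ : measurable_fun setT (fun p : R * R => h p.1) by exact: measurable_fun_fst1.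
transitivity (\int[mu2]_(p in Q) (h p.1)%:E)%E.
  rewrite (@fubini_tonelli1_set Q (fun p => h p.1))//= integral_mkcond.
  apply: eq_integral => y _; rewrite /patch.
  rewrite integral_cst; last exact: measurable_xsection.
  case: ifPn => yD; last first.
    rewrite (_ : xsection Q y = set0) ?measure0 ?mule0// -subset0 => r.
    by rewrite /xsection/= inE => -[/= Dy _]; move: yD; rewrite notin_setE.
  rewrite inE in yD; rewrite EFinM; congr (_ * _)%E.
  have -> : xsection Q y = `]0, Num.sqrt (1 - b y ^+ 2)[%classic.
    apply/seteqP; split=> r; rewrite /xsection/= inE/Q/= in_itv/=.
      move=> [_ [/andP[r0 r1] br]]; rewrite r0/=.
      have r2 := sqr_ge0 r; rewrite -(ger0_norm (ltW r0)) -sqrtr_sqr ltr_sqrt; lra.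
    move=> /andP[r0 rs]; split => //.
    have pos : 0 < 1 - b y ^+ 2 by rewrite -sqrtr_gt0; exact: lt_trans rs.
    have r2 : r ^+ 2 < 1 - b y ^+ 2.
      move: rs; rewrite -{1}(ger0_norm (ltW r0)) -sqrtr_sqr ltr_sqrt//.
    have b2 := sqr_ge0 (b y); split; last by lra.
    by rewrite r0/= -(@expr_lt1 _ 2)// ?(ltW r0)//; lra.
  have := lebesgue_measure_itv (R := R) `]0, Num.sqrt (1 - b y ^+ 2)[.
  rewrite /= lte_fin => ->; case: ifPn => [_|]; first by rewrite sube0.
  by rewrite -leNgt => s0; congr (_%:E); apply/eqP; rewrite eq_le s0 sqrtr_ge0.
rewrite (fubini_tonelli2_set mQ mhQ (fun p => h0 p.1)).
rewrite [RHS]integral_mkcond.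
apply: eq_integral => r _; rewrite /patch; case: ifPn => rI.
  rewrite inE/= in_itv/= in rI.
  suff -> : ysection Q r = D `&` [set y | b y ^+ 2 < 1 - r ^+ 2] by [].
  apply/seteqP; split=> y; rewrite /ysection/= inE/Q/=.
    by move=> [Dy [_ h1]].
  by move=> [Dy h1].
rewrite (_ : ysection Q r = set0) ?integral_set0// -subset0 => y.
rewrite /ysection/= inE/Q/= => -[_ [r01 _]].
by move: rI; rewrite notin_setE/= in_itv/=.
Qed.

End layers.

(** * Comparison of the arcs *)

Section isoperimetric.
Context {R : realType}.
Local Notation mu := (@lebesgue_measure R).

(** The integral of [y^alpha sqrt (1 - y^(2k))] over []0, 1[], with [k = beta - alpha + 1], in
    layer-cake form: the layer at [r] is []0, s^(1/k)[] with [s = sqrt (1 - r^2)]. *)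
Definition kappa (alpha beta : R) : \bar R :=
  (\int[mu]_(r in `]0%R, 1%R[)
     (Num.sqrt (1 - r ^+ 2) `^ ((alpha + 1) / (beta - alpha + 1)) / (alpha + 1))%:E)%E.

Lemma IVT_le (f : R -> R) (a b v : R) : a <= b -> continuous f -> f a <= v <= f b ->
  exists2 c, a <= c <= b & f c = v.
Proof.
move=> ab cf /andP[av vb].
have [||c cab fc] := @IVT R f a b v ab; last by exists c => //; move: cab; rewrite in_itv.
  by apply: continuous_subspaceT.
by rewrite ge_min av le_max vb orbT.
Qed.

(** The lower bound comes from the equation at [u] by monotonicity. For the upper one, [lam
    y^(beta+1) - s y^alpha = y^alpha (lam y^k - s)] with [k = beta - alpha + 1], and the second
    factor is increasing and nonnegative at [v] because [c >= 0]. *)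
Lemma layer_contains (alpha beta lam c s u v y : R) :
  0 <= alpha -> alpha < beta + 1 -> 0 < lam -> 0 < s -> 0 <= c ->
  lam * u `^ (beta + 1) + s * lower_barrier alpha beta u = c ->
  lam * v `^ (beta + 1) - s * v `^ alpha = c ->
  0 <= u -> u < y < v ->
  `|lam * y `^ (beta + 1) - c| < s * y `^ alpha.
Proof.
move=> a0 ab lam0 s0 c0 uc vc u0 /andP[uy yv].
have y0 : 0 < y by exact: le_lt_trans uy.
have v0 : 0 < v by exact: lt_trans yv.
have b1 : 0 < beta + 1 by exact: le_lt_trans ab.
have k0 : 0 < beta - alpha + 1 by lra.
have E z : 0 < z -> z `^ (beta + 1) = z `^ alpha * z `^ (beta - alpha + 1).
  by move=> z0; rewrite -powR_add_gt0//; congr (_ `^ _); ring.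
have wu : s * lower_barrier alpha beta u <= s * y `^ alpha.
  rewrite ler_pM2l//; apply: (le_trans (lower_barrier_le _ _ _)).
  by apply: ge0_ler_powR; rewrite // ?nnegrE// ltW.
have uy1 : lam * u `^ (beta + 1) < lam * y `^ (beta + 1).
  by rewrite ltr_pM2l//; apply: gt0_ltr_powR; rewrite // ?nnegrE// ltW.
have ya0 : 0 < y `^ alpha by exact: powR_gt0.
have yva : y `^ alpha <= v `^ alpha by apply: ge0_ler_powR; rewrite // ?nnegrE ltW.
have yvk : lam * y `^ (beta - alpha + 1) < lam * v `^ (beta - alpha + 1).
  by rewrite ltr_pM2l//; apply: gt0_ltr_powR; rewrite // ?nnegrE ltW.
rewrite ltr_norml; apply/andP; split.
  by move: wu uy1 uc; clear; lra.
rewrite E// in vc; rewrite E//.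
have cE : c = v `^ alpha * (lam * v `^ (beta - alpha + 1) - s) by rewrite -vc; ring.
have va0 : 0 < v `^ alpha by exact: powR_gt0.
have X0 : 0 <= lam * v `^ (beta - alpha + 1) - s by rewrite -(pmulr_rge0 _ va0) -cE.
have h1 : y `^ alpha * (lam * y `^ (beta - alpha + 1) - s) <
    y `^ alpha * (lam * v `^ (beta - alpha + 1) - s) by rewrite ltr_pM2l// ltrD2r.
have h2 := ler_wpM2r X0 yva.
by rewrite -cE in h2; move: h1 h2; clear; lra.
Qed.

(** Multiplying both barriers by [s < 1] moves the end points of the arc inwards; the intermediate
    value theorem finds the new ones between [p] and [q]. *)
Lemma layer_roots (alpha beta t p q c s : R) (lam := t `^ (- (beta - alpha + 1))) :
  0 <= alpha -> alpha < beta + 1 -> beta <= 2 * alpha -> 0 < t ->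
  0 <= p -> p < q -> c = lam * p `^ (beta + 1) + lower_barrier alpha beta p ->
  lam * q `^ (beta + 1) - q `^ alpha = c -> 0 < s < 1 ->
  exists u v, [/\ p <= u, 0 < v, v <= q,
    lam * u `^ (beta + 1) + s * lower_barrier alpha beta u = c &
    lam * v `^ (beta + 1) - s * v `^ alpha = c].
Proof.
move=> a0 ab b2a t0 p0 pq cE tight /andP[s0 s1].
have b1 : 0 < beta + 1 by exact: le_lt_trans ab.
have k0 : 0 < beta - alpha + 1 by lra.
have q0 : 0 < q by exact: le_lt_trans pq.
have lam0 : 0 < lam by exact: powR_gt0.
have m0E y : 0 <= y -> Num.max y 0 = y by move=> y0; rewrite max_l.
have op := lower_barrier_ge0 alpha beta p.
have qa0 : 0 < q `^ alpha by exact: powR_gt0.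
have opa := lower_barrier_le alpha beta p.
have [|||u /andP[pu uq]] := @IVT_le (fun y => lam * (Num.max y 0) `^ (beta + 1) +
    s * lower_barrier alpha beta (Num.max y 0)) p q c.
- exact: ltW.
- move=> y; apply: cvgD; apply: cvgMr; first exact: (continuous_powR_max0 (ltW b1)).
  exact: continuous_lower_barrier_max0.
- rewrite !m0E ?(ltW q0)//; apply/andP; split.
    have : s * lower_barrier alpha beta p <= lower_barrier alpha beta p by rewrite ler_piMl// ltW.
    by rewrite cE; lra.
  have : 0 <= s * lower_barrier alpha beta q by apply: mulr_ge0; [exact: ltW|exact: lower_barrier_ge0].
  by move: tight qa0; clear; lra.
rewrite m0E ?(le_trans p0)// => ru.
suff [v [v0 vq rv]] : exists v, [/\ 0 < v, v <= q & lam * v `^ (beta + 1) - s * v `^ alpha = c].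
  by exists u, v.
(* At level 0 the value [v = 0] may be a spurious root, so the equation is divided by [v^alpha] and
   solved as [lam v^k = s]. At a positive level [v = 0] is excluded by the equation. *)
have [c0|cn0] := eqVneq c 0.
  have [|||v /andP[v0 vq]] := @IVT_le (fun y => lam * (Num.max y 0) `^ (beta - alpha + 1)) 0 q s.
  - exact: ltW.
  - by move=> y; apply: cvgMr; exact: (continuous_powR_max0 (ltW k0)).
  - rewrite !m0E ?(ltW q0)// powR0 ?gt_eqF// mulr0 (ltW s0)/=.
    suff -> : lam * q `^ (beta - alpha + 1) = 1 by exact: ltW.
    have E : q `^ (beta + 1) = q `^ alpha * q `^ (beta - alpha + 1).
      by rewrite -powR_add_gt0//; congr (_ `^ _); ring.
    apply: (mulfI (lt0r_neq0 qa0)); move: tight; rewrite c0 E; clear; lra.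
  rewrite m0E// => rv.
  have vn0 : 0 < v.
    rewrite lt_neqAle v0 andbT; apply/eqP => v00.
    by move: rv s0; rewrite -v00 powR0 ?gt_eqF// mulr0 => ->; rewrite ltxx.
  exists v; split => //; rewrite c0 -rv.
  have -> : v `^ (beta + 1) = v `^ alpha * v `^ (beta - alpha + 1).
    by rewrite -powR_add_gt0//; congr (_ `^ _); ring.
  by ring.
have [|||v /andP[pv vq]] := @IVT_le (fun y => lam * (Num.max y 0) `^ (beta + 1) -
    s * (Num.max y 0) `^ alpha) p q c.
- exact: ltW.
- by move=> y; apply: cvgB; apply: cvgMr; [exact: (continuous_powR_max0 (ltW b1))|exact: (continuous_powR_max0 a0)].
- rewrite !m0E ?(ltW q0)//; apply/andP; split.
    have : 0 <= s * p `^ alpha by apply: mulr_ge0; [exact: ltW|exact: powR_ge0].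
    by rewrite cE; lra.
  have : s * q `^ alpha <= q `^ alpha by rewrite ler_piMl ?(ltW s1)// ltW.
  by move: tight; clear; lra.
have v0' := le_trans p0 pv.
rewrite m0E// => rv.
exists v; split => //; rewrite lt_neqAle v0' andbT; apply/eqP => v00.
move/eqP: cn0; apply; apply/eqP; rewrite eq_le; apply/andP; split.
  rewrite -rv -v00 powR0 ?gt_eqF// mulr0 sub0r oppr_le0 mulr_ge0 ?powR_ge0//; exact: ltW.
by rewrite cE addr_ge0// mulr_ge0 ?powR_ge0// ltW.
Qed.

(** The layer contains the interval between the two roots, and [layer_inequality] compares its
    weighted length with that of []0, t s^(1/k)[], the layer of the arc that starts on the boundary
    line. *)
Lemma layer_integral_ge (alpha beta t p q c s : R) (lam := t `^ (- (beta - alpha + 1))) :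
  0 <= alpha -> alpha < beta + 1 -> beta <= 2 * alpha -> 0 < t ->
  0 <= p -> p < q -> c = lam * p `^ (beta + 1) + lower_barrier alpha beta p ->
  lam * q `^ (beta + 1) - q `^ alpha = c -> 0 < s < 1 ->
  (((t * s `^ (beta - alpha + 1)^-1) `^ (alpha + 1) / (alpha + 1))%:E <=
   \int[mu]_(y in `]p, q[ `&` [set y | (((lam * y `^ (beta + 1) - c) / y `^ alpha) ^+ 2 < s ^+ 2)%R])
     (y `^ alpha)%:E)%E.
Proof.
move=> a0 ab b2a t0 p0 pq cE tight s01.
have [u [v [pu v0 vq ru rv]]] := layer_roots a0 ab b2a t0 p0 pq cE tight s01.
rewrite -/lam in ru rv.
have /andP[s0 s1] := s01.
have lam0 : 0 < lam by exact: powR_gt0.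
have b1 : 0 < beta + 1 by exact: le_lt_trans ab.
have u0 : 0 <= u by exact: le_trans pu.
have c0 : 0 <= c.
  by rewrite cE addr_ge0 ?lower_barrier_ge0// mulr_ge0 ?powR_ge0// ltW.
have E : s * (v `^ alpha + lower_barrier alpha beta u) = lam * (v `^ (beta + 1) - u `^ (beta + 1)).
  by move: ru rv; clear; lra.
have uv : u <= v.
  rewrite leNgt; apply/negP => vu.
  have h1 : v `^ (beta + 1) < u `^ (beta + 1).
    by apply: gt0_ltr_powR; rewrite // ?nnegrE// ltW.
  have h2 : 0 < s * (v `^ alpha + lower_barrier alpha beta u).
    by rewrite mulr_gt0// ltr_wpDr ?lower_barrier_ge0// powR_gt0.
  by move: h2; rewrite E pmulr_rgt0// subr_gt0 ltNge (ltW h1).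
have a1 : 0 < alpha + 1 by lra.
have main := @layer_inequality R alpha beta t s u v a0 ab b2a t0 s0 v0.
rewrite u0 uv E in main; have {}main := main isT erefl.
apply: (@le_trans _ _ (\int[mu]_(y in `]u, v[) (y `^ alpha)%:E)%E).
  by rewrite integral_powR// lee_fin ler_pM2r ?invr_gt0.
apply: ge0_subset_integral_nonmeas; first by move=> y _; rewrite lee_fin powR_ge0.
move=> y; rewrite /= in_itv/= => /andP[uy yv].
have y0 : 0 < y by exact: le_lt_trans uy.
split; first by rewrite /= in_itv/= (le_lt_trans pu uy) (lt_le_trans yv vq).
have uyv : u < y < v by rewrite uy yv.
have h := @layer_contains alpha beta lam c s u v y a0 ab lam0 s0 c0 ru rv u0 uyv.
have ya0 : 0 < y `^ alpha by exact: powR_gt0.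
rewrite /= -[X in X < _]real_normK ?num_real// ltr_pXn2r ?nnegrE ?(ltW s0)//.
by rewrite normrM normfV (gtr0_norm ya0) ltr_pdivrMr.
Qed.

(** Both sides are integrals over layers, and the inequality holds layer by layer with
    [s = sqrt (1 - r^2)]. *)
Lemma arc_integral_ge (alpha beta t p q c : R) (lam := t `^ (- (beta - alpha + 1))) :
  0 <= alpha -> alpha < beta + 1 -> beta <= 2 * alpha -> 0 < t ->
  0 <= p -> p < q -> c = lam * p `^ (beta + 1) + lower_barrier alpha beta p ->
  lam * q `^ (beta + 1) - q `^ alpha = c ->
  ((t `^ (alpha + 1))%:E * kappa alpha beta <=
   \int[mu]_(y in `]p, q[)
     (Num.sqrt ((y `^ alpha) ^+ 2 - (lam * y `^ (beta + 1) - c) ^+ 2))%:E)%E.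
Proof.
move=> a0 ab b2a t0 p0 pq cE tight.
pose b (y : R) := (lam * y `^ (beta + 1) - c) / y `^ alpha.
have mpow (a : R) : measurable_fun setT (fun y : R => y `^ a) by exact: measurable_powR.
have mb : measurable_fun setT b.
  apply: measurable_funM; first by apply: measurable_funB => //; exact: measurable_funM.
  have -> : (fun y : R => (y `^ alpha)^-1) = (fun y : R => y `^ (- alpha)).
    by apply/funext => y; rewrite powRN.
  exact: mpow.
have b1 : 0 < beta + 1 by exact: le_lt_trans ab.
have k0 : 0 < beta - alpha + 1 by lra.
have a1 : 0 < alpha + 1 by lra.
have -> : (\int[mu]_(y in `]p, q[)
     (Num.sqrt ((y `^ alpha) ^+ 2 - (lam * y `^ (beta + 1) - c) ^+ 2))%:E)%E =
  (\int[mu]_(y in `]p, q[) (y `^ alpha * Num.sqrt (1 - b y ^+ 2))%:E)%E.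
  apply: eq_integral => y; rewrite inE/= in_itv/= => /andP[py _]; congr (_%:E).
  have ya0 : 0 < y `^ alpha by apply: powR_gt0; exact: le_lt_trans py.
  rewrite -{2}(ger0_norm (ltW ya0)) -(sqrtr_sqr (y `^ alpha)) -sqrtrM ?sqr_ge0//.
  by congr Num.sqrt; rewrite /b; field; rewrite gt_eqF.
rewrite (@layer_cake R _ (fun y => y `^ alpha) b)//; last by move=> y; exact: powR_ge0.
rewrite /kappa -ge0_integralZl_EFin ?powR_ge0//; first last.
- apply/measurable_EFinP; apply: measurable_funTS; apply: measurable_funM => //.
  apply: (measurableT_comp (mpow _)).
  have ms : measurable_fun setT (@Num.sqrt R).
    by apply: continuous_measurable_fun; exact: sqrt_continuous.
  apply: (measurableT_comp ms); apply: measurable_funB => //.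
- by move=> r _; rewrite lee_fin divr_ge0 ?powR_ge0// ltW.
apply: ge0_le_integral_nonmeas.
  by move=> r _; rewrite -EFinM lee_fin mulr_ge0 ?divr_ge0 ?powR_ge0// ltW.
move=> r; rewrite /= in_itv/= => /andP[r0 r1].
have r2 : 0 < r ^+ 2 < 1 by rewrite exprn_gt0//= expr_lt1// ltW.
have s2 : 0 <= 1 - r ^+ 2 by lra.
have s01 : 0 < Num.sqrt (1 - r ^+ 2) < 1.
  rewrite sqrtr_gt0 -[X in _ && (_ < X)]sqrtr1 ltr_sqrt//; lra.
have /andP[s0 _] := s01.
have := layer_integral_ge a0 ab b2a t0 p0 pq cE tight s01.
rewrite sqr_sqrtr//; apply: le_trans.
rewrite -EFinM lee_fin powRM ?powR_ge0 ?(ltW t0)// -powRrM mulrA.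
by rewrite (mulrC (alpha + 1)).
Qed.

End isoperimetric.

(** * The optimal arc and the isoperimetric inequality *)

Section isoperimetric.
Context {R : realType}.
Local Notation mu := (@lebesgue_measure R).

(** A pair with positive quotient [rr w y] admits exactly the multipliers [lam <= 1 / rr w y]. The
    inverse of the maximum of [rr] over the pairs with equal [N] is therefore feasible, and a
    maximising pair is tight. *)
Lemma optimal_arc (alpha beta L : R) (N : R -> R) (k := beta - alpha + 1) :
  0 <= alpha -> alpha < beta + 1 -> continuous N ->
  (exists p q, [/\ 0 <= p, p < q, q <= L & N p = N q]) ->
  exists t p q, [/\ 0 < t, feasible alpha beta (t `^ (- k)) L N,
    0 <= p < q, q <= L & N p = N q /\
    t `^ (- k) * q `^ (beta + 1) - q `^ alpha =
    t `^ (- k) * p `^ (beta + 1) + lower_barrier alpha beta p].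
Proof.
move=> a0 ab cN [p1 [q1 [p10 pq1 q1L Npq1]]].
have b1 : 0 < beta + 1 by exact: le_lt_trans ab.
have k0 : 0 < k by rewrite /k; lra.
have E z : 0 < z -> z `^ (beta + 1) = z `^ alpha * z `^ k.
  by move=> z0; rewrite -powR_add_gt0//; congr (_ `^ _); rewrite /k; ring.
have lb0 := @lower_barrier_ge0 R alpha beta.
pose rr (w y : R) := (y `^ (beta + 1) - w `^ (beta + 1)) / (lower_barrier alpha beta w + y `^ alpha).
have den0 w y : 0 < y -> 0 < lower_barrier alpha beta w + y `^ alpha.
  by move=> y0; rewrite ltr_wpDl// powR_gt0.
have rrk w y : 0 < y -> rr w y <= y `^ k.
  move=> y0; rewrite /rr ler_pdivrMr ?den0// E//.
  have h1 := powR_ge0 w (beta + 1).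
  have h2 : 0 <= y `^ k * lower_barrier alpha beta w by rewrite mulr_ge0 ?powR_ge0.
  by rewrite mulrDr; move: h1 h2; clear; lra.
have q10 : 0 < q1 by exact: le_lt_trans pq1.
pose r1 := rr p1 q1.
have r10 : 0 < r1.
  rewrite /r1 /rr divr_gt0 ?den0// subr_gt0.
  by apply: gt0_ltr_powR; rewrite // nnegrE// ltW.
(* A pair with [y < qm] has [rr w y <= y^k < r1] and cannot be a maximum. This keeps the denominator
   away from 0 and makes the maximisation compact. *)
pose qm := r1 `^ k^-1.
have qm0 : 0 < qm by exact: powR_gt0.
have qmk : qm `^ k = r1 by rewrite /qm -powRrM mulVf ?gt_eqF// powRr1// ltW.
have qmq1 : qm <= q1.
  rewrite leNgt; apply/negP => h.
  have : q1 `^ k < qm `^ k by apply: gt0_ltr_powR; rewrite // ?nnegrE ltW.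
  by rewrite qmk ltNge rrk.
pose A : set (R * R) := (`[0, L]%classic `*` `[0, L]%classic) `&`
  (((fun z => z.2 - z.1) @^-1` `[0, +oo[%classic) `&`
   (((fun z => z.2) @^-1` `[qm, +oo[%classic) `&`
    ((fun z => N z.1 - N z.2) @^-1` `[0, 0]%classic))).
have AE w y : A (w, y) <-> [/\ 0 <= w, w <= y, qm <= y, y <= L & N w = N y].
  rewrite /A/=; split.
    rewrite !in_itv/= !andbT -eq_le eq_sym subr_eq0 subr_ge0.
    by move=> [[/andP[w0 _] /andP[_ yL]] [wy [qy /eqP Nwy]]].
  move=> [w0 wy qy yL Nwy]; rewrite !in_itv/= !andbT subr_ge0 wy qy yL w0 Nwy subrr lexx.
  by rewrite (le_trans wy yL) (le_trans w0 wy).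
have cfst (f : R -> R) : continuous f -> continuous (fun z : R * R => f z.1).
  by move=> cf; exact: continuous_fst1.
have csnd (f : R -> R) : continuous f -> continuous (fun z : R * R => f z.2).
  by move=> cf; exact: continuous_snd1.
have cid : continuous (fun y : R => y) by move=> y; exact: cvg_id.
have cA : compact A.
  apply: (@subclosed_compact _ A (`[0, L]%classic `*` `[0, L]%classic)).
  - apply: closedI; first by apply: compact_closed; [exact: norm_hausdorff|apply: compact_setX; exact: segment_compact].
    apply: closedI; [|apply: closedI].
    + apply: closed_comp => [z _|]; last exact: interval_closed.
      by apply: cvgB; [exact: (csnd _ cid)|exact: (cfst _ cid)].
    + by apply: closed_comp => [z _|]; [exact: (csnd _ cid)|exact: interval_closed].
    + apply: closed_comp => [z _|]; last exact: interval_closed.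
      by apply: cvgB; [exact: (cfst _ cN)|exact: (csnd _ cN)].
  - by apply: compact_setX; exact: segment_compact.
  - by move=> p [].
(* A continuous extension of [rr] to the whole plane; none of the truncations is active on [A]. *)
pose g (z : R * R) := ((Num.max z.2 0) `^ (beta + 1) - (Num.max z.1 0) `^ (beta + 1)) /
  (lower_barrier alpha beta (Num.max z.1 0) + (Num.max (Num.max z.2 qm) 0) `^ alpha).
have gE w y : A (w, y) -> g (w, y) = rr w y.
  move=> /AE[w0 wy qy yL _]; have y0 : 0 <= y by exact: le_trans wy.
  by rewrite /g/= (max_l w0) (max_l y0) (max_l qy) (max_l y0).
have cg : continuous g.
  move=> z; apply: cvgM.
    apply: cvgB; [apply: (csnd (fun y => (Num.max y 0) `^ (beta + 1)))|
      apply: (cfst (fun y => (Num.max y 0) `^ (beta + 1)))]; exact: (continuous_powR_max0 (ltW b1)).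
  apply: cvgV.
    apply: lt0r_neq0; apply: den0; rewrite lt_max; apply/orP; left.
    by rewrite lt_max qm0 orbT.
  apply: cvgD.
    apply: (cfst (fun y => lower_barrier alpha beta (Num.max y 0))).
    exact: continuous_lower_barrier_max0.
  apply: (csnd (fun y => (Num.max (Num.max y qm) 0) `^ alpha)) => y.
  apply: (continuous_comp (f := fun y : R => Num.max y qm) (g := fun y => (Num.max y 0) `^ alpha)).
    by apply: continuous_max; [exact: cvg_id|exact: cvg_cst].
  exact: continuous_powR_max0.
have A1 : A (p1, q1) by apply/AE; split => //; exact: ltW.
have [[p q] Apq gmax] := compact_EVT_max (ex_intro _ _ A1) cA (continuous_subspaceT cg).
rewrite inE in Apq; have /AE[p0 pq qmq qL Npq] := Apq.
pose l := rr p q.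
have q0 : 0 < q by exact: lt_le_trans qmq.
have lmax w y : A (w, y) -> rr w y <= l.
  by move=> Awy; rewrite /l -!gE//; apply: gmax; rewrite inE.
have l1 : r1 <= l by exact: lmax.
have l0 : 0 < l by exact: lt_le_trans l1.
exists (l `^ k^-1), p, q; have -> : (l `^ k^-1) `^ (- k) = l^-1.
  by rewrite -powRrM mulrN mulVf ?gt_eqF// powRN powRr1// ltW.
split; [exact: powR_gt0| | |exact: qL|].
- move=> w y w0 wy yL Nwy; rewrite mulrC ler_pdivrMr//.
  have [y00|yn0] := eqVneq y 0.
    have -> : w = y by apply/eqP; rewrite eq_le wy y00.
    by rewrite subrr; apply: mulr_ge0; [rewrite addr_ge0 ?powR_ge0|exact: ltW].
  have y0 : 0 < y by rewrite lt_neqAle eq_sym yn0 (le_trans w0).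
  rewrite mulrC -ler_pdivrMr ?den0// -/(rr w y).
  have [qy|yq] := leP qm y; first by apply: lmax; apply/AE.
  apply: (le_trans (rrk w y y0)); apply: (le_trans _ l1); rewrite -qmk.
  by apply: ge0_ler_powR; rewrite ?nnegrE ltW.
- rewrite p0/= lt_neqAle pq andbT; apply/eqP => pqE.
  by move: l0; rewrite /l /rr pqE subrr mul0r ltxx.
- split; first exact: Npq.
  have h : q `^ (beta + 1) - p `^ (beta + 1) = l * (lower_barrier alpha beta p + q `^ alpha).
    by rewrite /l /rr divfK// gt_eqF// den0.
  apply: (mulfI (lt0r_neq0 l0)); rewrite mulrBr mulrDr !mulrA mulfV ?gt_eqF// !mul1r.
  by move: h; clear; lra.
Qed.

(** If no two heights of [[0, L]] share a value of [N], every multiplier is feasible, and the bound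
    for the degenerate arc [p = q = 0] with [lam] arbitrarily large makes the perimeter infinite.
    Otherwise the optimal arc applies. *)
Lemma weighted_isoperimetry (alpha beta K : R) (E : set (R * R)) :
  0 <= alpha -> alpha < beta + 1 -> beta <= 2 * alpha -> 0 < K -> measurable E ->
  (forall p, E p -> `|p.1| < K /\ 0 < p.2 < K) -> (0 < weighted_area beta E)%E ->
  weighted_perimeter alpha E = +oo%E \/
  exists2 t, 0 < t &
    ((t `^ (- (beta - alpha + 1)) * (beta + 1))%:E * weighted_area beta E +
     2%:E * ((t `^ (alpha + 1))%:E * kappa alpha beta) <= weighted_perimeter alpha E)%E.
Proof.
move=> a0 ab b2a K0 mE EK A0; pose L := K + 2.
pose S := [set y | (0 < mu (ysection E y))%E].
pose N := cdf_of (`]0, L]%classic `\` S).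
have b1 : 0 < beta + 1 by exact: le_lt_trans ab.
have L0 : 0 <= L by rewrite /L; lra.
have mS : measurable S.
  rewrite -[X in measurable X]setTI; apply: emeasurable_fun_o_infty => //.
  exact: measurable_fun_ysection.
have mZ : measurable (`]0, L]%classic `\` S) by exact: measurableD.
have Zfin : (mu (`]0%R, L]%classic `\` S) < +oo)%E.
  apply: (@le_lt_trans _ _ (mu `]0, L]%classic)).
    by apply: le_measure; rewrite ?inE.
  by rewrite lebesgue_measure_itv/=; case: ifP => _; rewrite -?EFinB ltry.
have lipN y z : y <= z -> 0 <= N z - N y <= z - y by exact: cdf_of_lip.
have cN : continuous N by exact: nondecreasing_lip_continuous.
have [pq|npq] := pselect (exists p q, [/\ 0 <= p, p < q, q <= L & N p = N q]).
  right; have [t [p [q [t0 feas /andP[p0 pq1] qL [Npq tight]]]]] := optimal_arc a0 ab cN pq.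
  exists t => //.
  have lam0 : 0 < t `^ (- (beta - alpha + 1)) by exact: powR_gt0.
  apply: le_trans (@arc_bound R alpha beta _ K L p q _ E a0 ab b2a lam0 K0 (lexx _) mE EK feas
     p0 (ltW pq1) qL Npq erefl (fun=> tight)).
  apply: leeD2l; apply: lee_wpmul2l; first by rewrite lee_fin.
  exact: (@arc_integral_ge R alpha beta t p q _ a0 ab b2a t0 p0 pq1 erefl tight).
left; have bound lam : 0 < lam -> ((lam * (beta + 1))%:E * weighted_area beta E <= weighted_perimeter alpha E)%E.
  move=> lam0; have feas : feasible alpha beta lam L N.
    move=> w y w0; rewrite le_eqVlt => /predU1P[->|wy] yL Nwy.
      by rewrite subrr mulr0 addr_ge0 ?powR_ge0// lower_barrier_ge0.
    by exfalso; apply: npq; exists w, y.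
  have := @arc_bound R alpha beta lam K L 0 0 _ E a0 ab b2a lam0 K0 (lexx _) mE EK feas
     (lexx _) (lexx _) L0 erefl erefl.
  rewrite ltxx set_itv_ge ?bnd_simp ?ltxx// integral_set0 mule0 adde0; exact.
move: A0 bound; case: (weighted_area beta E) => [a|_ /(_ 1 ltr01)|//].
  rewrite lte_fin => a0' bound; apply/eqyP => B B0; apply: le_trans (bound (B / (beta + 1) / a) _).
    by rewrite -EFinM lee_fin (_ : _ / _ / _ * _ * _ = B)//; field; rewrite !gt_eqF.
  by rewrite !divr_gt0.
by rewrite gt0_muley ?lte_fin ?mul1r// leye_eq => /eqP.
Qed.

End isoperimetric.

(** * Regions below a graph *)

Section weighted_fields.
Context {R : realType}.
Local Notation mu := (@lebesgue_measure R).

Lemma open_measurable2 (U : set (R * R)) : open U -> measurable U.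
Proof.
move=> oU.
pose Q (i : rat * rat * rat) : set (R * R) :=
  `](ratr i.1.1 - ratr i.2), (ratr i.1.1 + ratr i.2)[%classic `*`
  `](ratr i.1.2 - ratr i.2), (ratr i.1.2 + ratr i.2)[%classic.
have -> : U = \bigcup_i (if pselect (Q i `<=` U) then Q i else set0).
  apply/seteqP; split=> [p Up|p [i _]]; last by case: (pselect (Q i `<=` U)) => // h; exact: h.
  have /nbhs_ballP[e /= e0 he] : nbhs p U by exact: open_nbhs_nbhs.
  have e2 : 0 < e / 2 by rewrite divr_gt0.
  have [r] := rat_in_itvoo e2; rewrite in_itv/= => /andP[r0 re].
  have near_rat (x : R) : exists a : rat, `|ratr a - x| < ratr r.
    have xr : x - ratr r < x + ratr r by lra.
    have [a] := rat_in_itvoo xr; rewrite in_itv/= => /andP[h1 h2].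
    by exists a; rewrite ltr_norml; apply/andP; split; lra.
  have [a ha] := near_rat p.1; have [b hb] := near_rat p.2.
  move: (ha) (hb); rewrite !ltr_norml => /andP[a1 a2] /andP[b1 b2].
  exists (a, b, r) => //; case: (pselect (Q (a, b, r) `<=` U)) => [hQ|[]] /=.
    by split; rewrite /Q/= in_itv/=; apply/andP; split; lra.
  move=> q [/=]; rewrite !in_itv/= => /andP[q1 q2] /andP[q3 q4]; apply: he; split;
    rewrite /ball/= ltr_norml; apply/andP; split; lra.
apply: countable_bigcupT_measurable; first exact: countableP.
by move=> i; case: (pselect (Q i `<=` U)) => //= hQ; apply: measurableX.
Qed.

Lemma continuous_measurable_fun2 (f : R * R -> R) : continuous f -> measurable_fun setT f.
Proof.
move=> cf; apply: (measurability _ (RGenOpens.measurableE R)).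
move=> _ [A GA <-]; rewrite setTI; apply: open_measurable2.
by have [a [b ->]] := GA; move/continuousP : cf; apply; exact: interval_open.
Qed.

Lemma is_derive_locally0 (V : normedModType R) (f : V -> R) (p v : V) :
  (\near p, f p = 0) -> is_derive p v f 0.
Proof.
move=> h; have h' : \forall q \near p, (cst 0 : V -> R^o) q = f q by apply: filterS h => q ->.
exact: (@near_eq_is_derive _ _ R^o _ _ _ _ _ h' (is_derive_cst (0 : R^o) p v)).
Qed.

Lemma continuous_compact_support_bounded (f : R * R -> R) (K : set (R * R)) :
  compact K -> continuous f -> (forall p, ~ K p -> f p = 0) ->
  exists C, forall p, `|f p| <= C.
Proof.
move=> cK cf f0.
have /compact_bounded[M [_ HM]] := continuous_compact (continuous_subspaceT cf) cK.
exists (Num.max (M + 1) 0) => p.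
have [Kp|/f0 ->] := pselect (K p); last by rewrite normr0 le_max lexx orbT.
have M1 : M < M + 1 by rewrite ltrDl.
by rewrite le_max (HM (M + 1) M1 _ (ex_intro2 _ _ p Kp erefl)).
Qed.

Lemma derive_bounded_lipschitz (f f' : R -> R) (C : R) :
  (forall x : R, is_derive x 1 f (f' x)) -> (forall x, `|f' x| <= C) ->
  forall x y, `|f x - f y| <= C * `|x - y|.
Proof.
move=> df fC; have le_case x y : x <= y -> `|f x - f y| <= C * `|x - y|.
  move=> xy; have cf : {within `[x, y], continuous f}.
    by apply: continuous_subspaceT => z; exact: derive_continuous (df z).
  have [z _ E] := @MVT_segment R f f' x y xy (fun z _ => df z) cf.
  by rewrite distrC E normrM (distrC x); apply: ler_wpM2r.
move=> x y; have [|yx] := leP x y; first exact: le_case.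
by rewrite distrC (distrC x); apply: le_case; exact: ltW.
Qed.

(** [C1] speaks of the partial derivatives alone; continuity of the function itself comes from the
    Lipschitz bound along two segments parallel to the axes. *)
Lemma bounded_partials_continuous (h hx hy : R * R -> R) (C : R) :
  (forall p, is_derive p ex h (hx p)) -> (forall p, is_derive p ey h (hy p)) ->
  (forall p, `|hx p| <= C /\ `|hy p| <= C) -> continuous h.
Proof.
move=> dx dy hC.
have lip p q : `|h p - h q| <= C * (`|p.1 - q.1| + `|p.2 - q.2|).
  rewrite -(subrKA (h (q.1, p.2))) mulrDr; apply: (le_trans (ler_normD _ _)); apply: lerD.
    rewrite {1}(surjective_pairing p).
    apply: (@derive_bounded_lipschitz (fun x => h (x, p.2)) (fun x => hx (x, p.2)));
      last by move=> x; have [] := hC (x, p.2).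
    by move=> x; have /is_derive_exE := dx (x, p.2).
  rewrite [in X in _ - X](surjective_pairing q).
  apply: (@derive_bounded_lipschitz (fun y => h (q.1, y)) (fun y => hy (q.1, y)));
    last by move=> y; have [] := hC (q.1, y).
  by move=> y; have /is_derive_eyE := dy (q.1, y).
have C0 : 0 <= C by rewrite (le_trans (normr_ge0 _) (hC 0).1).
move=> p; apply/cvgrPdist_lt => e e0.
have d0 : 0 < e / (2 * C + 1) by rewrite divr_gt0//; lra.
have := nbhsx_ballx p _ d0; apply: filterS => q [b1 b2].
apply: (le_lt_trans (lip p q)).
move: b1 b2; rewrite /ball/= !ltr_pdivlMr; [|lra..].
move: (normr_ge0 (p.1 - q.1)) (normr_ge0 (p.2 - q.2)) e0 C0; clear; nra.
Qed.

(** The product rule applies at the points of [K], where the height is positive; at any other point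
    [u] vanishes in a neighbourhood, so the weight causes no trouble at or below height 0. *)
Lemma C1_weight (alpha : R) (u : R * R -> R) (K : set (R * R)) :
  C1 u -> compact K -> K `<=` half_plane -> (forall p, ~ K p -> u p = 0) ->
  exists wx wy C, [/\ continuous wx, continuous wy,
    (forall p, `|wx p| <= C /\ `|wy p| <= C),
    (forall p : R * R, is_derive p ex (fun q => q.2 `^ alpha * u q) (wx p)) &
    (forall p : R * R, is_derive p ey (fun q => q.2 `^ alpha * u q) (wy p))].
Proof.
move=> [ux uy cux cuy] cK KH u0.
have clK : closed K by apply: compact_closed => //; exact: norm_hausdorff.
have nearK p : ~ K p -> \near p, ~ K p.
  by move=> nK; apply: open_nbhs_nbhs; split => //; exact: closed_openC.
pose wx (p : R * R) := p.2 `^ alpha * 'D_ex u p.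
pose wy (p : R * R) := alpha * p.2 `^ (alpha - 1) * u p + p.2 `^ alpha * 'D_ey u p.
have dx p : is_derive p ex u ('D_ex u p) by exact: DeriveDef.
have dy p : is_derive p ey u ('D_ey u p) by exact: DeriveDef.
have Du0 v p : ~ K p -> 'D_v u p = 0.
  move=> nK; apply: derive_val; apply: is_derive_locally0.
  by apply: filterS (nearK _ nK) => q /u0.
have wx0 p : ~ K p -> wx p = 0 by move=> nK; rewrite /wx Du0// mulr0.
have wy0 p : ~ K p -> wy p = 0 by move=> nK; rewrite /wy Du0// u0// !mulr0 addr0.
have cpow (a : R) p : 0 < p.2 -> {for p, continuous (fun q : R * R => q.2 `^ a)}.
  move=> p0; apply: (continuous_comp (f := fun q : R * R => q.2) (g := fun y => y `^ a)).
    exact: cvg_snd.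
  exact: derive_continuous (is_derive1_powR a p0).
have near0 (f : R * R -> R) p : (forall q, ~ K q -> f q = 0) -> ~ K p -> {for p, continuous f}.
  move=> f0 nK; rewrite /prop_for /continuous_at f0//.
  by apply: cvg_near_cst; apply: filterS (nearK _ nK) => q /f0.
have cu : continuous u.
  have [Cx hCx] := continuous_compact_support_bounded cK cux (Du0 ex).
  have [Cy hCy] := continuous_compact_support_bounded cK cuy (Du0 ey).
  apply: (bounded_partials_continuous (C := Num.max Cx Cy) dx dy) => p.
  by split; rewrite le_max; [rewrite hCx|rewrite hCy orbT].
have cwx : continuous wx.
  move=> p; have [Kp|nK] := pselect (K p); last exact: (near0 _ _ wx0 nK).
  by apply: cvgM; [exact: (cpow _ _ (KH _ Kp))|exact: cux].
have cwy : continuous wy.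
  move=> p; have [Kp|nK] := pselect (K p); last exact: (near0 _ _ wy0 nK).
  apply: cvgD; apply: cvgM; [|exact: cu|exact: (cpow _ _ (KH _ Kp))|exact: cuy].
  by apply: cvgMr; exact: (cpow _ _ (KH _ Kp)).
have [C1 hC1] := continuous_compact_support_bounded cK cwx wx0.
have [C2 hC2] := continuous_compact_support_bounded cK cwy wy0.
exists wx, wy, (Num.max C1 C2); split => //.
- by move=> p; split; rewrite le_max; [rewrite hC1|rewrite hC2 orbT].
- move=> p; have [Kp|nK] := pselect (K p); last first.
    rewrite wx0//; apply: is_derive_locally0.
    by apply: filterS (nearK _ nK) => q /u0 ->; rewrite mulr0.
  apply/is_derive_exE => /=; have /is_derive_exE h := dx p.
  have : is_derive p.1 1 (fun x => p.2 `^ alpha * u (x, p.2))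
      (p.2 `^ alpha * 'D_ex u p + u (p.1, p.2) * 0) by exact: is_deriveM.
  by rewrite mulr0 addr0.
- move=> p; have [Kp|nK] := pselect (K p); last first.
    rewrite wy0//; apply: is_derive_locally0.
    by apply: filterS (nearK _ nK) => q /u0 ->; rewrite mulr0.
  apply/is_derive_eyE => /=; have /is_derive_eyE h := dy p.
  have h2 := is_derive1_powR alpha (KH _ Kp).
  have : is_derive p.2 1 (fun y => y `^ alpha * u (p.1, y))
      (p.2 `^ alpha * 'D_ey u p + u (p.1, p.2) * (alpha * p.2 `^ (alpha - 1))) by exact: is_deriveM.
  by rewrite -surjective_pairing addrC (mulrC (u p)).
Qed.

End weighted_fields.

(** * Integration over the region below a graph *)

Section graph_region.
Context {R : realType}.
Local Notation mu := (@lebesgue_measure R).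
Local Notation mu2 := (lebesgue_measure2 R).

Definition graph_region (t : R) (F : R -> R) : set (R * R) :=
  [set p | `|p.1| < F p.2 /\ 0 < p.2 < t].

(** The slope [phi] may be unbounded near the top [t], as for the star, while the limit of [F] there
    closes the region. Nothing is asked at height 0. *)
Definition is_profile (t : R) (F phi : R -> R) : Prop :=
  [/\ forall y : R, 0 < y < t -> is_derive y 1 F (- phi y),
      forall y : R, 0 < y < t -> {for y, continuous phi},
      forall y : R, 0 < y < t -> 0 <= phi y,
      forall y : R, 0 < y < t -> 0 < F y &
      F t = 0 /\ F y @[y --> t^'-] --> 0].

Variables (t : R) (F phi : R -> R).
Hypothesis FP : is_profile t F phi.

Lemma measurable_profile : measurable_fun `]0, t[ F.
Proof.
apply: open_continuous_measurable_fun; first exact: interval_open.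
move=> y; rewrite inE/= in_itv/= => yt; have [h _ _ _ _] := FP.
exact: derive_continuous (h y yt).
Qed.

Lemma measurable_slope : measurable_fun `]0, t[ phi.
Proof.
apply: open_continuous_measurable_fun; first exact: interval_open.
by move=> y; rewrite inE/= in_itv/= => yt; have [_ h _ _ _] := FP; exact: h.
Qed.

Let F0 := F \_ `]0, t[%classic.
Let phi0 := phi \_ `]0, t[%classic.

Let mF0 : measurable_fun setT F0.
Proof. by apply/(measurable_restrictT _ _).1 => //; exact: measurable_profile. Qed.

Let mphi0 : measurable_fun setT phi0.
Proof. by apply/(measurable_restrictT _ _).1 => //; exact: measurable_slope. Qed.

Let F0E y : 0 < y < t -> F0 y = F y.
Proof. by move=> yt; rewrite /F0 /patch ifT// inE/= in_itv. Qed.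

Let phi0E y : 0 < y < t -> phi0 y = phi y.
Proof. by move=> yt; rewrite /phi0 /patch ifT// inE/= in_itv. Qed.

Let phi00 y : 0 <= phi0 y.
Proof.
rewrite /phi0 /patch; case: ifPn => //; rewrite inE/= in_itv/= => yt.
by have [_ _ h _ _] := FP; exact: h.
Qed.

Lemma measurable_graph_region : measurable (graph_region t F).
Proof.
have -> : graph_region t F = (setT `*` `]0, t[%classic) `&`
    ((fun p : R * R => F0 p.2 - `|p.1|) @^-1` `]0, +oo[%classic).
  apply/seteqP; split=> p /=; rewrite !in_itv/= andbT subr_gt0.
    by move=> [h pt]; rewrite F0E.
  by move=> [[_ pt]]; rewrite F0E.
apply: measurableI; first by apply: measurableX.
rewrite -[X in measurable X]setTI.
have mg : measurable_fun setT (fun p : R * R => F0 p.2 - `|p.1|).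
  apply: measurable_funB; first exact: measurable_fun_snd1.
  by apply: (measurable_fun_fst1 (f := fun x => `|x|)); exact: normr_measurable.
by apply: mg => //; exact: measurable_itv.
Qed.

Lemma ysection_graph_region y : 0 < y < t -> ysection (graph_region t F) y = `](- F y), (F y)[%classic.
Proof.
move=> yt; apply/seteqP; split=> x; rewrite /ysection/= inE/= in_itv/= -ltr_norml.
  by move=> [].
by split.
Qed.

Lemma graph_integral_slices (h : R * R -> R) : measurable_fun setT h -> (forall p, 0 <= h p) ->
  (\int[mu2]_(p in graph_region t F) (h p)%:E =
   \int[mu]_(y in `]0%R, t[) \int[mu]_(x in `](- F y)%R, (F y)[) (h (x, y))%:E)%E.
Proof.
move=> mh h0.
rewrite (fubini_tonelli2_set measurable_graph_region mh h0).
rewrite [RHS]integral_mkcond; apply: eq_integral => y _; rewrite /patch; case: ifPn => yt.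
  by rewrite inE/= in_itv/= in yt; rewrite ysection_graph_region.
rewrite (_ : ysection _ _ = set0) ?integral_set0// -subset0 => x.
rewrite /ysection/= inE/= => -[_ h1].
by move: yt; rewrite notin_setE/= in_itv/=.
Qed.

Lemma continuous_pairl (h : R * R -> R) y : continuous h -> continuous (fun x => h (x, y)).
Proof.
move=> ch x; apply: (continuous_comp (f := fun x => (x, y)) (g := h)); last exact: ch.
by apply: (@cvg_pair _ _ _ (nbhs x) (nbhs x) (nbhs y)); [exact: cvg_id|exact: cvg_cst].
Qed.

Lemma continuous_pairr (h : R * R -> R) x : continuous h -> continuous (fun y => h (x, y)).
Proof.
move=> ch y; apply: (continuous_comp (f := fun y => (x, y)) (g := h)); last exact: ch.
by apply: (@cvg_pair _ _ _ (nbhs y) (nbhs x) (nbhs y)); [exact: cvg_cst|exact: cvg_id].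
Qed.

Lemma ge0_FTC2_continuous (f f' : R -> R) (a b : R) : a < b ->
  (forall x : R, is_derive x 1 f (f' x)) -> continuous f' -> (forall x, 0 <= f' x) ->
  (\int[mu]_(x in `]a, b[) (f' x)%:E = (f b - f a)%:E)%E.
Proof.
move=> ab df cf f0; apply: ge0_FTC2_oo => //.
- by move=> x _; exact: cf.
- apply: cvg_at_right_filter; exact: derive_continuous (df a).
- apply: cvg_at_left_filter; exact: derive_continuous (df b).
Qed.

Lemma graph_integral_ex (h hx : R * R -> R) : continuous hx -> (forall p, 0 <= hx p) ->
  (forall p, is_derive p ex h (hx p)) ->
  (\int[mu2]_(p in graph_region t F) (hx p)%:E =
   \int[mu]_(y in `]0%R, t[) (h (F y, y) - h (- F y, y))%:E)%E.
Proof.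
move=> chx hx0 dx.
rewrite (graph_integral_slices (continuous_measurable_fun2 chx) hx0); apply: eq_integral => y.
rewrite inE/= in_itv/= => yt; have [_ _ _ Fpos _] := FP; have Fy := Fpos _ yt.
apply: (@ge0_FTC2_continuous (fun x => h (x, y)) (fun x => hx (x, y))) => //.
- by lra.
- by move=> x; have /is_derive_exE := dx (x, y).
- exact: continuous_pairl.
Qed.

(* In the slice at height [s], the change of variables [x = F y]. *)
Lemma slice_along_graph (u : R -> R) s : continuous u -> (forall x, 0 <= u x) -> 0 < s < t ->
  (\int[mu]_(x in `](- F s)%R, (F s)[) (u x)%:E =
   \int[mu]_(y in `]s, t[) (phi y * (u (F y) + u (- F y)))%:E)%E.
Proof.
move=> cu u0 /andP[s0 st]; have [dF cphi phi_ge0 Fpos [Ft cFt]] := FP.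
have sst : 0 < s < t by rewrite s0.
have Fs := Fpos _ sst.
have [U dU] := antiderivative cu.
rewrite (ge0_FTC2_continuous _ dU cu u0); last by lra.
pose G y := U (- F y) - U (F y).
have dG y : 0 < y < t -> is_derive y 1 G (phi y * (u (F y) + u (- F y))).
  move=> yt; have h := dF y yt.
  have hN : is_derive y 1 (fun y => - F y) (phi y).
    by have := is_deriveN h; rewrite opprK.
  have h1 : is_derive y 1 (fun y => U (F y)) (u (F y) * (- phi y)).
    by apply: (@is_derive1_comp _ U F); exact: dU.
  have h2 : is_derive y 1 (fun y => U (- F y)) (u (- F y) * phi y).
    by apply: (@is_derive1_comp _ U (fun y => - F y)); exact: dU.
  by apply: is_derive_eq; ring.
have -> : U (F s) - U (- F s) = G t - G s by rewrite /G Ft oppr0; ring.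
symmetry; apply: ge0_FTC2_oo => //.
- by move=> y /andP[sy yt]; apply: dG; rewrite (lt_trans s0 sy).
- move=> y /andP[sy yt]; have yy : 0 < y < t by rewrite (lt_trans s0 sy).
  have cF := derive_continuous (dF y yy).
  apply: cvgM; first exact: cphi.
  apply: cvgD; first by apply: (continuous_comp cF); exact: cu.
  by apply: (continuous_comp (f := fun y => - F y)); [exact: cvgN|exact: cu].
- move=> y /andP[sy yt]; apply: mulr_ge0; last by rewrite addr_ge0.
  by apply: phi_ge0; rewrite (lt_trans s0 sy).
- by apply: cvg_at_right_filter; exact: derive_continuous (dG s sst).
- have cU : continuous U by move=> x; exact: derive_continuous (dU x).
  rewrite /G Ft oppr0; have cN : - F y @[y --> t^'-] --> 0 by rewrite -[X in _ --> X]oppr0; exact: cvgN.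
  apply: cvgB; [exact: (continuous_cvg _ (cU 0) cN)|exact: (continuous_cvg _ (cU 0) cFt)].
Qed.

(** Once each slice is parametrised by the graph, the region becomes the triangle [0 < s < y < t].
    Exchanging the order leaves integrals in the height [s] along the columns at [F y] and [- F y],
    without any inverse of [F]. *)
Lemma graph_integral_columns (hy : R * R -> R) : measurable_fun setT hy ->
  (forall y, continuous (fun x => hy (x, y))) -> (forall p, 0 <= hy p) ->
  (\int[mu2]_(p in graph_region t F) (hy p)%:E =
   \int[mu]_(y in `]0%R, t[) \int[mu]_(s in `]0%R, y[)
     (phi y * (hy (F y, s) + hy (- F y, s)))%:E)%E.
Proof.
move=> mhy chy hy0; rewrite (graph_integral_slices mhy hy0).
pose T := [set p : R * R | 0 < p.2 < p.1 /\ p.1 < t].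
pose g (p : R * R) := phi0 p.1 * (hy (F0 p.1, p.2) + hy (- F0 p.1, p.2)).
have mT : measurable T.
  have -> : T = ((fun p : R * R => p.2) @^-1` `]0, +oo[%classic) `&`
     (((fun p : R * R => p.1 - p.2) @^-1` `]0, +oo[%classic) `&`
      ((fun p : R * R => p.1) @^-1` `]-oo, t[%classic)).
    apply/seteqP; split=> p; rewrite /T/= !in_itv/= !andbT subr_gt0.
      by move=> [/andP[]].
    by move=> [-> [-> ->]]; split.
  have c1 : continuous (fun p : R * R => p.1) by move=> p; exact: cvg_fst.
  have c2 : continuous (fun p : R * R => p.2) by move=> p; exact: cvg_snd.
  apply: open_measurable2; apply: openI; [|apply: openI].
  - by move/continuousP : c2; apply; exact: interval_open.
  - have c3 : continuous (fun p : R * R => p.1 - p.2) by move=> p; apply: cvgB; [exact: c1|exact: c2].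
    by move/continuousP : c3; apply; exact: interval_open.
  - by move/continuousP : c1; apply; exact: interval_open.
have mg : measurable_fun setT g.
  apply: measurable_funM; first exact: measurable_fun_fst1.
  apply: measurable_funD.
    apply: (measurableT_comp (f := hy) mhy (g := fun p => (F0 p.1, p.2))).
    by apply: measurable_fun_pair; [exact: (measurable_fun_fst1 mF0)|exact: measurable_snd].
  apply: (measurableT_comp (f := hy) mhy (g := fun p => (- F0 p.1, p.2))).
  have mN : measurable_fun setT (fun y => - F0 y) by exact: measurableT_comp.
  by apply: measurable_fun_pair; [exact: (measurable_fun_fst1 mN)|exact: measurable_snd].
have g0 p : 0 <= g p by rewrite mulr_ge0// addr_ge0.
transitivity (\int[mu2]_(p in T) (g p)%:E)%E.
  rewrite (fubini_tonelli2_set mT mg g0) [LHS]integral_mkcond; apply: eq_integral => s _.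
  rewrite /patch; case: ifPn => st; last first.
    rewrite (_ : ysection _ _ = set0) ?integral_set0// -subset0 => y.
    rewrite /ysection/= inE/T/= => -[/andP[h1 h2] h3].
    by move: st; rewrite notin_setE/= in_itv/= h1/= (lt_trans h2 h3).
  rewrite inE/= in_itv/= in st; have /andP[s0 _] := st.
  rewrite (slice_along_graph (u := fun x => hy (x, s)))//.
  have -> : ysection T s = `]s, t[%classic.
    apply/seteqP; split=> y; rewrite /ysection/= inE/T/= in_itv/=.
      by move=> [/andP[_ ->] ->].
    by move=> /andP[sy ->]; rewrite s0 sy.
  apply: eq_integral => y; rewrite inE/= in_itv/= => /andP[sy yt].
  by rewrite /g/= phi0E ?F0E// (lt_trans s0 sy).
rewrite (fubini_tonelli1_set mT mg g0) [RHS]integral_mkcond; apply: eq_integral => y _.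
rewrite /patch; case: ifPn => yt; last first.
  rewrite (_ : xsection _ _ = set0) ?integral_set0// -subset0 => s.
  rewrite /xsection/= inE/T/= => -[/andP[h1 h2] h3].
  by move: yt; rewrite notin_setE/= in_itv/= h3 (lt_trans h1 h2).
rewrite inE/= in_itv/= in yt; have /andP[y0 yt'] := yt.
have -> : xsection T y = `]0, y[%classic.
  apply/seteqP; split=> s; rewrite /xsection/= inE/T/= in_itv/=.
    by move=> [].
  by move=> ->.
by apply: eq_integral => s _; rewrite /g/= phi0E ?F0E.
Qed.

Lemma graph_integral_ey (h hy : R * R -> R) : continuous hy -> (forall p, 0 <= hy p) ->
  (forall p, is_derive p ey h (hy p)) -> (forall x, h (x, 0) = 0) ->
  (\int[mu2]_(p in graph_region t F) (hy p)%:E =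
   \int[mu]_(y in `]0%R, t[) (phi y * (h (F y, y) + h (- F y, y)))%:E)%E.
Proof.
move=> chy hy0 dy h0.
rewrite (graph_integral_columns (continuous_measurable_fun2 chy)
  (fun y => @continuous_pairl hy y chy) hy0); apply: eq_integral => y.
rewrite inE/= in_itv/= => yt; have /andP[y0 _] := yt; have [_ _ phi_ge0 _ _] := FP.
have -> : phi y * (h (F y, y) + h (- F y, y)) =
    phi y * (h (F y, y) + h (- F y, y)) - phi y * (h (F y, 0) + h (- F y, 0)).
  by rewrite !h0 addr0 mulr0 subr0.
apply: (@ge0_FTC2_continuous (fun s => phi y * (h (F y, s) + h (- F y, s)))
  (fun s => phi y * (hy (F y, s) + hy (- F y, s)))) => //.
- move=> s.
  have /is_derive_eyE d1 := dy (F y, s); have /is_derive_eyE d2 := dy (- F y, s).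
  by apply: is_derive_eq; rewrite /= /GRing.scale/=; ring.
- by move=> s; apply: cvgMr; apply: cvgD; exact: continuous_pairr.
- by move=> s; rewrite mulr_ge0 ?phi_ge0// addr_ge0.
Qed.

End graph_region.

(** * Perimeter of the region below a graph *)

Section graph_perimeter.
Context {R : realType}.
Local Notation mu := (@lebesgue_measure R).
Local Notation mu2 := (lebesgue_measure2 R).

(** Cauchy-Schwarz against the vector [(1, s)], which is normal to the graph when [s] is its slope
    [phi]. *)
Lemma unit_vector_dual (a b s : R) : Num.sqrt (a ^+ 2 + b ^+ 2) <= 1 ->
  a + s * b <= Num.sqrt (1 + s ^+ 2).
Proof.
move=> ab; have [le0|gt0] := leP (a + s * b) 0; first exact: (le_trans le0 (sqrtr_ge0 _)).
rewrite -(ger0_norm (ltW gt0)) -sqrtr_sqr; apply: ler_wsqrtr.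
have ab1 : a ^+ 2 + b ^+ 2 <= 1.
  rewrite -(@sqrtr1 R) ler_sqrt// in ab.
have := sqr_ge0 (b - s * a); have := sqr_ge0 s; move: ab1; clear; nra.
Qed.

(** Admissibility bounds the field inside the region, whereas the Gauss-Green formula evaluates it
    on the boundary; continuity along horizontal lines carries the bound there. *)
Lemma field_norm_boundary (v : R * R -> R * R) (y r : R) : 0 < r ->
  C1 (fun p => (v p).1) -> C1 (fun p => (v p).2) ->
  (forall x, `|x| < r -> euclidean_norm (v (x, y)) <= 1) ->
  euclidean_norm (v (r, y)) <= 1 /\ euclidean_norm (v (- r, y)) <= 1.
Proof.
move=> r0 [d1 _ _ _] [d2 _ _ _] v1.
have cline (u : R * R -> R) : (forall p, derivable u p ex) -> continuous (fun x => u (x, y)).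
  move=> du x; have /is_derive_exE h : is_derive (x, y) ex u ('D_ex u (x, y)) by exact: DeriveDef.
  exact: derive_continuous h.
have c : continuous (fun x => euclidean_norm (v (x, y))).
  move=> x; rewrite /euclidean_norm.
  apply: (continuous_comp (f := fun x => (v (x, y)).1 ^+ 2 + (v (x, y)).2 ^+ 2) (g := @Num.sqrt R)); last exact: sqrt_continuous.
  by apply: cvgD; rewrite expr2; apply: cvgM; solve [exact: (cline (fun p => (v p).1))|exact: (cline (fun p => (v p).2))].
split.
  apply: (cvgr_to_le (cvg_at_left_filter (c r))); near=> x; apply: v1.
  rewrite ltr_norml; apply/andP; split; last by near: x; exact: nbhs_left_lt.
  by near: x; apply: nbhs_left_gt; lra.
apply: (cvgr_to_le (cvg_at_right_filter (c (- r)))); near=> x; apply: v1.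
rewrite ltr_norml; apply/andP; split; first by near: x; exact: nbhs_right_gt.
by near: x; apply: nbhs_right_lt; lra.
Unshelve. all: by end_near. Qed.

(** The integration formulas hold for nonnegative derivatives. A constant [C] is therefore added to
    both partial derivatives, and its contribution, computed by the same formulas, is cancelled on
    the boundary side. *)
Lemma graph_perimeter_le (alpha t M : R) (F phi : R -> R) : 0 <= alpha -> 0 < t ->
  is_profile t F phi -> (forall y, 0 < y < t -> F y <= M) ->
  (weighted_perimeter alpha (graph_region t F) <=
   \int[mu]_(y in `]0%R, t[) (2 * (y `^ alpha * Num.sqrt (1 + phi y ^+ 2)))%:E)%E.
Proof.
move=> a0 t0 FP FM; apply: ge_ereal_sup => _ [v [[c1 c2 cK KH] v1] <-].
set E := graph_region t F; have mE : measurable E := measurable_graph_region FP.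
set K := closure _ in cK KH.
have v0 p : ~ K p -> v p = 0.
  by move=> nK; apply/eqP/negPn/negP => h; apply: nK; exact: subset_closure.
have [w1x [w1y [C1 [cw1x cw1y b1 d1x d1y]]]] :=
  C1_weight alpha c1 cK KH (fun p nK => congr1 fst (v0 p nK)).
have [w2x [w2y [C2 [cw2x cw2y b2 d2x d2y]]]] :=
  C1_weight alpha c2 cK KH (fun p nK => congr1 snd (v0 p nK)).
set w1 := (fun q : R * R => q.2 `^ alpha * (v q).1) in d1x d1y.
set w2 := (fun q : R * R => q.2 `^ alpha * (v q).2) in d2x d2y.
have cw1 : continuous w1 := bounded_partials_continuous d1x d1y b1.
have cw2 : continuous w2 := bounded_partials_continuous d2x d2y b2.
have w20 x : w2 (x, 0) = 0.
  by rewrite /w2 v0 ?mulr0// => /KH; rewrite /half_plane/= ltxx.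
pose C := Num.max C1 C2.
have bx p : `|w1x p| <= C by rewrite le_max (b1 p).1.
have by_ p : `|w2y p| <= C by rewrite le_max (b2 p).2 orbT.
have C0 : 0 <= C by rewrite (le_trans (normr_ge0 _) (bx 0)).
have divE p : divergence (fun q : R * R => q.2 `^ alpha *: v q) p = w1x p + w2y p.
  by have ? := d1x p; have ? := d2y p; congr (_ + _); exact: derive_val.
have [dF _ phi0 Fpos _] := FP.
have inE_ p : E p -> `|p.1| <= Num.max M t /\ `|p.2| <= Num.max M t.
  move=> [h pt]; have /andP[p0 pt'] := pt; rewrite !le_max; split.
    by rewrite (le_trans (ltW h) (FM _ pt)).
  by rewrite gtr0_norm// (ltW pt') orbT.
have Efin : (mu2 E < +oo)%E by exact: (measure2_bounded_lty mE inE_).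
have int (f : R * R -> R) B : continuous f -> (forall p, `|f p| <= B) -> mu2.-integrable E (EFin \o f).
  move=> cf fB; apply: (@bounded_integrable _ _ _ _ _ _ B) => //.
  by apply: measurable_funTS; exact: continuous_measurable_fun2.
have cst_ge0 : (0 <= \int[mu2]_(p in E) (C%:E))%E by apply: integral_ge0 => p _; rewrite lee_fin.
have cst_fin : (\int[mu2]_(p in E) (C%:E) \is a fin_num)%E.
  apply: integrable_fin_num => //; apply: (int (cst C) C); first exact: cst_continuous.
  by move=> p; rewrite ger0_norm.
have addC (f : R * R -> R) B : continuous f -> (forall p, `|f p| <= B) ->
    (\int[mu2]_(p in E) (f p + C)%:E = \int[mu2]_(p in E) (f p)%:E + \int[mu2]_(p in E) C%:E)%E.
  move=> cf fB; rewrite -integralD_EFin//; first exact: (int f B).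
  by apply: (int (cst C) C); [exact: cst_continuous|move=> p; rewrite ger0_norm].
have h1 : (\int[mu2]_(p in E) (w1x p + C)%:E =
    \int[mu]_(y in `]0%R, t[) (w1 (F y, y) - w1 (- F y, y) + 2 * (C * F y))%:E)%E.
  etransitivity; first apply: (graph_integral_ex FP (h := fun p => w1 p + C * p.1)).
  - by move=> p; apply: cvgD; [exact: cw1x|exact: cvg_cst].
  - by move=> p; have := bx p; rewrite ler_norml; lra.
  - move=> p; have /is_derive_exE h := d1x p; apply/is_derive_exE => /=.
    have h' : is_derive p.1 1 (fun x => C * x) C by apply: is_derive_eq; rewrite /GRing.scale/=; ring.
    exact: is_deriveD.
  - by apply: eq_integral => y _ /=; congr (_%:E); ring.
have h2 : (\int[mu2]_(p in E) (w2y p + C)%:E =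
    \int[mu]_(y in `]0%R, t[) (phi y * (w2 (F y, y) + w2 (- F y, y) + 2 * (C * y)))%:E)%E.
  etransitivity; first apply: (graph_integral_ey FP (h := fun p => w2 p + C * p.2)).
  - by move=> p; apply: cvgD; [exact: cw2y|exact: cvg_cst].
  - by move=> p; have := by_ p; rewrite ler_norml; lra.
  - move=> p; have /is_derive_eyE h := d2y p; apply/is_derive_eyE => /=.
    have h' : is_derive p.2 1 (fun x => C * x) C by apply: is_derive_eq; rewrite /GRing.scale/=; ring.
    exact: is_deriveD.
  - by move=> x; rewrite w20 mulr0 addr0.
  - by apply: eq_integral => y _ /=; congr (_%:E); ring.
have h3 : (\int[mu2]_(p in E) C%:E = \int[mu]_(y in `]0%R, t[) (2 * (C * F y))%:E)%E.
  etransitivity; first apply: (graph_integral_ex FP (h := fun p => C * p.1) (hx := cst C)).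
  - exact: cst_continuous.
  - by [].
  - move=> p; apply/is_derive_exE => /=.
    by apply: is_derive_eq; rewrite /GRing.scale/=; ring.
  - by apply: eq_integral => y _ /=; congr (_%:E); ring.
have h4 : (\int[mu2]_(p in E) C%:E = \int[mu]_(y in `]0%R, t[) (phi y * (2 * (C * y)))%:E)%E.
  etransitivity; first apply: (graph_integral_ey FP (h := fun p => C * p.2) (hy := cst C)).
  - exact: cst_continuous.
  - by [].
  - move=> p; apply/is_derive_eyE => /=.
    by apply: is_derive_eq; rewrite /GRing.scale/=; ring.
  - by move=> x; rewrite mulr0.
  - by apply: eq_integral => y _ /=; congr (_%:E); ring.
have mF := measurable_profile FP; have mphi := measurable_slope FP.
have mcomp (h : R * R -> R) (s : R) : continuous h -> measurable_fun `]0, t[ (fun y : R => h (s * F y, y)).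
  move=> ch; apply: open_continuous_measurable_fun; first exact: interval_open.
  move=> y; rewrite inE/= in_itv/= => yt; have cF := derive_continuous (dF y yt).
  apply: (continuous_comp (f := fun y => (s * F y, y)) (g := h)); last exact: ch.
  by apply: (@cvg_pair _ _ _ (nbhs y) (nbhs (s * F y)) (nbhs y)); [exact: cvgMr|exact: cvg_id].
have vb (y : R) : 0 < y < t -> euclidean_norm (v (F y, y)) <= 1 /\ euclidean_norm (v (- F y, y)) <= 1.
  by move=> yt; apply: field_norm_boundary => //; [exact: Fpos|move=> x xF; apply: v1].
have pt (y : R) : 0 < y < t -> w1 (F y, y) - w1 (- F y, y) + phi y * (w2 (F y, y) + w2 (- F y, y)) <=
    2 * (y `^ alpha * Num.sqrt (1 + phi y ^+ 2)).
  move=> yt; have [n1 n2] := vb y yt.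
  have k1 := unit_vector_dual (phi y) n1.
  have n2' : Num.sqrt ((- (v (- F y, y)).1) ^+ 2 + (v (- F y, y)).2 ^+ 2) <= 1 by rewrite sqrrN.
  have k2 := unit_vector_dual (phi y) n2'.
  have ya := powR_ge0 y alpha.
  have := ler_wpM2l ya k1; have := ler_wpM2l ya k2; rewrite /w1 /w2/=; clear; lra.
have p1 (y : R) : 0 < y < t -> 0 <= w1 (F y, y) - w1 (- F y, y) + 2 * (C * F y).
  move=> yt; have d (x : R) : is_derive x 1 (fun x => w1 (x, y)) (w1x (x, y)).
    by have /is_derive_exE := d1x (x, y).
  have := derive_bounded_lipschitz d (fun x => bx (x, y)) (F y) (- F y).
  have Fy := Fpos _ yt.
  rewrite opprK -mulr2n (ger0_norm (x := F y *+ 2)); last by rewrite mulr2n; lra.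
  by rewrite ler_norml mulr2n => /andP[h _]; move: h; clear; lra.
have p2 (y : R) : 0 < y < t -> 0 <= phi y * (w2 (F y, y) + w2 (- F y, y) + 2 * (C * y)).
  move=> yt; apply: mulr_ge0; first exact: phi0.
  have d (x z : R) : is_derive z 1 (fun z => w2 (x, z)) (w2y (x, z)).
    by have /is_derive_eyE := d2y (x, z).
  have /andP[y0 _] := yt.
  have l x := derive_bounded_lipschitz (d x) (fun z => by_ (x, z)) y 0.
  have := l (F y); have := l (- F y).
  rewrite !w20 !subr0 (gtr0_norm y0) !ler_norml => /andP[g1 _] /andP[g2 _].
  by move: g1 g2; clear; lra.
have i1 := int w1x C cw1x bx; have i2 := int w2y C cw2y by_.
rewrite (_ : (\int[mu2]_(p in E) _ = \int[mu2]_(p in E) (w1x p)%:E + \int[mu2]_(p in E) (w2y p)%:E)%E); last first.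
  rewrite -integralD_EFin//; apply: eq_integral => p _.
  by rewrite divE.
rewrite -(leeD2rE _ _ cst_fin) -(leeD2rE _ _ cst_fin).
rewrite -addeA addeACA -(addC w1x C cw1x bx) -(addC w2y C cw2y by_) h1 h2.
have mid A : measurable_fun A (fun y : R => y) by exact: measurable_id.
have mw1 : measurable_fun `]0, t[ (fun y : R => w1 (F y, y)).
  rewrite (_ : (fun y : R => _) = fun y => w1 (1 * F y, y)); first exact: mcomp.
  by apply/funext => y; rewrite mul1r.
have mw1' : measurable_fun `]0, t[ (fun y : R => w1 (- F y, y)).
  rewrite (_ : (fun y : R => _) = fun y => w1 ((-1) * F y, y)); first exact: mcomp.
  by apply/funext => y; rewrite mulN1r.
have mw2 : measurable_fun `]0, t[ (fun y : R => w2 (F y, y)).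
  rewrite (_ : (fun y : R => _) = fun y => w2 (1 * F y, y)); first exact: mcomp.
  by apply/funext => y; rewrite mul1r.
have mw2' : measurable_fun `]0, t[ (fun y : R => w2 (- F y, y)).
  rewrite (_ : (fun y : R => _) = fun y => w2 ((-1) * F y, y)); first exact: mcomp.
  by apply/funext => y; rewrite mulN1r.
have mCF : measurable_fun `]0, t[ (fun y => 2 * (C * F y)) by do 2 apply: measurable_funM => //.
have mCy : measurable_fun `]0, t[ (fun y => 2 * (C * y)) by do 2 apply: measurable_funM => //.
have mpCy : measurable_fun `]0, t[ (fun y => phi y * (2 * (C * y))) by exact: measurable_funM.
have mR : measurable_fun `]0, t[ (fun y => 2 * (y `^ alpha * Num.sqrt (1 + phi y ^+ 2))).
  apply: measurable_funM => //; apply: measurable_funM.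
    by apply: measurable_funTS; exact: measurable_powR.
  have ms : measurable_fun setT (@Num.sqrt R).
    by apply: continuous_measurable_fun; exact: sqrt_continuous.
  apply: (measurableT_comp ms); apply: measurable_funD => //.
  exact: measurable_funX.
have R0 y : 0 <= 2 * (y `^ alpha * Num.sqrt (1 + phi y ^+ 2)).
  by rewrite mulr_ge0// mulr_ge0// ?powR_ge0// sqrtr_ge0.
have F0 (y : R) : 0 < y < t -> 0 <= 2 * (C * F y).
  by move=> yt; rewrite mulr_ge0// mulr_ge0// ltW// Fpos.
have y0' (y : R) : 0 < y < t -> 0 <= phi y * (2 * (C * y)).
  by move=> yt; have /andP[y0 _] := yt; rewrite mulr_ge0 ?phi0// mulr_ge0// mulr_ge0// ltW.
rewrite [X in (_ <= _ + X + _)%E]h3 [X in (_ <= _ + X)%E]h4.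
rewrite -ge0_integralD//=; first last.
- apply/measurable_EFinP; apply: measurable_funM => //.
  by apply: measurable_funD => //; exact: measurable_funD.
- by apply/measurable_EFinP; apply: measurable_funD => //; exact: measurable_funB.
have mE1 := (measurable_EFinP _ _).2 mR; have mE2 := (measurable_EFinP _ _).2 mCF.
have mE3 := (measurable_EFinP _ _).2 mpCy.
rewrite -ge0_integralD//=; last by move=> y _; rewrite lee_fin R0.
rewrite -ge0_integralD//=; first last.
- by apply: emeasurable_funD.
- by move=> y yt; rewrite -EFinD lee_fin addr_ge0// F0.
apply: ge0_le_integral_nonmeas.
  by move=> y; rewrite /= in_itv/= => yt; rewrite -EFinD lee_fin addr_ge0// ?p1// p2.
move=> y; rewrite /= in_itv/= => yt; rewrite -!EFinD lee_fin.
by have := pt y yt; clear; lra.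
Qed.

End graph_perimeter.

(** * The star-shaped region *)

Section star_profile.
Context {R : realType}.
Local Notation mu := (@lebesgue_measure R).

(** The ratio of the components of the unit normal to the boundary of the star, whose vertical one
    is [s^k]. *)
Definition star_slope (k s : R) : R := s `^ k / Num.sqrt (1 - s `^ (2 * k)).

Lemma powR_lt1 (k s : R) : 0 < k -> 0 <= s < 1 -> s `^ k < 1.
Proof.
move=> k0 /andP[s0 s1]; have := gt0_ltr_powR k0 _ _ s1.
by rewrite powR1; apply; rewrite nnegrE.
Qed.

Lemma star_slope_ge0 (k s : R) : 0 <= star_slope k s.
Proof. by rewrite divr_ge0 ?powR_ge0// sqrtr_ge0. Qed.

Lemma continuous_star_slope (k s : R) : 0 < k -> 0 < s < 1 -> {for s, continuous (star_slope k)}.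
Proof.
move=> k0 /andP[s0 s1].
have cpow a : {for s, continuous (fun s : R => s `^ a)} := derive_continuous (is_derive1_powR a s0).
have pos : 0 < 1 - s `^ (2 * k) by rewrite subr_gt0 powR_lt1 ?s1 ?(ltW s0)//; lra.
apply: cvgM; first exact: cpow.
apply: cvgV; first by rewrite gt_eqF// sqrtr_gt0.
apply: (continuous_comp (f := fun s => 1 - s `^ (2 * k)) (g := @Num.sqrt R)); last exact: sqrt_continuous.
by apply: cvgB; [exact: cvg_cst|exact: cpow].
Qed.

(** From [ln s <= s - 1] and [exp (- x) <= 1 / (1 + x)] with [x = a (1 - s)]. It shows that
    [1 - s^a] vanishes no faster than linearly at 1. *)
Lemma powR_chord (a s : R) : 0 < a -> 0 < s < 1 -> a / (1 + a) * (1 - s) <= 1 - s `^ a.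
Proof.
move=> a0 /andP[s0 s1].
have x0 : 0 <= a * (1 - s) by rewrite mulr_ge0 ?ltW// subr_gt0.
have a1 : 0 < 1 + a by lra.
have lns : a * ln s <= - (a * (1 - s)).
  by rewrite -mulrN ler_pM2l// opprB; have := expR_ge1Dx (ln s); rewrite lnK ?posrE//; clear; lra.
have x1 : 0 < 1 + a * (1 - s) by lra.
have : s `^ a <= (1 + a * (1 - s))^-1.
  rewrite /powR gt_eqF//; apply: (@le_trans _ _ (expR (- (a * (1 - s))))).
    by rewrite ler_expR.
  by rewrite expRN lef_pV2 ?posrE ?expR_gt0//; exact: expR_ge1Dx.
move=> h; apply: (@le_trans _ _ (1 - (1 + a * (1 - s))^-1)); last by lra.
have -> : 1 - (1 + a * (1 - s))^-1 = a * (1 - s) / (1 + a * (1 - s)).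
  by field; rewrite gt_eqF.
rewrite mulrAC ler_wpM2l// lef_pV2 ?posrE//.
have : a * (1 - s) <= a * 1 by rewrite ler_pM2l//; lra.
lra.
Qed.

(** The singularity at the top is at most that of an inverse square root, hence integrable. *)
Lemma star_slope_le (k : R) : 0 < k -> exists2 M, 0 < M &
  forall s, 0 < s < 1 -> star_slope k s <= M / Num.sqrt (1 - s).
Proof.
move=> k0; pose c := 2 * k / (1 + 2 * k).
have c0 : 0 < c by rewrite divr_gt0//; lra.
exists (Num.sqrt c)^-1; first by rewrite invr_gt0 sqrtr_gt0.
move=> s s01; have /andP[s0 s1] := s01.
have k2 : 0 < 2 * k by lra.
have h := powR_chord k2 s01.
have d0 : 0 < c * (1 - s) by rewrite mulr_gt0// subr_gt0.
rewrite -invfM -sqrtrM ?(ltW c0)// /star_slope -[leRHS]mul1r.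
apply: ler_pM; rewrite ?powR_ge0 ?invr_ge0 ?sqrtr_ge0//.
  by apply: powR_le1; rewrite ?(ltW k0)// !ltW.
rewrite lef_pV2 ?posrE ?sqrtr_gt0//; last exact: lt_le_trans h.
by apply: ler_wsqrtr.
Qed.

Lemma integral_invsqrt (y : R) : y < 1 ->
  (\int[mu]_(s in `]y, 1%R[) ((Num.sqrt (1 - s))^-1)%:E = (2 * Num.sqrt (1 - y))%:E)%E.
Proof.
move=> y1; pose G (s : R) := - (2 * Num.sqrt (1 - s)).
have cG : continuous G.
  move=> s; apply: cvgN; apply: cvgMr.
  apply: (continuous_comp (f := fun s : R => 1 - s) (g := @Num.sqrt R)); last exact: sqrt_continuous.
  by apply: cvgB; [exact: cvg_cst|exact: cvg_id].
have -> : 2 * Num.sqrt (1 - y) = G 1 - G y by rewrite /G subrr sqrtr0; ring.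
apply: ge0_FTC2_oo; first exact: y1.
- move=> s /andP[_ s1]; have pos : 0 < 1 - s by rewrite subr_gt0.
  have h1 : is_derive s 1 (fun s : R => 1 - s) (-1).
    by apply: is_derive_eq; ring.
  have h2 := is_derive1_sqrt pos.
  have h3 : is_derive s 1 (fun s : R => Num.sqrt (1 - s)) ((2 * Num.sqrt (1 - s))^-1 * -1).
    exact: (@is_derive1_comp _ Num.sqrt (fun s => 1 - s)).
  have sn0 : Num.sqrt (1 - s) != 0 by rewrite gt_eqF// sqrtr_gt0.
  by apply: is_derive_eq; rewrite /GRing.scale/=; field.
- move=> s /andP[_ s1]; apply: cvgV; first by rewrite gt_eqF// sqrtr_gt0 subr_gt0.
  apply: (continuous_comp (f := fun s : R => 1 - s) (g := @Num.sqrt R)); last exact: sqrt_continuous.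
  by apply: cvgB; [exact: cvg_cst|exact: cvg_id].
- by move=> s _; rewrite invr_ge0 sqrtr_ge0.
- exact: cvg_at_right_filter (cG y).
- exact: cvg_at_left_filter (cG 1).
Qed.

(** The integrand may be singular at both ends. Around [y] it agrees with its composition with the
    clipping to [[a, b]], which is continuous on the line and has a primitive; the tail beyond [b]
    is a constant. *)
Lemma tail_integral_derive (g : R -> R) (y : R) :
  (forall s, 0 < s < 1 -> {for s, continuous g}) -> (forall s, 0 <= g s) ->
  (\int[mu]_(s in `]0%R, 1%R[) (g s)%:E < +oo)%E -> 0 < y < 1 ->
  is_derive y 1 (fun y => fine (\int[mu]_(s in `]y, 1%R[) (g s)%:E)) (- g y).
Proof.
move=> cg g0 gfin /andP[y0 y1].
pose a := y / 2; pose b := (y + 1) / 2.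
have [a0 ay yb b1] : [/\ 0 < a, a < y, y < b & b < 1] by rewrite /a /b; split; lra.
pose clip s := Num.min (Num.max s a) b.
have clip01 s : 0 < clip s < 1.
  by rewrite /clip lt_min gt_min lt_max a0 orbT b1 orbT/= (lt_trans y0).
have cgc : continuous (fun s => g (clip s)).
  move=> s; apply: (continuous_comp (f := clip)); last exact: cg.
  apply: (continuous_min (f := fun s : R => Num.max s a) (g := cst b)); last exact: cvg_cst.
  by apply: (continuous_max (f := id) (g := cst a)); [exact: cvg_id|exact: cvg_cst].
have [G dG] := antiderivative cgc.
have clipE s : a <= s <= b -> clip s = s.
  by move=> /andP[h1 h2]; rewrite /clip max_l// min_l.
have mg (u v : R) : 0 <= u -> v <= 1 -> measurable_fun `]u, v[ g.
  move=> u0 v1; apply: open_continuous_measurable_fun; first exact: interval_open.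
  move=> s; rewrite inE/= in_itv/= => /andP[us sv]; apply: cg.
  by rewrite (le_lt_trans u0 us) (lt_le_trans sv v1).
have mgc (u : R) : 0 <= u -> measurable_fun `]u, 1[ (fun s => (g s)%:E).
  by move=> u0; apply/measurable_EFinP; exact: mg.
have tailE (s : R) : a < s < b ->
    fine (\int[mu]_(s in `]s, 1%R[) (g s)%:E) =
    G b - G s + fine (\int[mu]_(s in `]b, 1%R[) (g s)%:E).
  move=> /andP[as_ sb].
  have s0 : 0 <= s by rewrite ltW// (lt_trans a0).
  have -> : `]s, 1[%classic = `]s, b] `|` `]b, 1[ :> set R.
    by rewrite -itv_bndbnd_setU// bnd_simp ltW.
  rewrite ge0_integral_setU//; last 3 first.
  - by rewrite -itv_bndbnd_setU ?bnd_simp ?(ltW sb)// ?(ltW b1)//; exact: mgc.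
  - by move=> r _; rewrite lee_fin.
  - apply/disj_setPS => r [] /=; rewrite !in_itv/= => /andP[_ h1] /andP[h2 _].
    by move: (le_lt_trans h1 h2); rewrite ltxx.
  have -> : (\int[mu]_(r in `]s, b]) (g r)%:E = (G b - G s)%:E)%E.
    rewrite integral_itv_bndoo; last by apply/measurable_EFinP; apply: mg => //; exact: ltW.
    rewrite -(ge0_FTC2_continuous sb dG cgc); last by move=> r; exact: g0.
    apply: eq_integral => r; rewrite inE/= in_itv/= => /andP[sr rb].
    by rewrite clipE// (ltW rb) andbT ltW// (lt_trans as_).
  rewrite fineD//; rewrite ge0_fin_numE; last by apply: integral_ge0 => r _; rewrite lee_fin.
  apply: le_lt_trans gfin; apply: ge0_subset_integral_nonmeas.
    by move=> r _; rewrite lee_fin.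
  move=> r /=; rewrite !in_itv/= => /andP[br ->]; rewrite andbT.
  by rewrite (lt_trans _ br)// (lt_trans y0).
apply: (@near_eq_is_derive _ _ R^o (fun s => G b - G s + fine (\int[mu]_(s in `]b, 1%R[) (g s)%:E))).
  have nab : \forall s \near y, a < s < b.
    have := near_in_itvoo; move=> /(_ R a b y); rewrite in_itv/= ay yb => /(_ isT).
    by apply: filterS => s; rewrite in_itv.
  by apply: filterS nab => s sab; exact/esym/tailE.
have := dG y; rewrite clipE ?(ltW ay) ?(ltW yb)// => h.
by apply: is_derive_eq; ring.
Unshelve. all: by end_near. Qed.

Lemma star_slope_integral_le (k : R) : 0 < k -> exists2 M, 0 < M &
  forall y : R, 0 <= y < 1 ->
  (\int[mu]_(s in `]y, 1%R[) (star_slope k s)%:E <= (M * Num.sqrt (1 - y))%:E)%E.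
Proof.
move=> k0; have [M M0 HM] := star_slope_le k0.
exists (M * 2) => [|y /andP[y0 y1]]; first by rewrite mulr_gt0.
rewrite -mulrA EFinM -integral_invsqrt// -ge0_integralZl_EFin ?(ltW M0)//; last first.
  apply/measurable_EFinP; apply: open_continuous_measurable_fun; first exact: interval_open.
  move=> s; rewrite inE/= in_itv/= => /andP[_ s1].
  apply: cvgV; first by rewrite gt_eqF// sqrtr_gt0 subr_gt0.
  apply: (continuous_comp (f := fun s : R => 1 - s) (g := @Num.sqrt R)); last exact: sqrt_continuous.
  by apply: cvgB; [exact: cvg_cst|exact: cvg_id].
apply: ge0_le_integral_nonmeas => s; first by rewrite lee_fin star_slope_ge0.
rewrite /= in_itv/= => /andP[ys s1]; rewrite -EFinM lee_fin HM//.
by rewrite (le_lt_trans y0 ys).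
Qed.

Lemma star_profile_is_profile (alpha beta t : R) (k := beta - alpha + 1) : 0 < k -> 0 < t ->
  is_profile t (fun y => t * star_profile alpha beta (y / t)) (fun y => star_slope k (y / t)) /\
  exists M, forall y, 0 < y < t -> t * star_profile alpha beta (y / t) <= M.
Proof.
move=> k0 t0; have [M M0 HM] := star_slope_integral_le k0.
have P0 y : 0 <= star_profile alpha beta y.
  by apply: fine_ge0; apply: integral_ge0 => s _; rewrite lee_fin star_slope_ge0.
have Ifin y : 0 <= y < 1 -> (\int[mu]_(s in `]y, 1%R[) (star_slope k s)%:E)%E \is a fin_num.
  move=> y01; rewrite ge0_fin_numE; last by apply: integral_ge0 => s _; rewrite lee_fin star_slope_ge0.
  by apply: le_lt_trans (HM _ y01) _; rewrite ltry.
have PM y : 0 <= y < 1 -> star_profile alpha beta y <= M * Num.sqrt (1 - y).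
  by move=> y01; rewrite -lee_fin /star_profile /Rintegral fineK; [exact: HM|exact: Ifin].
have scale y : 0 < y < t -> 0 < y / t < 1.
  by move=> /andP[y0 yt]; rewrite divr_gt0//= ltr_pdivrMr// mul1r.
split; last first.
  exists (t * M) => y /scale /andP[y0 y1]; rewrite ler_pM2l//.
  apply: (le_trans (PM _ _)); first by rewrite (ltW y0).
  rewrite -[leRHS]mulr1 ler_pM2l// -[leRHS]sqrtr1; apply: ler_wsqrtr; lra.
split.
- move=> y yt; have h1 := tail_integral_derive (fun s => @continuous_star_slope k s k0)
    (star_slope_ge0 k) _ (scale y yt).
  have {}h1 : is_derive (y / t) 1 (star_profile alpha beta) (- star_slope k (y / t)).
    apply: h1; apply: le_lt_trans (HM 0 _) _; first by rewrite lexx ltr01.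
    by rewrite ltry.
  have h2 : is_derive y 1 (fun y : R => y / t) t^-1.
    by apply: is_derive_eq; rewrite /GRing.scale/=; ring.
  have h3 : is_derive y 1 (fun y : R => star_profile alpha beta (y / t)) (- star_slope k (y / t) * t^-1).
    exact: (@is_derive1_comp _ (star_profile alpha beta) (fun y => y / t)).
  by apply: is_derive_eq; rewrite /GRing.scale/=; field; rewrite gt_eqF.
- move=> y yt; apply: (continuous_comp (f := fun y : R => y / t) (g := star_slope k)).
    by apply: cvgMl; exact: cvg_id.
  exact: continuous_star_slope k0 (scale _ yt).
- by move=> y _; exact: star_slope_ge0.
- move=> y yt; have /andP[y0 y1] := scale _ yt; rewrite mulr_gt0//.
  (* The slope is at least its numerator, which is increasing: this bounds the tail integral from
     below by a positive rectangle. *)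
  apply: (@lt_le_trans _ _ ((y / t) `^ k * (1 - y / t))).
    by rewrite mulr_gt0 ?powR_gt0// subr_gt0.
  rewrite -lee_fin /star_profile /Rintegral fineK; last by apply: Ifin; rewrite ltW.
  have -> : (((y / t) `^ k * (1 - y / t))%:E = \int[mu]_(s in `](y / t)%R, 1%R[) ((y / t) `^ k)%:E)%E.
    rewrite integral_cst//= EFinM; congr (_ * _)%E.
    have := lebesgue_measure_itv (R := R) `](y / t), 1[; rewrite /= lte_fin y1 => ->.
    by rewrite EFinB.
  apply: ge0_le_integral_nonmeas => s; first by rewrite lee_fin powR_ge0.
  rewrite /= in_itv/= => /andP[ys s1]; rewrite lee_fin.
  have s0 : 0 < s by exact: lt_trans ys.
  apply: (@le_trans _ _ (s `^ k)).
    by apply: ge0_ler_powR; rewrite ?nnegrE ?(ltW k0)// ltW.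
  have pos : 0 < 1 - s `^ (2 * k) by rewrite subr_gt0 powR_lt1 ?s1 ?(ltW s0)//; lra.
  rewrite ler_pdivlMr ?sqrtr_gt0// ler_piMr ?powR_ge0// -[leRHS]sqrtr1.
  apply: ler_wsqrtr; have := powR_ge0 s (2 * k); lra.
- split.
    rewrite divff ?gt_eqF// /star_profile /Rintegral set_itv_ge ?bnd_simp ?ltxx//.
    by rewrite integral_set0 mulr0.
  have c : (fun y : R => t * (M * Num.sqrt (1 - y / t))) @ t^'- --> 0.
    have c1 : {for t, continuous (fun y : R => t * (M * Num.sqrt (1 - y / t)))}.
      apply: cvgMr; apply: cvgMr.
      apply: (continuous_comp (f := fun y : R => 1 - y / t) (g := @Num.sqrt R)); last exact: sqrt_continuous.
      by apply: cvgB; [exact: cvg_cst|apply: cvgMl; exact: cvg_id].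
    have := cvg_at_left_filter c1.
    by rewrite divff ?gt_eqF// subrr sqrtr0 !mulr0.
  apply: (squeeze_cvgr _ (cvg_cst 0) c); near=> y.
  have yt : 0 < y < t.
    by apply/andP; split; near: y; [exact: nbhs_left_gt|exact: nbhs_left_lt].
  rewrite mulr_ge0 ?(ltW t0)//= ler_pM2l// PM//.
  by have /andP[/ltW -> ->] := scale _ yt.
Unshelve. all: by end_near. Qed.

End star_profile.

(** * Area and perimeter of the dilated star *)

Section star_region.
Context {R : realType}.
Local Notation mu := (@lebesgue_measure R).

Lemma powR_double (x a : R) : x `^ (2 * a) = (x `^ a) ^+ 2.
Proof. by rewrite mulrC powRrM powR_mulrn// powR_ge0. Qed.

Lemma dilate_Omega_star (alpha beta t : R) : 0 < t ->
  dilate t (Omega_star alpha beta) =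
  graph_region t (fun y => t * star_profile alpha beta (y / t)).
Proof.
move=> t0; apply/seteqP; split=> p.
  move=> [q [q1 /andP[q2 q3]] <-]; rewrite /graph_region/= /GRing.scale/=.
  rewrite (mulrC t q.2) mulfK ?gt_eqF// normrM (gtr0_norm t0) ltr_pM2l//; split => //.
  by rewrite mulr_gt0//= -[ltRHS]mul1r ltr_pM2r.
move=> [h /andP[p0 pt]]; exists (t^-1 *: p); last by rewrite scalerA mulfV ?gt_eqF// scale1r.
have ti : 0 < t^-1 by rewrite invr_gt0.
rewrite /Omega_star/= /GRing.scale/=; split.
  by rewrite normrM (gtr0_norm ti) mulrC ltr_pdivrMr// mulrC (mulrC t^-1).
by rewrite mulr_gt0//= mulrC ltr_pdivrMr// mul1r.
Qed.

Section integrals.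
Variables (alpha beta t : R).
Hypotheses (a0 : 0 <= alpha) (ab : alpha < beta + 1) (t0 : 0 < t).
Let k := beta - alpha + 1.
(** The horizontal component of the unit normal at height [y]; the vertical one is [(y/t)^k]. *)
Let sigma (y : R) := Num.sqrt (1 - ((y / t) `^ k) ^+ 2).
Let phi (y : R) := star_slope k (y / t).

Let k0 : 0 < k. Proof. by move: ab; rewrite /k => h; lra. Qed.
Let b1 : 0 < beta + 1. Proof. exact: le_lt_trans ab. Qed.
Let a1 : 0 < alpha + 1. Proof. by move: a0 => h; lra. Qed.

Let mpow (a : R) D : measurable_fun D (fun y : R => y `^ a).
Proof. by apply: measurable_funTS; exact: measurable_powR. Qed.

Let msqrt : measurable_fun setT (@Num.sqrt R).
Proof. by apply: continuous_measurable_fun; exact: sqrt_continuous. Qed.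

Let mb : measurable_fun setT (fun y : R => (y / t) `^ k).
Proof.
apply: (measurableT_comp (f := fun x : R => x `^ k) (g := fun y : R => y / t)); first exact: mpow.
by apply: measurable_funM => //; exact: measurable_id.
Qed.

Let msigma D : measurable_fun D sigma.
Proof.
apply: measurable_funTS; apply: (measurableT_comp msqrt).
by apply: measurable_funB => //; exact: measurable_funX.
Qed.

Let scale (y : R) : 0 < y < t -> 0 < y / t < 1.
Proof. by move=> /andP[y0 yt]; rewrite divr_gt0//= ltr_pdivrMr// mul1r. Qed.

Let mphi : measurable_fun `]0, t[ phi.
Proof.
by have [FP _] := star_profile_is_profile k0 t0; exact: measurable_slope FP.
Qed.

Let sigma_gt0 (y : R) : 0 < y < t -> 0 < sigma y.
Proof.
move=> /scale /andP[y0 y1]; rewrite sqrtr_gt0 subr_gt0 expr_lt1// ?powR_ge0//.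
by apply: powR_lt1; rewrite // y1 ltW.
Qed.

Let sigma_le1 (y : R) : sigma y <= 1.
Proof. by rewrite -[leRHS]sqrtr1; apply: ler_wsqrtr; rewrite gerBl sqr_ge0. Qed.

Let phiE (y : R) : phi y = (y / t) `^ k / sigma y.
Proof. by rewrite /phi /star_slope powR_double. Qed.

(** The area of the dilated star is a multiple of [I2], and its perimeter integrand splits into
    those of [I1] and [I2]. As [I1] is [kappa] up to scaling, one relation between the two integrals
    expresses everything by [kappa]. *)
Let I1 := (\int[mu]_(y in `]0%R, t[) (y `^ alpha * sigma y)%:E)%E.
Let I2 := (\int[mu]_(y in `]0%R, t[) (y `^ (beta + 1) * phi y)%:E)%E.

Lemma lebesgue_itv01 : mu `]0, 1[%classic = 1%E.
Proof. by have := lebesgue_measure_itv (R := R) `]0, 1[; rewrite /= lte_fin ltr01 oppr0 adde0. Qed.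

Lemma kappa_fin : (0 < kappa alpha beta)%E /\ kappa alpha beta \is a fin_num.
Proof.
have e0 : 0 <= (alpha + 1) / k by rewrite divr_ge0// ltW.
split; last first.
  rewrite ge0_fin_numE; last first.
    by apply: integral_ge0 => r _; rewrite lee_fin divr_ge0 ?powR_ge0 ?(ltW a1).
  apply: (@le_lt_trans _ _ (\int[mu]_(r in `]0%R, 1%R[) ((alpha + 1)^-1)%:E)%E); last first.
    by rewrite integral_cst//= lebesgue_itv01 mule1 ltry.
  apply: ge0_le_integral_nonmeas => r; first by rewrite lee_fin divr_ge0 ?powR_ge0 ?(ltW a1).
  move=> _; rewrite lee_fin -[leRHS]mul1r ler_pM2r ?invr_gt0//.
  apply: powR_le1 => //; rewrite sqrtr_ge0/= -[leRHS]sqrtr1; apply: ler_wsqrtr.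
  by rewrite gerBl sqr_ge0.
pose c := Num.sqrt (1 - 2^-1 ^+ 2) `^ ((alpha + 1) / k) / (alpha + 1).
have c0 : 0 < c by rewrite divr_gt0// powR_gt0// sqrtr_gt0; lra.
apply: (@lt_le_trans _ _ (\int[mu]_(r in `]0%R, 2^-1%R[) c%:E)%E).
  rewrite integral_cst//=.
  have := lebesgue_measure_itv (R := R) `]0, 2^-1[; rewrite /= lte_fin invr_gt0 ltr0n => ->.
  by rewrite oppr0 adde0 -EFinM lte_fin mulr_gt0// invr_gt0.
apply: (@le_trans _ _ (\int[mu]_(r in `]0%R, 2^-1%R[)
     (Num.sqrt (1 - r ^+ 2) `^ ((alpha + 1) / k) / (alpha + 1))%:E)%E).
  apply: ge0_le_integral_nonmeas => r; first by rewrite lee_fin ltW.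
  rewrite /= in_itv/= => /andP[r0 r1]; rewrite lee_fin ler_pM2r ?invr_gt0//.
  apply: ge0_ler_powR; rewrite ?nnegrE ?sqrtr_ge0//.
  by apply: ler_wsqrtr; rewrite lerD2l lerN2 ler_sqr ?nnegrE ?(ltW r0) ?(ltW r1)// invr_ge0.
apply: ge0_subset_integral_nonmeas => r.
  by rewrite lee_fin divr_ge0 ?powR_ge0 ?(ltW a1).
by rewrite /= !in_itv/= => /andP[-> h]/=; lra.
Qed.

(** In the layer-cake formula the layer at [r] is exactly []0, t s^(1/k)[]: the comparison of layers
    is an equality for this arc. *)
Let I1E : I1 = ((t `^ (alpha + 1))%:E * kappa alpha beta)%E.
Proof.
rewrite /I1 (@layer_cake R _ (fun y => y `^ alpha) (fun y => (y / t) `^ k) (measurable_itv _)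
  (@mpow _ _) (fun y => powR_ge0 _ _) mb).
rewrite /kappa -ge0_integralZl_EFin ?powR_ge0//; first last.
- apply/measurable_EFinP; apply: measurable_funTS; apply: measurable_funM => //.
  apply: (measurableT_comp (f := fun x : R => x `^ ((alpha + 1) / k))); first exact: mpow.
  apply: (measurableT_comp msqrt); apply: measurable_funB => //.
- by move=> r _; rewrite lee_fin divr_ge0 ?powR_ge0// ltW.
apply: eq_integral => r; rewrite inE/= in_itv/= => /andP[r0 r1].
have r2 : 0 < r ^+ 2 < 1 by rewrite exprn_gt0//= expr_lt1// ltW.
set s := Num.sqrt (1 - r ^+ 2).
have s2 : s ^+ 2 = 1 - r ^+ 2 by rewrite sqr_sqrtr//; lra.
have s01 : 0 < s < 1.
  rewrite sqrtr_gt0 -[X in _ && (_ < X)]sqrtr1 ltr_sqrt//; lra.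
have /andP[s0 s1] := s01.
have ki : 0 < k^-1 by rewrite invr_gt0.
have q0 : 0 < s `^ k^-1 by exact: powR_gt0.
have q1 : s `^ k^-1 < 1 by apply: powR_lt1; rewrite // s1 ltW.
have -> : `]0, t[ `&` [set y | ((y / t) `^ k) ^+ 2 < 1 - r ^+ 2] = `]0, (t * s `^ k^-1)[%classic.
  have E y : 0 < y -> (((y / t) `^ k) ^+ 2 < 1 - r ^+ 2) = (y < t * s `^ k^-1).
    move=> y0; rewrite -s2 ltr_sqr ?nnegrE ?powR_ge0 ?(ltW s0)//.
    rewrite (mulrC t) -ltr_pdivrMr//.
    have {1}-> : s = (s `^ k^-1) `^ k by rewrite -powRrM mulVf ?gt_eqF// powRr1// ltW.
    have yt0 : 0 < y / t by rewrite divr_gt0.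
    apply/idP/idP => [|h]; last by apply: gt0_ltr_powR; rewrite // ?nnegrE ltW.
    by apply: contraLR; rewrite -!leNgt => h; apply: ge0_ler_powR; rewrite // ?nnegrE ltW.
  apply/seteqP; split=> y /=; rewrite !in_itv/=.
    by move=> [/andP[y0 _]]; rewrite E// y0.
  move=> /andP[y0 yq]; rewrite E// y0 yq; split => //=.
  by apply: (lt_trans yq); rewrite gtr_pMr.
rewrite integral_powR//; last by rewrite mulr_ge0 ?ltW.
rewrite (powR0 (lt0r_neq0 a1)) subr0 -EFinM powRM ?(ltW t0) ?(ltW q0)// -powRrM mulrA.
by rewrite (mulrC k^-1).
Qed.

(** Adding the integral [X] of [(alpha+1) y^alpha (1 - sigma)] makes both sides equal to
    [t^(alpha+1)]: on the right the integrand becomes [(alpha+1) y^alpha], on the left the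
    derivative of [y^(alpha+1) (1 - sigma)]. *)
Let identity : ((k * t `^ (- k))%:E * I2 = (alpha + 1)%:E * I1)%E.
Proof.
pose X := (\int[mu]_(y in `]0%R, t[) ((alpha + 1) * y `^ alpha * (1 - sigma y))%:E)%E.
have X0 y : 0 <= (alpha + 1) * y `^ alpha * (1 - sigma y).
  by rewrite !mulr_ge0 ?powR_ge0 ?(ltW a1)// subr_ge0.
have mX : measurable_fun `]0, t[ (fun y => (alpha + 1) * y `^ alpha * (1 - sigma y)).
  by apply: measurable_funM; [exact: measurable_funM|exact: measurable_funB].
have m1 : measurable_fun `]0, t[ (fun y => y `^ alpha * sigma y) by exact: measurable_funM.
have m2 : measurable_fun `]0, t[ (fun y => y `^ (beta + 1) * phi y) by exact: (measurable_funM (@mpow _ _) mphi).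
have f1 y : 0 <= y `^ alpha * sigma y by rewrite mulr_ge0 ?powR_ge0 ?sqrtr_ge0.
have f2 y : 0 <= y `^ (beta + 1) * phi y by rewrite mulr_ge0 ?powR_ge0 ?star_slope_ge0.
have h1 : (X + (alpha + 1)%:E * I1 = (t `^ (alpha + 1))%:E)%E.
  rewrite /I1 -ge0_integralZl_EFin ?(ltW a1)//; last 2 first.
  - by move=> y _; rewrite lee_fin.
  - exact/measurable_EFinP.
  rewrite /X -ge0_integralD//; first last.
  - by apply/measurable_EFinP; exact: measurable_funM.
  - by move=> y _; rewrite -EFinM lee_fin mulr_ge0// ltW.
  - exact/measurable_EFinP.
  - by move=> y _; rewrite lee_fin.
  transitivity ((alpha + 1)%:E * \int[mu]_(y in `]0%R, t[) (y `^ alpha)%:E)%E.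
    rewrite -ge0_integralZl_EFin ?(ltW a1)//; last 2 first.
    - by move=> y _; rewrite lee_fin powR_ge0.
    - by apply/measurable_EFinP; exact: mpow.
    by apply: eq_integral => y _; rewrite -!EFinM -EFinD; congr (_%:E); ring.
  rewrite integral_powR ?(ltW t0)// (powR0 (lt0r_neq0 a1)) subr0 -EFinM; congr (_%:E).
  by field; rewrite gt_eqF.
have kt0 : 0 <= k * t `^ (- k) by rewrite mulr_ge0 ?powR_ge0// ltW.
have h2 : (X + (k * t `^ (- k))%:E * I2 = (t `^ (alpha + 1))%:E)%E.
  rewrite /I2 -ge0_integralZl_EFin//; last 2 first.
  - by move=> y _; rewrite lee_fin.
  - exact/measurable_EFinP.
  rewrite /X -ge0_integralD//; first last.
  - by apply/measurable_EFinP; exact: measurable_funM.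
  - by move=> y _; rewrite -EFinM lee_fin mulr_ge0.
  - exact/measurable_EFinP.
  - by move=> y _; rewrite lee_fin.
  pose G (y : R) := y `^ (alpha + 1) - y `^ (alpha + 1) * sigma y.
  have -> : t `^ (alpha + 1) = G t - G 0.
    rewrite /G (powR0 (lt0r_neq0 a1)) mul0r /sigma divff ?gt_eqF// powR1 expr1n subrr sqrtr0.
    by ring.
  pose g (y : R) := (alpha + 1) * y `^ alpha * (1 - sigma y) +
       k * t `^ (- k) * (y `^ (beta + 1) * phi y).
  transitivity (\int[mu]_(y in `]0%R, t[) (g y)%:E)%E.
    by apply: eq_integral => y _; rewrite /g EFinD EFinM.
  have dG (y : R) : 0 < y < t -> is_derive y 1 G (g y).
    move=> yt; have /andP[y0 _] := yt; have s0 := sigma_gt0 yt.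
    have yt0 : 0 < y / t by rewrite divr_gt0.
    have d1 : is_derive y 1 (fun y : R => y `^ (alpha + 1)) ((alpha + 1) * y `^ alpha).
      by have := is_derive1_powR (alpha + 1) y0; rewrite addrK.
    have d2 : is_derive y 1 (fun y : R => y / t) t^-1.
      by apply: is_derive_eq; rewrite /GRing.scale/=; ring.
    have d3 : is_derive y 1 (fun y : R => (y / t) `^ k) (k * (y / t) `^ (k - 1) * t^-1).
      exact: (@is_derive1_comp _ (fun x : R => x `^ k) (fun y : R => y / t) y _ _ (is_derive1_powR k yt0) d2).
    have d4 : is_derive y 1 (fun y : R => 1 - ((y / t) `^ k) ^+ 2)
        (- (2 * (y / t) `^ k * (k * (y / t) `^ (k - 1) * t^-1))).
      by apply: is_derive_eq; rewrite /GRing.scale/=; ring.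
    have pos : 0 < 1 - ((y / t) `^ k) ^+ 2 by rewrite -sqrtr_gt0.
    have d5 : is_derive y 1 sigma ((2 * sigma y)^-1 *
        - (2 * (y / t) `^ k * (k * (y / t) `^ (k - 1) * t^-1))).
      exact: (@is_derive1_comp _ Num.sqrt (fun y : R => 1 - ((y / t) `^ k) ^+ 2) y _ _ (is_derive1_sqrt pos) d4).
    apply: is_derive_eq; rewrite /g phiE /GRing.scale/=.
    have e1 : y `^ (alpha + 1) = y `^ alpha * y.
      by rewrite powR_add_gt0// powRr1// ltW.
    have e2 : (y / t) `^ (k - 1) = (y / t) `^ k * (t / y).
      rewrite powR_add_gt0// powR_inv1 ?(ltW yt0)//; congr (_ * _).
      by rewrite invf_div.
    have e3 : y `^ (beta + 1) = y `^ alpha * (y / t) `^ k * t `^ k.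
      rewrite -mulrA -powRM ?(ltW yt0) ?(ltW t0)// divfK ?gt_eqF// -powR_add_gt0//.
      by congr (_ `^ _); rewrite /k; ring.
    rewrite e1 e2 e3 powRN; field; rewrite !gt_eqF// powR_gt0//.
  apply: (@ge0_FTC2_oo R G g 0 t).
  - exact: t0.
  - move=> y yt; have /andP[y0 _] := yt.
    have cp a := derive_continuous (is_derive1_powR a y0).
    have cs : {for y, continuous sigma}.
      apply: (continuous_comp (f := fun y : R => 1 - ((y / t) `^ k) ^+ 2) (g := @Num.sqrt R)); last exact: sqrt_continuous.
      have ck : {for y, continuous (fun y : R => (y / t) `^ k)}.
        apply: (continuous_comp (f := fun y : R => y / t) (g := fun x : R => x `^ k)).
          by apply: cvgMl; exact: cvg_id.
        by apply: derive_continuous (is_derive1_powR k _); rewrite divr_gt0.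
      by apply: cvgB; [exact: cvg_cst|rewrite expr2; exact: cvgM].
    have cf : {for y, continuous phi}.
      apply: (continuous_comp (f := fun y : R => y / t) (g := star_slope k)).
        by apply: cvgMl; exact: cvg_id.
      exact: continuous_star_slope k0 (scale yt).
    apply: cvgD; apply: cvgM.
    + by apply: cvgMr; exact: cp.
    + by apply: cvgB; [exact: cvg_cst|exact: cs].
    + exact: cvg_cst.
    + by apply: cvgM; [exact: cp|exact: cf].
  - by move=> y _; rewrite /g addr_ge0// mulr_ge0.
  - have cp : y `^ (alpha + 1) @[y --> 0^'+] --> (0 : R).
      by have := cvg_powR_at (ltW a1) (lexx (0 : R)); rewrite powR0 ?gt_eqF.
    have -> : G 0 = 0 by rewrite /G powR0 ?gt_eqF// mul0r subrr.
    apply: (squeeze_cvgr _ (cvg_cst 0) cp); near=> y.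
    by rewrite /G subr_ge0 ler_piMr ?powR_ge0// gerBl mulr_ge0 ?powR_ge0// sqrtr_ge0.
  - have cG : {for t, continuous G}.
      have cp := derive_continuous (is_derive1_powR (alpha + 1) t0).
      have cs : {for t, continuous sigma}.
        apply: (continuous_comp (f := fun y : R => 1 - ((y / t) `^ k) ^+ 2) (g := @Num.sqrt R)); last exact: sqrt_continuous.
        have ck : {for t, continuous (fun y : R => (y / t) `^ k)}.
          apply: (continuous_comp (f := fun y : R => y / t) (g := fun x : R => x `^ k)).
            by apply: cvgMl; exact: cvg_id.
          by apply: derive_continuous (is_derive1_powR k _); rewrite divr_gt0.
        by apply: cvgB; [exact: cvg_cst|rewrite expr2; exact: cvgM].
      by apply: cvgB; [exact: cp|exact: cvgM].
    exact: cvg_at_left_filter cG.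
have Xfin : X \is a fin_num.
  have I10 : (0 <= (alpha + 1)%:E * I1)%E.
    by apply: mule_ge0; [rewrite lee_fin ltW|apply: integral_ge0 => y _; rewrite lee_fin].
  rewrite ge0_fin_numE; last by apply: integral_ge0 => y _; rewrite lee_fin.
  by apply: (@le_lt_trans _ _ (t `^ (alpha + 1))%:E); [rewrite -h1 leeDl|rewrite ltry].
have E : ((k * t `^ (- k))%:E * I2 + X = (alpha + 1)%:E * I1 + X)%E.
  by rewrite addeC h2 -h1 addeC.
by rewrite -[LHS](addeK _ Xfin) E addeK.
Unshelve. all: by end_near. Qed.

(** Integrating [s^beta] along the two columns attached to the height [y] gives
    [2 y^(beta+1) / (beta+1)], so the area is [2 / (beta+1)] times [I2]. *)
Lemma star_area : weighted_area beta (dilate t (Omega_star alpha beta)) =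
  ((2 * (alpha + 1) / (k * (beta + 1)) * t `^ (beta + 2) * fine (kappa alpha beta))%:E)%E.
Proof.
have [FP _] := star_profile_is_profile k0 t0.
have [kp kf] := kappa_fin.
rewrite dilate_Omega_star// /weighted_area.
rewrite (graph_integral_columns FP (hy := fun p => p.2 `^ beta)); last 3 first.
- by apply: (measurable_fun_snd1 (f := fun y => y `^ beta)); exact: mpow.
- by move=> y; exact: (@cst_continuous _ _ (y `^ beta)).
- by move=> p; exact: powR_ge0.
transitivity ((2 / (beta + 1))%:E * I2)%E.
  rewrite /I2 -ge0_integralZl_EFin ?divr_ge0 ?(ltW b1)//; last 2 first.
  - by move=> y _; rewrite lee_fin mulr_ge0 ?powR_ge0 ?star_slope_ge0.
  - by apply/measurable_EFinP; exact: (measurable_funM (@mpow _ _) mphi).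
  apply: eq_integral => y; rewrite inE/= in_itv/= => /andP[y0 _].
  under eq_integral do rewrite -mulr2n mulrnAr -mulrnAl EFinM.
  rewrite ge0_integralZl_EFin ?mulrn_wge0 ?star_slope_ge0//; last 2 first.
  - by move=> s _; rewrite lee_fin powR_ge0.
  - by apply/measurable_EFinP; exact: mpow.
  rewrite integral_powR ?(ltW y0)// (powR0 (lt0r_neq0 b1)) subr0 -!EFinM; congr (_%:E).
  by rewrite mulr2n -/(phi y); field; rewrite gt_eqF.
have tk : (t `^ k / k) * (k * t `^ (- k)) = 1.
  by rewrite powRN; field; rewrite !gt_eqF// powR_gt0.
have -> : I2 = ((t `^ k / k * (alpha + 1))%:E * I1)%E.
  by rewrite EFinM -muleA -identity muleA -EFinM tk mul1e.
rewrite I1E -(fineK kf) -!EFinM; congr (_%:E).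
have -> : t `^ (beta + 2) = t `^ k * t `^ (alpha + 1).
  by rewrite -powR_add_gt0//; congr (_ `^ _); rewrite /k; ring.
by rewrite /=; field; rewrite !gt_eqF.
Qed.

(** Since [sqrt (1 + phi^2) = 1 / sigma = sigma + (y/t)^(2k) / sigma], the boundary integral is
    [2 I1 + 2 t^(-k) I2]. An upper bound suffices: the opposite inequality will come from
    [cheeger_ge] applied to the star. *)
Lemma star_perimeter_le :
  (weighted_perimeter alpha (dilate t (Omega_star alpha beta)) <=
   ((beta + 1) * (beta + 2) / (alpha + 1) * t `^ (- k))%:E *
   weighted_area beta (dilate t (Omega_star alpha beta)))%E.
Proof.
have [FP [M FM]] := star_profile_is_profile k0 t0.
have [kp kf] := kappa_fin.
rewrite star_area dilate_Omega_star//.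
apply: (le_trans (graph_perimeter_le a0 t0 FP FM)).
have -> : (\int[mu]_(y in `]0%R, t[) (2 * (y `^ alpha * Num.sqrt (1 + star_slope k (y / t) ^+ 2)))%:E =
    2%:E * I1 + (2 * t `^ (- k))%:E * I2)%E.
  have m1 : measurable_fun `]0, t[ (fun y => y `^ alpha * sigma y) by exact: measurable_funM.
  have m2 : measurable_fun `]0, t[ (fun y => y `^ (beta + 1) * phi y) by exact: (measurable_funM (@mpow _ _) mphi).
  have f1 y : 0 <= y `^ alpha * sigma y by rewrite mulr_ge0 ?powR_ge0 ?sqrtr_ge0.
  have f2 y : 0 <= y `^ (beta + 1) * phi y by rewrite mulr_ge0 ?powR_ge0 ?star_slope_ge0.
  rewrite /I1 -ge0_integralZl_EFin//; last 2 first.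
  - by move=> y _; rewrite lee_fin.
  - exact/measurable_EFinP.
  have tk0 : 0 <= 2 * t `^ (- k) by rewrite mulr_ge0 ?powR_ge0.
  rewrite /I2 -ge0_integralZl_EFin//; last 2 first.
  - by move=> y _; rewrite lee_fin.
  - exact/measurable_EFinP.
  rewrite -ge0_integralD//; first last.
  - by apply/measurable_EFinP; exact: measurable_funM.
  - by move=> y _; rewrite -EFinM lee_fin mulr_ge0.
  - by apply/measurable_EFinP; exact: measurable_funM.
  - by move=> y _; rewrite -EFinM lee_fin mulr_ge0.
  apply: eq_integral => y; rewrite inE/= in_itv/= => yt; rewrite -!EFinM -EFinD; congr (_%:E).
  have /andP[y0 _] := yt; have s0 := sigma_gt0 yt.
  have pos : 0 < 1 - ((y / t) `^ k) ^+ 2 by rewrite -sqrtr_gt0.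
  have s2 : sigma y ^+ 2 = 1 - ((y / t) `^ k) ^+ 2 by rewrite sqr_sqrtr// ltW.
  rewrite -/(phi y) phiE.
  have -> : Num.sqrt (1 + ((y / t) `^ k / sigma y) ^+ 2) = (sigma y)^-1.
    rewrite -[RHS]ger0_norm ?invr_ge0 ?(ltW s0)// -sqrtr_sqr; congr Num.sqrt.
    rewrite exprVn expr_div_n s2; field; rewrite gt_eqF//.
  have e3 : y `^ (beta + 1) = y `^ alpha * (y / t) `^ k * t `^ k.
    have yt0 : 0 < y / t by rewrite divr_gt0.
    rewrite -mulrA -powRM ?(ltW yt0) ?(ltW t0)// divfK ?gt_eqF// -powR_add_gt0//.
    by congr (_ `^ _); rewrite /k; ring.
  have e4 : (sigma y)^-1 = sigma y + ((y / t) `^ k) ^+ 2 / sigma y.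
    rewrite -[X in X + _](mulfK (lt0r_neq0 s0)) -expr2 s2; field; rewrite gt_eqF//.
  rewrite [in LHS]e4 e3 powRN; field; rewrite !gt_eqF// powR_gt0//.
have tk : (t `^ k / k) * (k * t `^ (- k)) = 1.
  by rewrite powRN; field; rewrite !gt_eqF// powR_gt0.
have -> : I2 = ((t `^ k / k * (alpha + 1))%:E * I1)%E.
  by rewrite EFinM -muleA -identity muleA -EFinM tk mul1e.
rewrite I1E -(fineK kf) -!EFinM -EFinD lee_fin.
have -> : t `^ (beta + 2) = t `^ k * t `^ (alpha + 1).
  by rewrite -powR_add_gt0//; congr (_ `^ _); rewrite /k; ring.
rewrite /= powRN le_eqVlt; apply/orP; left; apply/eqP.
have tk0 : t `^ k != 0 by rewrite gt_eqF// powR_gt0.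
have kn0 : k != 0 by rewrite gt_eqF.
have -> : beta + 2 = k + (alpha + 1) by rewrite /k; ring.
by field; rewrite ?kn0 ?tk0 ?(gt_eqF a1) ?(gt_eqF b1).
Qed.

End integrals.

End star_region.

(** * Cheeger constants *)

Section cheeger.
Context {R : realType}.
Local Notation mu := (@lebesgue_measure R).
Local Notation mu2 := (lebesgue_measure2 R).

(** The Borel set is taken from outside because the constraint on test fields is pointwise: a field
    admissible for the larger set is admissible for [E]. The intersection with [Q] keeps the hull in
    the box. *)
Lemma borel_hull (E Q : set (R * R)) : lebesgue_measurable2 E -> measurable Q -> E `<=` Q ->
  exists B, [/\ measurable B, E `<=` B, B `<=` Q &
    forall f : R * R -> \bar R, measurable_fun setT f ->
      (\int[mu2]_(p in E) f p = \int[mu2]_(p in B) f p)%E].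
Proof.
move=> [A mA [N negN <-]] mQ EQ; have [M [mM M0 NM]] := negN.
exists (A `|` (M `&` Q)); split.
- by apply: measurableU => //; exact: measurableI.
- move=> p [Ap|Np]; [by left|right]; split; first exact: NM.
  by apply: EQ; right.
- by move=> p [Ap|[]] //; apply: EQ; left.
- move=> f mf; rewrite !integral_setU_negligible//.
  by exists M; split => // p [].
Qed.

Lemma measurable_divergence (alpha : R) (v : R * R -> R * R) : C1_0 v ->
  measurable_fun setT (divergence (fun q : R * R => q.2 `^ alpha *: v q)).
Proof.
move=> [c1 c2 cK KH]; set K := closure _ in cK KH.
have v0 p : ~ K p -> v p = 0.
  by move=> nK; apply/eqP/negPn/negP => h; apply: nK; exact: subset_closure.
have [w1x [_ [_ [cw1x _ _ d1x _]]]] := C1_weight alpha c1 cK KH (fun p nK => congr1 fst (v0 p nK)).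
have [_ [w2y [_ [_ cw2y _ _ d2y]]]] := C1_weight alpha c2 cK KH (fun p nK => congr1 snd (v0 p nK)).
rewrite (_ : divergence _ = fun p => w1x p + w2y p).
  by apply: measurable_funD; exact: continuous_measurable_fun2.
by apply/funext => p; have ? := d1x p; have ? := d2y p; congr (_ + _); exact: derive_val.
Qed.

Lemma weighted_perimeter_hull (alpha : R) (E B : set (R * R)) : E `<=` B ->
  (forall f : R * R -> \bar R, measurable_fun setT f ->
      (\int[mu2]_(p in E) f p = \int[mu2]_(p in B) f p)%E) ->
  (weighted_perimeter alpha B <= weighted_perimeter alpha E)%E.
Proof.
move=> EB intE; apply: ge_ereal_sup => _ [v [cv v1] <-]; apply: ereal_sup_ubound.
exists v; first by split => // p /EB; exact: v1.
by apply: intE; apply/measurable_EFinP; exact: measurable_divergence.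
Qed.

Lemma weighted_area_rectangle (beta a b c d : R) : 0 < beta + 1 -> a < b -> 0 <= c <= d ->
  weighted_area beta (`]a, b[%classic `*` `]c, d[%classic) =
  ((b - a) * ((d `^ (beta + 1) - c `^ (beta + 1)) / (beta + 1)))%:E.
Proof.
move=> b1 ab /andP[c0 cd]; rewrite /weighted_area.
have mf : measurable_fun setT (fun p : R * R => p.2 `^ beta).
  by apply: (measurable_fun_snd1 (f := fun y => y `^ beta)); exact: measurable_powR.
have mQ : measurable (`]a, b[%classic `*` `]c, d[%classic) by exact: measurableX.
rewrite (fubini_tonelli2_set mQ mf (fun p => powR_ge0 _ _)) EFinM -integral_powR//.
rewrite -ge0_integralZl_EFin ?subr_ge0 ?(ltW ab)//; last 2 first.
- by move=> y _; rewrite lee_fin powR_ge0.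
- by apply/measurable_EFinP; apply: measurable_funTS; exact: measurable_powR.
rewrite [RHS]integral_mkcond; apply: eq_integral => y _; rewrite /patch.
rewrite /= integral_cst; last exact: measurable_ysection.
case: ifPn => yD.
  rewrite in_ysectionX ?inE//; last by rewrite inE in yD.
  have := lebesgue_measure_itv (R := R) `]a, b[; rewrite /= lte_fin ab => ->.
  by rewrite muleC -EFinB.
by rewrite notin_ysectionX ?measure0 ?mule0.
Qed.

Lemma bounded_half_plane_box (Omega : set (R * R)) : bounded_set Omega -> Omega `<=` half_plane ->
  exists2 K, 0 < K & Omega `<=` `](- K), K[%classic `*` `]0, K[%classic.
Proof.
move=> [M [_ HM]] OH; pose K := Num.max (M + 1) 1 + 1.
exists K => [|z Oz]; first by rewrite ltr_pwDr// le_max ler01 orbT.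
have := HM (M + 1) _ z Oz; rewrite ltrDl ltr01 => /(_ isT)/=.
rewrite prod_normE ge_max => /andP[z1 z2].
have z10 : `|z.1| < K by apply: (le_lt_trans z1); rewrite ltr_pwDr// le_max lexx.
have z20 : `|z.2| < K by apply: (le_lt_trans z2); rewrite ltr_pwDr// le_max lexx.
have z2p : 0 < z.2 by exact: OH.
by split; rewrite /= in_itv/= ?z2p/=; [rewrite -ltr_norml|rewrite -(gtr0_norm z2p)].
Qed.

Lemma weighted_area_open (beta : R) (Omega : set (R * R)) : 0 < beta + 1 ->
  Omega !=set0 -> bounded_set Omega -> open Omega -> Omega `<=` half_plane ->
  exists2 a, 0 < a & weighted_area beta Omega = a%:E.
Proof.
move=> b1 [p Op] bO oO OH; have [K K0 OK] := bounded_half_plane_box bO OH.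
have hp (z : R * R) : (0 <= (z.2 `^ beta)%:E)%E by rewrite lee_fin powR_ge0.
have fin : (weighted_area beta Omega < +oo)%E.
  apply: (@le_lt_trans _ _ (weighted_area beta (`](- K)%R, K%R[%classic `*` `]0%R, K%R[%classic))).
    by apply: ge0_subset_integral_nonmeas => // z _.
  by rewrite weighted_area_rectangle ?ltry//; [lra|apply/andP; split; lra].
have pos : (0 < weighted_area beta Omega)%E.
  have /nbhs_ballP[e /= e0 he] : nbhs p Omega by exact: open_nbhs_nbhs.
  have p2 : 0 < p.2 by exact: OH.
  apply: (@lt_le_trans _ _ (weighted_area beta (`]p.1, (p.1 + e)[%classic `*` `]p.2, (p.2 + e)[%classic))).
    rewrite weighted_area_rectangle//; [|lra|by apply/andP; split; lra].
    rewrite lte_fin mulr_gt0//; first lra.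
    rewrite divr_gt0// subr_gt0; apply: gt0_ltr_powR; rewrite // ?nnegrE; lra.
  apply: ge0_subset_integral_nonmeas; first by move=> z _.
  move=> z [] /=; rewrite !in_itv/= => /andP[z1 z2] /andP[z3 z4]; apply: he; split;
    rewrite /ball/= ltr_norml; apply/andP; split; lra.
exists (fine (weighted_area beta Omega)); first by apply: fine_gt0; rewrite pos fin.
by rewrite fineK// ge0_fin_numE// ltW.
Qed.

(** * The Cheeger constant of sets and of the dilated star *)

Section bounds.
Variables (alpha beta t : R).
Hypotheses (a0 : 0 <= alpha) (ab : alpha < beta + 1) (b2a : beta <= 2 * alpha) (t0 : 0 < t).
Let k := beta - alpha + 1.
Let Star := dilate t (Omega_star alpha beta).
(** Equal to [(beta+1) t^(-k) (1 + k / (alpha+1))], the value at [rho = 1], the equality case of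
    [weighted_AMGM]; it is the ratio of perimeter to area of the dilated star. *)
Let Lam := (beta + 1) * (beta + 2) / (alpha + 1) * t `^ (- k).

(** With [tau = rho t] in the isoperimetric inequality, the quotient of [E] is bounded below by a
    multiple of [rho^(-k) + (k/m) rho^m], whose minimum gives [Lam]. *)
Lemma cheeger_ge (Omega : set (R * R)) : bounded_set Omega -> Omega `<=` half_plane ->
  (weighted_area beta Omega = weighted_area beta Star) -> (Lam%:E <= cheeger alpha beta Omega)%E.
Proof.
move=> bO OH areaE; apply: le_ereal_inf_tmp => _ [E [EO mE E0 Efin] <-].
have [K K0 OK] := bounded_half_plane_box bO OH.
have b1 : 0 < beta + 1 by exact: le_lt_trans ab.
have a1 : 0 < alpha + 1 by move: a0 => h; lra.
have k0 : 0 < k by move: ab; rewrite /k => h; lra.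
have [kap0 kapf] := kappa_fin a0 ab.
have EQ := subset_trans EO OK.
have [B [mB EB BQ intE]] := borel_hull mE (measurableX (measurable_itv _) (measurable_itv _)) EQ.
have areaB : weighted_area beta B = weighted_area beta E.
  rewrite /weighted_area intE//; apply/measurable_EFinP.
  by apply: (measurable_fun_snd1 (f := fun y => y `^ beta)); exact: measurable_powR.
have PB := @weighted_perimeter_hull alpha E B EB intE.
have aE : (weighted_area beta E <= weighted_area beta Star)%E.
  rewrite -areaE; apply: ge0_subset_integral_nonmeas => // z _.
  by rewrite lee_fin powR_ge0.
have BK p : B p -> `|p.1| < K /\ 0 < p.2 < K.
  by move=> /BQ []; rewrite /= !in_itv/= -ltr_norml.
have iso := weighted_isoperimetry a0 ab b2a K0 mB BK.
rewrite areaB in iso; have {iso} := iso E0.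
rewrite star_area// in aE.
move: E0 Efin aE; case: (weighted_area beta E) => [a| |]//.
rewrite lte_fin => aa _; rewrite lee_fin => aE.
rewrite inver gt_eqF//.
have ai : (0 < (a^-1)%:E :> \bar R)%E by rewrite lte_fin invr_gt0.
move=> iso; apply: (@le_trans _ _ (weighted_perimeter alpha B * (a^-1)%:E)%E); last first.
  by apply: lee_wpmul2r => //; exact: ltW.
case: iso => [->|[tau tau0 h]]; first by rewrite gt0_mulye// leey.
apply: (@le_trans _ _ (((Lam * a)%:E * (a^-1)%:E)%E)).
  by rewrite -EFinM lee_fin mulfK// gt_eqF.
apply: lee_wpmul2r; first exact: ltW.
apply: le_trans h; rewrite -(fineK kapf) -!EFinM -EFinD lee_fin.
set kap := fine _ in aE *; set m := alpha + 1.
have [rho rho0 tauE] : exists2 rho, 0 < rho & tau = rho * t.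
  by exists (tau / t); rewrite ?divr_gt0// divfK// gt_eqF.
have tE : t `^ (beta + 2) = t `^ k * t `^ m.
  by rewrite -powR_add_gt0//; congr (_ `^ _); rewrite /k /m; ring.
have tk0 : 0 < t `^ k by exact: powR_gt0.
have tkN : t `^ (- k) = (t `^ k)^-1 by rewrite powRN.
have h1 := @weighted_AMGM R rho k m rho0 k0 a1.
(* [kappa] is eliminated through the area of the star, with equality when [a] is that area; a
   smaller [a] only helps. *)
have h2 : k * (beta + 1) / m * a / t `^ k <= 2 * t `^ m * kap.
  rewrite tE -/m -/k in aE.
  rewrite ler_pdivrMr// mulrAC ler_pdivrMr//.
  have c0 : 0 < k * (beta + 1) by rewrite mulr_gt0.
  have := ler_wpM2l (ltW c0) aE; congr (_ <= _).
  by field; rewrite !gt_eqF.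
rewrite -/k tauE !powRM ?(ltW rho0) ?(ltW t0)//.
have h3 := ler_wpM2l (powR_ge0 rho m) h2.
have c1 : 0 <= t `^ (- k) * (beta + 1) * a.
  by rewrite !mulr_ge0 ?powR_ge0 ?ltW.
have h4 := ler_wpM2l c1 h1.
have e1 : Lam * a = t `^ (- k) * (beta + 1) * a * (1 + k / m).
  by rewrite /Lam /m /k; field; rewrite gt_eqF.
rewrite e1; apply: (le_trans h4).
apply: (@le_trans _ _ (rho `^ (- k) * t `^ (- k) * (beta + 1) * a + rho `^ m * (k * (beta + 1) / m * a / t `^ k))).
  rewrite tkN le_eqVlt; apply/orP; left; apply/eqP; field.
  by rewrite !gt_eqF.
apply: lerD; last by move: h3; congr (_ <= _); ring.
by rewrite le_eqVlt; apply/orP; left; apply/eqP; ring.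
Qed.

(** The star competes in its own infimum, which closes the chain: Cheeger constant, quotient of the
    star, [Lam], and again the Cheeger constant by [cheeger_ge], each at most the next. *)
Lemma cheeger_star : cheeger alpha beta Star =
  (weighted_perimeter alpha Star / weighted_area beta Star)%E /\
  (cheeger alpha beta Star <= Lam%:E)%E.
Proof.
have b1 : 0 < beta + 1 by exact: le_lt_trans ab.
have a1 : 0 < alpha + 1 by move: a0 => h; lra.
have k0 : 0 < k by move: ab; rewrite /k => h; lra.
have [kap0 kapf] := kappa_fin a0 ab.
have [FP [M FM]] := star_profile_is_profile k0 t0.
have SE : Star = graph_region t (fun y => t * star_profile alpha beta (y / t)).
  exact: dilate_Omega_star.
have SH : Star `<=` half_plane by rewrite SE => p [_ /andP[]].
have Sb : bounded_set Star.
  rewrite SE; exists (Num.max M t); split; first exact: num_real.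
  move=> B hB p [h pt]; have /andP[p0 pt'] := pt.
  apply: (le_trans _ (ltW hB)); rewrite prod_normE ge_max !le_max.
  by rewrite (le_trans (ltW h) (FM _ pt))/= gtr0_norm// (ltW pt') orbT.
have area := star_area a0 ab t0.
have A0 : 0 < 2 * (alpha + 1) / ((beta - alpha + 1) * (beta + 1)) * t `^ (beta + 2) *
    fine (kappa alpha beta).
  have kap : 0 < fine (kappa alpha beta) by rewrite -lte_fin fineK.
  by rewrite !mulr_gt0 ?powR_gt0 ?invr_gt0 ?mulr_gt0.
have ge := cheeger_ge Sb SH erefl.
have le1 : (cheeger alpha beta Star <= weighted_perimeter alpha Star / weighted_area beta Star)%E.
  apply: ereal_inf_lbound; exists Star => //; split => //.
  - exists Star; first by rewrite SE; exact: (measurable_graph_region FP).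
    by exists set0; rewrite ?setU0//; exact: negligible_set0.
  - by rewrite /Star area lte_fin.
  - by rewrite /Star area ltry.
have le2 : (weighted_perimeter alpha Star / weighted_area beta Star <= Lam%:E)%E.
  have := star_perimeter_le a0 ab t0; rewrite -/Star area -/k -/Lam inver gt_eqF//.
  move: (_ * fine _) A0 => a aa h.
  have ai : (0 <= (a^-1)%:E :> \bar R)%E by rewrite lee_fin invr_ge0 ltW.
  apply: (le_trans (lee_wpmul2r ai h)).
  by rewrite -!EFinM lee_fin mulfK// gt_eqF.
split; last exact: le_trans le1 le2.
by apply/eqP; rewrite eq_le le1 (le_trans le2 ge).
Qed.

End bounds.
End cheeger.

Unset Implicit Arguments.
Set Strict Implicit.

Theorem theorem3p1 (R : realType) (alpha beta : R) (Omega : set (R * R))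
    (halpha : 0 <= alpha) (hab : alpha < beta + 1) (hba : beta <= 2 * alpha)
    (Omega_neq0 : Omega !=set0) (Omega_bounded : bounded_set Omega)
    (Omega_open : open Omega) (Omega_half_plane : Omega `<=` half_plane) :
  (exists t : R, 0 < t /\
     weighted_area beta (dilate t (Omega_star alpha beta))
     = weighted_area beta Omega) /\
  (forall t : R, 0 < t ->
     weighted_area beta (dilate t (Omega_star alpha beta))
     = weighted_area beta Omega ->
     (cheeger alpha beta Omega
        >= cheeger alpha beta (dilate t (Omega_star alpha beta)))%E /\
     (cheeger alpha beta (dilate t (Omega_star alpha beta))
      = weighted_perimeter alpha (dilate t (Omega_star alpha beta))
        / weighted_area beta (dilate t (Omega_star alpha beta)))%E).
Proof.
have b1 : 0 < beta + 1 by exact: le_lt_trans hab.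
split.
  have [a aa ->] := weighted_area_open b1 Omega_neq0 Omega_bounded Omega_open Omega_half_plane.
  have [kap0 kapf] := kappa_fin halpha hab.
  pose c := 2 * (alpha + 1) / ((beta - alpha + 1) * (beta + 1)) * fine (kappa alpha beta).
  have kap : 0 < fine (kappa alpha beta) by rewrite -lte_fin fineK.
  have a1 : 0 < alpha + 1 by lra.
  have k0 : 0 < beta - alpha + 1 by lra.
  have c0 : 0 < c by rewrite !mulr_gt0 ?invr_gt0 ?mulr_gt0.
  have ac : 0 < a / c by rewrite divr_gt0.
  have t0 : 0 < (a / c) `^ (beta + 2)^-1 by exact: powR_gt0.
  have b2 : 0 < beta + 2 by lra.
  (* The area of the dilate is [c t^(beta+2)], to be equated with the area [a] of [Omega]. *)
  exists ((a / c) `^ (beta + 2)^-1); split => //.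
  rewrite star_area// -powRrM mulVf ?gt_eqF// powRr1 ?(ltW ac)//; congr (_%:E).
  by rewrite mulrAC -/c mulrC divfK// gt_eqF.
move=> t t0 areaE.
have [eqS leS] := cheeger_star halpha hab hba t0.
split => //; apply: (le_trans leS).
exact: cheeger_ge.
Qed.
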